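(* Let $d\ge 2$ and let $g:=\{\mathcal G_n\}_{n\in\mathbb{Z}^d}$ be a Gaussian sequence of identically distributed, centred, one-dimensional Gaussian random variables such that there exists $\beta>0$ for which $$\mathbb{E}[\mathcal G_n\mathcal G_{n'}]=(1+|n-n'|)^{-\beta}\qquad\text{for any }n,n'\in\mathbb{Z}^d .$$ Let $\ell\ge1$ and let $h=\widehat h(\cdot/\ell)$ with $\widehat h$ compactly supported in the unit ball, normalised by $\sum_{n\in\mathbb{Z}^d}h(n)=\ell^d\,\nu$ for some $\nu\in\mathbb{R}^d$. Let $\bar u$ be the unique decaying solution on $\mathbb{Z}^d$ of $$-\Delta\bar u=\nabla\cdot g\nabla v\qquad\text{with}\qquad -\Delta v=\nabla\cdot h ,$$ where $(g\nabla v)(n)=\mathcal G_n\nabla v(n)$. Then there exists $\beta_d>d$ such that for any $\beta\ge\beta_d$ we have, in the regime $L\gg\ell$, $$\mathbb{E}\Big[\big|\nabla\bar u(0)-\mathbb{E}\big[\nabla\bar u(0)\,\big|\,\mathcal F_L\big]\big|^2\Big]^{\frac12}\gtrsim_\beta\Big(\frac\ell L\Big)^dL^{-\frac d2},$$ where $\mathbb{E}[\,\cdot\,|\mathcal F_L]$ denotes the conditional expectation with respect to the family $\mathcal F_L:=\{\mathcal G_n:\ |n|_\infty\le L\}$.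
   Context: On the lattice $\mathbb{Z}^d$, $\nabla$ is the finite-difference gradient $\nabla u(n)=(u(n+e_i)-u(n))_{1\le i\le d}$, $\nabla\cdot$ is the corresponding discrete divergence $\nabla\cdot F(n)=\sum_{i=1}^d(F_i(n)-F_i(n-e_i))$, and $\Delta=\nabla\cdot\nabla$ is the discrete Laplacian. $|\cdot|$ is the Euclidean norm and $|\cdot|_\infty$ the sup norm. The symbol $\gtrsim_\beta$ means $\ge$ up to a positive multiplicative constant depending on $\beta$.
   Formalization: The lower bound carries an extra factor |ν| on the right-hand side: as written it fails for ĥ=0, ν=0 (left side 0, right side positive) and under scaling of ĥ; for each ν≠0 the stated bound holds with constant c(d,β)|ν|. *)

(* Defs.v *)
From HB Require Import structures.
From mathcomp Require Import all_boot all_order all_algebra.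
From mathcomp Require Import all_classical all_reals all_analysis.

Set Implicit Arguments.
Unset Strict Implicit.
Unset Printing Implicit Defensive.

Import Order.TTheory GRing.Theory Num.Theory.
Import numFieldNormedType.Exports.

Local Open Scope classical_set_scope.
Local Open Scope ring_scope.

Section Lattice.
Variables (R : realType) (d : nat).

(* The library norm `|x| on 'rV[R]_d is the sup norm. *)
Definition enorm (x : 'rV[R]_d) : R := Num.sqrt (\sum_i x 0 i ^+ 2).

Definition toR (n : 'rV[int]_d) : 'rV[R]_d := map_mx intr n.

Definition basis_vec (i : 'I_d) : 'rV[int]_d := delta_mx 0 i.

Definition grad (u : 'rV[int]_d -> R) (n : 'rV[int]_d) : 'rV[R]_d :=
  \row_i (u (n + basis_vec i) - u n).

Definition div (F : 'rV[int]_d -> 'rV[R]_d) (n : 'rV[int]_d) : R :=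
  \sum_i (F n 0 i - F (n - basis_vec i) 0 i).

Definition laplacian (u : 'rV[int]_d -> R) : 'rV[int]_d -> R := div (grad u).

Definition decays (u : 'rV[int]_d -> R) : Prop :=
  forall eps : R, 0 < eps ->
    exists r : R, forall n, r <= enorm (toR n) -> `|u n| <= eps.

(* Such a u is unique: a decaying harmonic function on the lattice is zero. *)
Definition decaying_solution (F : 'rV[int]_d -> 'rV[R]_d)
    (u : 'rV[int]_d -> R) : Prop :=
  (forall n, - laplacian u n = div F n) /\ decays u.

Definition supp (f : 'rV[R]_d -> 'rV[R]_d) : set 'rV[R]_d :=
  closure [set x | f x != 0].

End Lattice.

Section Probability.
Context (disp : measure_display) (T : measurableType disp) (R : realType).
Variable P : probability T R.

(* Degenerate (Dirac) laws count as Gaussian; the library's normal_prob is a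
   genuine normal law only when the standard deviation s is nonzero. *)
Definition is_gaussian (X : T -> R) : Prop :=
  exists m s : R, forall A : set R, measurable A ->
    P (X @^-1` A) = if s == 0 then dirac m A else normal_prob m s A.

Definition jointly_gaussian (I : Type) (X : I -> T -> R) : Prop :=
  forall (J : seq I) (a : I -> R),
    is_gaussian (fun w => \sum_(i <- J) a i * X i w).

Definition identically_distributed (I : Type) (X : I -> T -> R) : Prop :=
  forall (i j : I) (A : set R), measurable A ->
    P (X i @^-1` A) = P (X j @^-1` A).

Definition sigma_family (I : Type) (D : set I) (X : I -> T -> R)
    : set (set T) :=
  <<s \bigcup_(i in D) preimage_set_system setT (X i) measurable >>.

(* Y is a version of the conditional expectation of X given the
   sigma-algebra F. *)
Definition is_cond_expectation (F : set (set T)) (X Y : T -> R) : Prop :=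
  [/\ preimage_set_system setT Y measurable `<=` F,
      P.-integrable setT (EFin \o Y) &
      forall A, F A ->
        (\int[P]_(w in A) (Y w)%:E = \int[P]_(w in A) (X w)%:E)%E].

End Probability.

(* Main.v *)
(* Because -Delta has a decaying Green dipole w_k, the increment u(e_k) - u(0) of the solution
   is the almost sure limit of Gaussian sums S_M = sum_n a_M(n) G_n, where away from the
   cutoff a_M(n) = grad v(n) . grad w_k(n). For beta large the covariance of (G_n) is a small
   perturbation of the identity, so its quadratic form lies between 1/2 and 3/2 of the l^2 norm.
   The upper bound makes S_M converge in mean square; the lower bound, applied to the component
   of S_M orthogonal to the G_n with |n| <= L, bounds the conditional variance from below by the
   sum over |n| > L of (grad v . grad w_k)^2. Orthogonal Gaussian components are uncorrelated
   with every F_L-measurable variable: if D is orthogonal to W, then W + sD and W - sD have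
   the same law, which at s = 0 gives E[D cos W] = 0.

   Summed over k, grad w_k is nondegenerate, of size |n|^-d, since w_k is asymptotically a
   derivative of a radial potential. It remains to see that grad v carries the mass of h through
   every annulus: the field grad(x_i cutoff) - swirl, with a divergence-free swirl equal to e_i
   near the origin, is supported in an annulus, and pairing it with grad v gives the i-th
   component of sum h. Cauchy-Schwarz on an annulus of size L then yields the factor
   l^(2d) L^(-3d). *)
Require Import Defs.
From HB Require Import structures.
From mathcomp Require Import all_boot all_order all_algebra.
From mathcomp Require Import all_classical all_reals all_analysis.
From mathcomp Require Import measurable_realfun.
From mathcomp Require Import zify ring lra.

Set Implicit Arguments.
Unset Strict Implicit.
Unset Printing Implicit Defensive.

Import Order.TTheory GRing.Theory Num.Theory.
Import numFieldNormedType.Exports.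

Local Open Scope classical_set_scope.
Local Open Scope ring_scope.

(** * Finite differences on the lattice *)

Section Boxes.
Variable d : nat.
Implicit Types (n m : 'rV[int]_d) (N : nat).

(** No Fourier analysis enters: the dipoles w_k are controlled by maximum principles and Taylor
    expansions. A Green function is avoided, since none decays when d = 2; the dipole source is odd
    under the reflection exchanging 0 and e_k, so w_k solves a Dirichlet problem in a half space,
    where positivity is available. Its leading behaviour comes from an explicit potential [gamma]
    whose negative Laplacian [rho] is positive with finite mass [kappa]: an increment of [gamma] is
    the convolution of [rho] with w_k, hence close to [kappa] times w_k, and an interior gradient
    estimate passes this on to gradients. On the probabilistic side [ubar] is only known to decay
    for almost every realisation, with no control of moments, so the representation by Gaussian sums
    is pathwise and Fatou's lemma makes it a mean square statement. The exponent 3d collects |grad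
    w_k|^2, of order L^(-2d), and the annulus volume L^d lost in Cauchy-Schwarz. *)

Definition nsup n : nat := \max_(i < d) absz (n 0%R i).

Lemma nsup_leP n N : reflect (forall i, (absz (n 0%R i) <= N)%N) (nsup n <= N)%N.
Proof.
apply: (iffP (bigmax_leqP _ _ _)) => H i //; first exact: H.
Qed.

Lemma leq_nsup n i : (absz (n 0%R i) <= nsup n)%N.
Proof. exact: (@leq_bigmax _ (fun i => absz (n 0%R i))). Qed.

Lemma entryD n m i : (n + m) 0 i = n 0 i + m 0 i.
Proof. by rewrite mxE. Qed.

Lemma entryN n i : (- n) 0 i = - n 0 i.
Proof. by rewrite mxE. Qed.

Lemma entryB n m i : (n - m) 0 i = n 0 i - m 0 i.
Proof. by rewrite entryD entryN. Qed.

Lemma entry_basis (i j : 'I_d) : basis_vec i 0 j = (j == i)%:Z.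
Proof. by rewrite mxE eqxx /= natz. Qed.

Lemma nsupD n m : (nsup (n + m)%R <= nsup n + nsup m)%N.
Proof.
apply/nsup_leP => i; rewrite entryD.
by have := leq_nsup n i; have := leq_nsup m i; lia.
Qed.

Lemma nsupN n : nsup (- n) = nsup n.
Proof. by apply: eq_bigr => i _; rewrite mxE abszN. Qed.

Lemma nsup0 : nsup 0 = 0%N.
Proof. by rewrite /nsup big1 // => i _; rewrite mxE. Qed.

Lemma nsup_eq0 n : nsup n = 0%N -> n = 0.
Proof.
move=> n0; apply/rowP => i; rewrite mxE; apply/eqP; rewrite -absz_eq0.
by have := leq_nsup n i; rewrite n0 leqn0.
Qed.

Lemma nsup_basis (i : 'I_d) : nsup (basis_vec i) = 1%N.
Proof.
apply/eqP; rewrite eqn_leq; apply/andP; split.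
  by apply/nsup_leP => j; rewrite mxE eqxx /=; case: (_ == _).
by have := leq_nsup (basis_vec i) i; rewrite mxE !eqxx.
Qed.

Lemma nsup_addb n (i : 'I_d) : (nsup (n + basis_vec i)%R <= (nsup n).+1)%N.
Proof. by rewrite (leq_trans (nsupD _ _)) // nsup_basis addn1. Qed.

Lemma nsup_subb n (i : 'I_d) : (nsup (n - basis_vec i)%R <= (nsup n).+1)%N.
Proof. by rewrite (leq_trans (nsupD _ _)) // nsupN nsup_basis addn1. Qed.

Definition box_point N (f : {ffun 'I_d -> 'I_(2 * N).+1}) : 'rV[int]_d :=
  \row_i ((f i : nat)%:Z - N%:Z).

Lemma box_pointE N f i : @box_point N f 0 i = (f i : nat)%:Z - N%:Z.
Proof. by rewrite mxE. Qed.

Lemma box_subproof N : {s : seq 'rV[int]_d | [/\ uniq s,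
  size s = ((2 * N).+1 ^ d)%N & forall n, (n \in s) = (nsup n <= N)%N]}.
Proof.
exists [seq box_point f | f : {ffun 'I_d -> 'I_(2 * N).+1}]; split.
- rewrite map_inj_uniq ?enum_uniq // => f g /rowP fg.
  by apply/ffunP => i; apply: val_inj; move: (fg i); rewrite !box_pointE => /addIr [].
- by rewrite size_map -cardT card_ffun !card_ord.
move=> n; apply/mapP/nsup_leP => [[f _ ->] i|H].
  by rewrite box_pointE; case: (f i) => k /=; rewrite ltnS; lia.
exists [ffun i => inord (absz (n 0 i + N%:Z)%R)]; first by rewrite mem_enum.
apply/rowP => i; rewrite box_pointE ffunE inordK; last by have := H i; lia.
have E (z : int) : (absz z <= N)%N -> z = (absz (z + N%:Z)%R)%:Z - N%:Z by lia.
exact: E.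
Qed.

Definition box N : seq 'rV[int]_d := sval (box_subproof N).

Lemma mem_box N n : (n \in box N) = (nsup n <= N)%N.
Proof. by rewrite /box; case: box_subproof => s []. Qed.

Lemma box_uniq N : uniq (box N).
Proof. by rewrite /box; case: box_subproof => s []. Qed.

Lemma size_box N : size (box N) = ((2 * N).+1 ^ d)%N.
Proof. by rewrite /box; case: box_subproof => s []. Qed.

Lemma big_uniq_eq (V : nmodType) (T : eqType) (s t : seq T) (f : T -> V) :
  uniq s -> uniq t -> (forall x, f x != 0 -> (x \in s) = (x \in t)) ->
  \sum_(x <- s) f x = \sum_(x <- t) f x.
Proof.
move=> us ut H.
rewrite (bigID (fun x => f x != 0)) /= [X in _ + X]big1 ?addr0; last first.
  by move=> i /negPn/eqP.
rewrite [RHS](bigID (fun x => f x != 0)) /= [X in _ = _ + X]big1 ?addr0; last first.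
  by move=> i /negPn/eqP.
rewrite -!(big_filter _ (fun x => f x != 0)).
apply: perm_big; apply: uniq_perm; rewrite ?filter_uniq // => x.
by rewrite !mem_filter; case: (boolP (f x != 0)) => //= /H.
Qed.

Lemma box_widen (V : nmodType) (f : 'rV[int]_d -> V) N N' :
  (forall n, (N < nsup n)%N -> f n = 0) -> (N <= N')%N ->
  \sum_(n <- box N') f n = \sum_(n <- box N) f n.
Proof.
move=> f0 NN'; apply: big_uniq_eq; rewrite ?box_uniq // => n fn0.
have : (nsup n <= N)%N by rewrite leqNgt; apply: contra fn0 => /f0 ->.
by move=> nN; rewrite !mem_box nN (leq_trans nN NN').
Qed.

Lemma box_shift (V : nmodType) (f : 'rV[int]_d -> V) N N' a :
  (forall n, (N < nsup n)%N -> f n = 0) -> (N + nsup a <= N')%N ->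
  \sum_(n <- box N') f (n + a) = \sum_(n <- box N') f n.
Proof.
move=> f0 NN'; rewrite -(big_map (fun n => n + a) predT f).
apply: big_uniq_eq; rewrite ?box_uniq //.
  by rewrite map_inj_uniq ?box_uniq //; exact: addIr.
move=> n fn0.
have nN : (nsup n <= N)%N by rewrite leqNgt; apply: contra fn0 => /f0 ->.
rewrite mem_box (leq_trans nN) ?(leq_trans (leq_addr _ _) NN') //.
apply/mapP; exists (n - a); last by rewrite subrK.
rewrite mem_box (leq_trans (nsupD _ _)) // nsupN (leq_trans _ NN') //.
by rewrite leq_add2r.
Qed.

(** Mean value estimate for k-th powers with step 2, the difference of the side lengths of
    consecutive boxes; it serves to count a shell as the difference of two boxes. *)
Lemma expn_add2_sub (a k : nat) : ((a + 2) ^ k <= a ^ k + 2 * k * (a + 2) ^ k.-1)%N.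
Proof.
elim: k => // k IH; rewrite !expnS /=.
have E : ((a + 2) * (a + 2) ^ k.-1 * k = (a + 2) ^ k * k)%N.
  by case: k {IH} => [|k]; rewrite ?muln0 //= expnS.
have H : (a ^ k <= (a + 2) ^ k)%N by case: k {IH E} => // k; rewrite leq_exp2r // leq_addr.
nia.
Qed.

Lemma box_split N (V : nmodType) (P : pred 'rV[int]_d) (f : 'rV[int]_d -> V) :
  \sum_(n <- box N.+1 | P n) f n =
  \sum_(n <- box N | P n) f n + \sum_(n <- box N.+1 | P n && (nsup n == N.+1)) f n.
Proof.
rewrite (bigID (fun n => nsup n == N.+1)) /= addrC; congr (_ + _).
rewrite -big_filter -[RHS]big_filter; apply: perm_big; apply: uniq_perm;
  rewrite ?filter_uniq ?box_uniq // => n.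
rewrite !mem_filter !mem_box; case: (P n) => //=.
by rewrite (leq_eqVlt _ N.+1) ltnS; case: eqP => [->|] //=; rewrite ltnn.
Qed.

Lemma shell_card N :
  (count (fun n => nsup n == N.+1) (box N.+1) <= 2 * d * (2 * N + 3) ^ d.-1)%N.
Proof.
have it k : iter k (+%R 1%N) 0 = k by elim: k => //= k ->.
have := box_split N xpredT (fun=> 1%N : nat).
rewrite !big_const_seq !it !count_predT !size_box => E.
have := expn_add2_sub (2 * N).+1 d.
have -> : ((2 * N).+1 + 2 = (2 * N.+1).+1)%N by lia.
have -> : ((2 * N + 3) = (2 * N.+1).+1)%N by lia.
by rewrite {}E leq_add2l.
Qed.

End Boxes.

Section Decay.
Variables (R : realType) (d : nat).
Implicit Types (n m : 'rV[int]_d) (N : nat).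

(** Shifted by one so that powers of its inverse express decay rates down to the origin without a
    case distinction. *)
Definition jap n : R := (nsup n).+1%:R.

Lemma jap_ge1 n : 1 <= jap n.
Proof. by rewrite /jap ler1n. Qed.

Lemma jap_gt0 n : 0 < jap n.
Proof. by rewrite /jap ltr0n. Qed.

Lemma jap_neq0 n : jap n != 0.
Proof. by rewrite gt_eqF ?jap_gt0. Qed.

Lemma jap_step n m : (nsup m <= 1)%N -> jap n <= 2 * jap (n + m).
Proof.
move=> m1; rewrite /jap -natrM ler_nat.
have := nsupD (n + m) (- m); rewrite addrK nsupN; lia.
Qed.

(** A shell of radius N + 1 has O((N + 2)^(d - 1)) points, hence contributes O((N + 2)^(-2)), which
    a telescoping difference dominates. The [maxn] makes the bound vanish while the range m <= |n|
    <= N is empty, so that the induction on [N] can start. *)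
Lemma sum_jap_shells (m N : nat) :
  \sum_(n <- box d N | (m <= nsup n)%N) (jap n)^-1 ^+ d.+1
  <= (2 * (2 * d * 2 ^ d).+1)%:R * (m.+1%:R^-1 - (maxn m N.+1).+1%:R^-1).
Proof.
set K : R := _%:R.
have K0 : 0 <= K by rewrite ler0n.
have tel k : ((k.+1%:R : R)^-1 ^+ 2) <= 2 * (k.+1%:R^-1 - k.+2%:R^-1).
  have k1 : 0 < (k.+1%:R : R) by rewrite ltr0n.
  have k2 : (k.+2%:R : R) = k.+1%:R + 1 by rewrite -natr1.
  have k3 : 1 <= (k.+1%:R : R) by rewrite ler1n.
  rewrite k2; move: (k.+1%:R : R) k1 k3 => x x0 x1.
  have -> : 2 * (x^-1 - (x + 1)^-1) = x^-1 ^+ 2 + x^-1 ^+ 2 * ((x - 1) / (x + 1)).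
    by field; rewrite !gt_eqF //; lra.
  by rewrite lerDl mulr_ge0 ?sqr_ge0 // divr_ge0 //; lra.
elim: N => [|N IH].
  rewrite big_mkcond /= (@big_uniq_eq R _ _ [:: 0]) ?box_uniq //; last first.
    move=> n _; rewrite mem_box inE leqn0.
    by apply/eqP/eqP => [/nsup_eq0 //|->]; rewrite nsup0.
  rewrite big_seq1 nsup0 leqn0; case: eqP => [->|/eqP m0].
    rewrite /jap nsup0 invr1 expr1n max0n.
    have : 2 <= K by rewrite /K natrM ler_pMr ?ler1n.
    by move=> K2; lra.
  by rewrite (maxn_idPl _) ?lt0n // subrr mulr0.
have [mN|Nm] := leqP m N.+1; last first.
  rewrite big1_seq; last by move=> n; rewrite mem_box; lia.
  by rewrite (maxn_idPl _) // subrr mulr0.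
rewrite box_split /=.
have -> : maxn m N.+2 = N.+2 by apply/maxn_idPr; lia.
have E : maxn m N.+1 = N.+1 by apply/maxn_idPr; lia.
rewrite E in IH.
suff H : \sum_(n <- box d N.+1 | (m <= nsup n)%N && (nsup n == N.+1)) (jap n)^-1 ^+ d.+1
   <= K * (N.+2%:R^-1 - N.+3%:R^-1).
  by apply: le_trans (lerD IH H) _; rewrite -mulrDr addrA subrK.
apply: (@le_trans _ _ (\sum_(n <- box d N.+1 | nsup n == N.+1) N.+2%:R^-1 ^+ d.+1)).
  rewrite big_mkcond [leRHS]big_mkcond /=; apply: ler_sum => n _.
  have [E2|//] := eqVneq (nsup n) N.+1; last by rewrite andbF.
  by rewrite andbT /jap E2; case: ifP => // _; rewrite exprn_ge0 // invr_ge0.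
rewrite -big_filter big_const_seq iter_addr_0 count_predT size_filter.
have := shell_card d N.
set c := count _ _ => cle.
have N2 : 0 < (N.+2%:R : R) by rewrite ltr0n.
have cle2 : (c%:R : R) <= (2 * d * 2 ^ d)%:R * N.+2%:R ^+ d.-1.
  rewrite -natrX -natrM ler_nat (leq_trans cle) // -!mulnA leq_mul2l /=.
  case: d => // e /=.
  rewrite leq_mul2l /= expnS.
  have : ((2 * N + 3) ^ e <= (2 * N.+2) ^ e)%N.
    by case: e => // e; rewrite leq_exp2r //; lia.
  rewrite expnMn; nia.
rewrite -[leLHS]mulr_natl.
apply: (@le_trans _ _ ((2 * d * 2 ^ d)%:R * N.+2%:R^-1 ^+ 2)).
  case: d c {cle} cle2 => [|e] c cle2.
    move: cle2; rewrite !muln0 !mul0n !mul0r => c0.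
    by rewrite mulr_le0_ge0 ?exprn_ge0 ?invr_ge0 ?ler0n.
  have -> : N.+2%:R^-1 ^+ 2 = (N.+2%:R ^+ e) * (N.+2%:R^-1 ^+ e.+2) :> R.
    by rewrite -(addn2 e) exprD mulrA -exprMn divff ?gt_eqF // expr1n mul1r.
  by rewrite [leRHS]mulrA ler_wpM2r // exprn_ge0 // invr_ge0 ltW.
apply: (@le_trans _ _ ((2 * d * 2 ^ d)%:R * (2 * (N.+2%:R^-1 - N.+3%:R^-1)))).
  by rewrite ler_wpM2l.
rewrite [leLHS]mulrA ler_wpM2r //.
  by rewrite subr_ge0 lef_pV2 ?posrE ?ltr0n // ler_nat.
by rewrite -natrM /K ler_nat mulnC leq_mul2l leqnSn.
Qed.

Lemma sum_jap : exists2 C : R, 0 < C & forall m N : nat,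
  \sum_(n <- box d N | (m <= nsup n)%N) (jap n)^-1 ^+ d.+1 <= C / m.+1%:R.
Proof.
exists ((2 * (2 * d * 2 ^ d).+1)%:R); first by rewrite ltr0n.
move=> m N; apply: le_trans (sum_jap_shells m N) _.
by rewrite ler_wpM2l ?ler0n // gerBl invr_ge0 ler0n.
Qed.

End Decay.

Section SummationByParts.
Variables (R : realType) (d : nat).
Implicit Types (f g u : 'rV[int]_d -> R) (N : nat).

Definition supported f N := forall n, (N < nsup n)%N -> f n = 0.

Lemma laplacianE u n : laplacian u n =
  \sum_i (u (n + basis_vec i) + u (n - basis_vec i) - 2 * u n).
Proof. by apply: eq_bigr => i _; rewrite !mxE subrK; ring. Qed.

(** Green's identity. One factor has bounded support, and one extra layer of the box leaves room for
    the unit shifts. *)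
Lemma sum_laplacian_sym u g N N' : supported g N -> (N.+1 <= N')%N ->
  \sum_(n <- box d N') u n * laplacian g n = \sum_(n <- box d N') laplacian u n * g n.
Proof.
move=> g0 NN'.
under eq_bigr do rewrite laplacianE mulr_sumr.
under [RHS]eq_bigr do rewrite laplacianE mulr_suml.
rewrite exchange_big [RHS]exchange_big /=; apply: eq_bigr => i _.
under eq_bigr do rewrite mulrBr mulrDr.
under [RHS]eq_bigr do rewrite mulrBl mulrDl.
rewrite !sumrB !big_split /=; congr (_ - _); last first.
  by apply: eq_bigr => n _; ring.
rewrite addrC; congr (_ + _).
  rewrite -(@box_shift _ _ (fun n => u (n + basis_vec i) * g n) N N' (- basis_vec i)) //.
  - by apply: eq_bigr => n _; rewrite subrK.
  - by move=> n /g0 ->; rewrite mulr0.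
  - by rewrite nsupN nsup_basis addn1.
rewrite -(@box_shift _ _ (fun n => u (n - basis_vec i) * g n) N N' (basis_vec i)) //.
- by apply: eq_bigr => n _; rewrite addrK.
- by move=> n /g0 ->; rewrite mulr0.
- by rewrite nsup_basis addn1.
Qed.

Lemma sum_div (F : 'rV[int]_d -> 'rV[R]_d) g N N' : supported g N -> (N.+1 <= N')%N ->
  \sum_(n <- box d N') div F n * g n =
  - \sum_(n <- box d N') \sum_i F n 0 i * grad g n 0 i.
Proof.
move=> g0 NN'.
under eq_bigr do rewrite /div mulr_suml.
rewrite exchange_big [in RHS]exchange_big /= -sumrN; apply: eq_bigr => i _.
under eq_bigr do rewrite mulrBl.
rewrite sumrB -[RHS]sumrN.
rewrite -(@box_shift _ _ (fun n => F (n - basis_vec i) 0 i * g n) N N' (basis_vec i)) //.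
- rewrite -sumrB; apply: eq_bigr => n _; rewrite mxE addrK; ring.
- by move=> n /g0 ->; rewrite mulr0.
- by rewrite nsup_basis addn1.
Qed.

End SummationByParts.

(** * Decaying dipole potentials *)

Section Taylor.
Variable R : realType.
Implicit Types (p t u : R).

(** The mean value theorem replaces integration: the factor 1/(k + 1) is lost, which only enlarges
    constants. Iterating it yields the expansions below. *)
Lemma growth_from_derivative (g g' : R -> R) (C : R) k :
  (forall t, `|t| <= 1/2 -> is_derive t 1 g (g' t)) -> g 0 = 0 ->
  (forall t, `|t| <= 1/2 -> `|g' t| <= C * `|t| ^+ k) ->
  forall t, `|t| <= 1/2 -> `|g t| <= C * `|t| ^+ k.+1.
Proof.
move=> dg g0 bg t t2.
have C0 : 0 <= C.
  have h : `|1/2 : R| <= 1/2 by rewrite ger0_norm //; lra.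
  have := le_trans (normr_ge0 _) (bg _ h); rewrite pmulr_lge0 //.
  by rewrite exprn_gt0 // normr_gt0; lra.
have cg a b : `|a| <= 1/2 -> `|b| <= 1/2 -> {within `[a, b], continuous g}.
  rewrite !ler_norml => a2 b2.
  apply: derivable_within_continuous => x; rewrite in_itv /= => xab.
  have [|dx _] := dg x; last exact: dx.
  by rewrite ler_norml; lra.
(* The sign [c] lets one argument serve both [0, t] and [t, 0]. *)
have key a b c : a <= b -> `|a| <= `|t| -> `|b| <= `|t| -> b - a = c * t -> `|c| = 1 ->
    (exists2 x, x \in `[a, b] & g b - g a = g' x * (b - a)) -> 
    `|g b - g a| <= C * `|t| ^+ k.+1.
  move=> ab at_ bt bac c1 [x xab ->]; rewrite bac !normrM c1 mul1r exprSr mulrA ler_wpM2r //.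
  have xt : `|x| <= `|t|.
    move: xab at_ bt; rewrite in_itv /= !ler_norml; lra.
  apply: le_trans (bg _ (le_trans xt t2)) _.
  by rewrite ler_wpM2l // lerXn2r ?nnegrE.
have z2 : `|0 : R| <= 1/2 by rewrite normr0; lra.
have [t0|t0] := leP 0 t.
  have [|x xi E] := @MVT_segment R g g' 0 t t0 _ (cg _ _ z2 t2).
    move=> x; rewrite in_itv /= => xt; apply: dg; move: t2; rewrite !ler_norml; lra.
  have := key 0 t 1 t0; rewrite g0 !subr0; apply => //.
  - by rewrite normr0.
  - by rewrite mul1r.
  - by rewrite normr1.
  - by exists x => //; move: E; rewrite g0 !subr0.
have [|x xi E] := @MVT_segment R g g' t 0 (ltW t0) _ (cg _ _ t2 z2).
  move=> x; rewrite in_itv /= => xt; apply: dg; move: t2; rewrite !ler_norml; lra.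
rewrite -normrN; have := key t 0 (-1) (ltW t0); rewrite g0 !sub0r; apply => //.
- by rewrite normr0.
- by rewrite mulN1r.
- by rewrite normrN normr1.
- by exists x => //; move: E; rewrite g0 !sub0r.
Qed.

Lemma is_derive_cubic (a b c e t : R) :
  is_derive t 1 (fun x => a + b * x + c * x ^+ 2 + e * x ^+ 3)
    (b + 2 * c * t + 3 * e * t ^+ 2).
Proof.
pose P : {poly R} := a%:P + b *: 'X + c *: 'X^2 + e *: 'X^3.
have -> : (fun x => a + b * x + c * x ^+ 2 + e * x ^+ 3) = horner P.
  by apply/funext => x; rewrite /P !hornerE.
have -> : b + 2 * c * t + 3 * e * t ^+ 2 = P^`().[t].
  rewrite /P !(derivD, derivZ, derivC, derivX, derivXn) !hornerE /=; ring.
exact: is_derive_poly.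
Qed.

Lemma is_derive_ext (f g : R -> R) t (a b : R) :
  is_derive t 1 f a -> f =1 g -> a = b -> is_derive t 1 g b.
Proof. by move=> df /funext <- <-. Qed.

Definition powT p t : R := (1 + t) `^ (- p).

Lemma is_derive_powT p t : `|t| <= 1/2 ->
  is_derive t 1 (powT p) (- p * powT (p + 1) t).
Proof.
rewrite ler_norml => t2.
have t1 : 0 < 1 + t by lra.
have lin : is_derive t 1 (fun x : R => 1 + x : R) 1.
  by apply: is_derive_ext (is_derive_cubic 1 1 0 0 t) _ _ => [x|]; ring.
apply: is_derive_ext (is_derive1_comp (is_derive1_powR (- p) t1) lin) _ _ => //.
by rewrite mulr1 /powT opprD.
Qed.

Lemma powT_bound p t : 0 <= p -> `|t| <= 1/2 -> `|powT p t| <= 2 `^ p.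
Proof.
rewrite ler_norml => p0 t2; rewrite ger0_norm ?powR_ge0 //.
rewrite /powT powRN -powR_inv1 ?powR_ge0 // -powRrM mulrC powRrM powR_inv1; last lra.
apply: ge0_ler_powR => //; rewrite ?nnegrE ?invr_ge0; try lra.
by rewrite invf_ple ?posrE; lra.
Qed.

Lemma powT0 p : powT p 0 = 1.
Proof. by rewrite /powT addr0 powR1. Qed.

(** Since [powT p] has derivative [- p * powT (p + 1)], each order of the expansion follows from the
    preceding order at exponent [p + 1]. The nested factors of the constants record this recursion,
    which ends at [powT_bound]. *)
Lemma powT_taylor1 p t : 0 <= p -> `|t| <= 1/2 ->
  `|powT p t - 1| <= p * 2 `^ (p + 1) * `|t|.
Proof.
move=> p0; have := @growth_from_derivative (fun t => powT p t - 1)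
   (fun t => - p * powT (p + 1) t) (p * 2 `^ (p + 1)) 0.
move=> H; rewrite -(expr1 `|t|); apply: H => {t}.
- move=> t t2; have d := is_derive_powT p t2.
  by apply: is_derive_ext (is_deriveB d (is_derive_cubic 1 0 0 0 t)) _ _ => [x|]; rewrite ?fctE; ring.
- by rewrite powT0 subrr.
- move=> t t2; rewrite expr0 mulr1 normrM normrN (ger0_norm p0) ler_wpM2l //.
  by apply: powT_bound => //; lra.
Qed.

Lemma powT_taylor2 p t : 0 <= p -> `|t| <= 1/2 ->
  `|powT p t - (1 - p * t)| <= p * ((p + 1) * 2 `^ (p + 2)) * `|t| ^+ 2.
Proof.
move=> p0; apply: (@growth_from_derivative (fun t => powT p t - (1 - p * t))
   (fun t => - p * (powT (p + 1) t - 1))) => {t}.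
- move=> t t2; have d := is_derive_powT p t2.
  by apply: is_derive_ext (is_deriveB d (is_derive_cubic 1 (- p) 0 0 t)) _ _ => [x|]; rewrite ?fctE; field.
- by rewrite powT0; ring.
- move=> t t2; rewrite expr1 normrM normrN (ger0_norm p0) -mulrA ler_wpM2l //.
  by have := @powT_taylor1 (p + 1) t; rewrite -addrA; apply => //; lra.
Qed.

Lemma powT_taylor3 p t : 0 <= p -> `|t| <= 1/2 ->
  `|powT p t - (1 - p * t + p * (p + 1) / 2 * t ^+ 2)|
   <= p * ((p + 1) * ((p + 2) * 2 `^ (p + 3))) * `|t| ^+ 3.
Proof.
move=> p0; apply: (@growth_from_derivative
   (fun t => powT p t - (1 - p * t + p * (p + 1) / 2 * t ^+ 2))
   (fun t => - p * (powT (p + 1) t - (1 - (p + 1) * t)))) => {t}.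
- move=> t t2; have d := is_derive_powT p t2.
  by apply: is_derive_ext (is_deriveB d (is_derive_cubic 1 (- p) (p * (p + 1) / 2) 0 t)) _ _ => [x|]; rewrite ?fctE; field.
- by rewrite powT0; ring.
- move=> t t2; rewrite normrM normrN (ger0_norm p0) -[leRHS]mulrA ler_wpM2l //.
  have := @powT_taylor2 (p + 1) t; rewrite -!addrA.
  have -> : 1 + 1 = 2 :> R by ring.
  have -> : 1 + 2 = 3 :> R by ring.
  by apply => //; lra.
Qed.

Lemma powT_taylor4 p t : 0 <= p -> `|t| <= 1/2 ->
  `|powT p t - (1 - p * t + p * (p + 1) / 2 * t ^+ 2 - p * (p + 1) * (p + 2) / 6 * t ^+ 3)|
   <= p * ((p + 1) * ((p + 2) * ((p + 3) * 2 `^ (p + 4)))) * `|t| ^+ 4.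
Proof.
move=> p0; apply: (@growth_from_derivative
   (fun t => powT p t - (1 - p * t + p * (p + 1) / 2 * t ^+ 2 - p * (p + 1) * (p + 2) / 6 * t ^+ 3))
   (fun t => - p * (powT (p + 1) t - (1 - (p + 1) * t + (p + 1) * (p + 1 + 1) / 2 * t ^+ 2)))) => {t}.
- move=> t t2; have d := is_derive_powT p t2.
  by apply: is_derive_ext (is_deriveB d (is_derive_cubic 1 (- p) (p * (p + 1) / 2) (- (p * (p + 1) * (p + 2) / 6)) t)) _ _ => [x|]; rewrite ?fctE; field.
- by rewrite powT0; ring.
- move=> t t2; rewrite normrM normrN (ger0_norm p0) -[leRHS]mulrA ler_wpM2l //.
  have := @powT_taylor3 (p + 1) t; rewrite -!addrA.
  have -> : 1 + 1 = 2 :> R by ring.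
  have -> : 1 + 2 = 3 :> R by ring.
  have -> : 1 + 3 = 4 :> R by ring.
  by apply => //; lra.
Qed.

(** The primitive is kept abstract because it is a logarithm for p = 1, that is d = 2, and a power
    for larger d. Scaling by [u] reduces the derivative to [powT]. *)
Lemma primitive_taylor p u (q : R -> R) t : 0 <= p -> 0 < u -> `|t| <= 1/2 ->
  (forall x : R, 0 < x -> is_derive x 1 q (- x `^ (- p))) ->
  `|q (u * (1 + t)) - q u - u `^ (1 - p) * (- t + p / 2 * t ^+ 2 - p * (p + 1) / 6 * t ^+ 3)|
   <= u `^ (1 - p) * (p * ((p + 1) * ((p + 2) * 2 `^ (p + 3)))) * `|t| ^+ 4.
Proof.
move=> p0 u0 t2 dq; move: t t2; apply: (@growth_from_derivative
   (fun t => q (u * (1 + t)) - q u - u `^ (1 - p) * (- t + p / 2 * t ^+ 2 - p * (p + 1) / 6 * t ^+ 3))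
   (fun t => - u `^ (1 - p) * (powT p t - (1 - p * t + p * (p + 1) / 2 * t ^+ 2)))).
- move=> t; rewrite ler_norml => t2.
  have t1 : 0 < 1 + t by lra.
  have lin : is_derive t 1 (fun x : R => u * (1 + x) : R) u.
    by apply: is_derive_ext (is_derive_cubic u u 0 0 t) _ _ => [x|]; ring.
  have d := is_derive1_comp (g := fun x : R => u * (1 + x) : R) (dq _ (mulr_gt0 u0 t1)) lin.
  pose v := u `^ (1 - p).
  have E : u * u `^ (- p) = v.
    rewrite /v powRD; last by rewrite (gt_eqF u0) implybT.
    by rewrite powRr1 // ltW.
  have E2 : (u * (1 + t)) `^ (- p) = u `^ (- p) * powT p t by rewrite powRM // ltW.
  apply: is_derive_ext (is_deriveB d (is_derive_cubic (q u) (- v) (v * p / 2) (- (v * p * (p + 1) / 6)) t)) _ _ => [x|].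
    by rewrite !fctE /v; field.
  by rewrite E2 -/v -E; field.
- by rewrite addr0 mulr1; ring.
- move=> t t2; rewrite normrM normrN (ger0_norm (powR_ge0 _ _)) -(mulrA (u `^ (1 - p))) ler_wpM2l ?powR_ge0 //.
  exact: powT_taylor3.
Qed.

End Taylor.

(** * Barrier proof of an interior gradient bound for the discrete Laplacian *)

Section GradientEstimate.
Variables (R : realType) (d : nat).
Implicit Types (n x : 'rV[int]_d) (u f g : 'rV[int]_d -> R).

Definition sq n : R := \sum_i (n 0 i)%:~R ^+ 2.

Lemma sq_addb n (i : 'I_d) : sq (n + basis_vec i) = sq n + 2 * (n 0 i)%:~R + 1.
Proof.
rewrite /sq (bigD1 i) //= [in RHS](bigD1 i) //= entryD entry_basis eqxx /=.
rewrite (eq_bigr (fun j => (n 0 j)%:~R ^+ 2)); last first.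
  by move=> j /negPf ji; rewrite entryD entry_basis ji /= addr0.
by rewrite intrD /=; ring.
Qed.

Lemma sq_subb n (i : 'I_d) : sq (n - basis_vec i) = sq n - 2 * (n 0 i)%:~R + 1.
Proof.
rewrite -{2}(subrK (basis_vec i) n) sq_addb entryB entry_basis eqxx /= intrB /=; ring.
Qed.

Lemma sq_ge0 n : 0 <= sq n.
Proof. by apply: sumr_ge0 => i _; exact: sqr_ge0. Qed.

Lemma coord_sq n (i : 'I_d) : (n 0 i)%:~R ^+ 2 <= sq n.
Proof.
by rewrite /sq (bigD1 i) //= lerDl; apply: sumr_ge0 => j _; exact: sqr_ge0.
Qed.

Lemma abs_coord n (i : 'I_d) : `|(n 0 i)%:~R : R| = (absz (n 0 i))%:R.
Proof. by rewrite -intr_norm [RHS]pmulrn abszE. Qed.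

Lemma sq_le n : sq n <= d%:R * (nsup n)%:R ^+ 2.
Proof.
rewrite -[d in d%:R]card_ord mulr_natl -sumr_const; apply: ler_sum => i _.
rewrite -real_normK ?num_real // abs_coord lerXn2r ?nnegrE ?ler0n //.
by rewrite ler_nat leq_nsup.
Qed.

Lemma sq_ge n : (nsup n)%:R ^+ 2 <= sq n.
Proof.
case: (posnP (nsup n)) => [->|n0]; first by rewrite expr0n /= sq_ge0.
have [i _ ->] : exists2 i, i \in 'I_d & nsup n = absz (n 0%R i).
  have [i0] : exists i : 'I_d, True.
    case: (pickP 'I_d) => [i _|e]; first by exists i.
    by move: n0; rewrite /nsup big1 // => i; have := e i.
  move=> _; have [|i ii E] := @eq_bigmax_cond _ 'I_d (fun i => absz (n 0%R i)).
    by apply/card_gt0P; exists i0.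
  by exists i.
by rewrite -abs_coord real_normK ?num_real // coord_sq.
Qed.

Lemma laplacianD f g n : laplacian (fun m => f m + g m) n = laplacian f n + laplacian g n.
Proof. by rewrite !laplacianE -big_split; apply: eq_bigr => i _ /=; ring. Qed.

Lemma laplacianZ (c : R) f n : laplacian (fun m => c * f m) n = c * laplacian f n.
Proof. by rewrite !laplacianE mulr_sumr; apply: eq_bigr => i _ /=; ring. Qed.

Lemma laplacianN f n : laplacian (fun m => - f m) n = - laplacian f n.
Proof. by rewrite !laplacianE -sumrN; apply: eq_bigr => i _ /=; ring. Qed.

Lemma laplacianB f g n : laplacian (fun m => f m - g m) n = laplacian f n - laplacian g n.
Proof. by rewrite laplacianD laplacianN. Qed.

Lemma laplacian_shift f x n : laplacian (fun m => f (m + x)) n = laplacian f (n + x).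
Proof. by rewrite !laplacianE; apply: eq_bigr => i _; rewrite !(addrAC _ _ x). Qed.

Lemma laplacian_sq n : laplacian sq n = 2 * d%:R.
Proof.
rewrite laplacianE (eq_bigr (fun=> 2)); last first.
  by move=> i _; rewrite sq_addb sq_subb; ring.
by rewrite sumr_const card_ord mulr_natr.
Qed.

Lemma laplacian_coord (h : int -> R) (i : 'I_d) n :
  laplacian (fun m => h (m 0 i)) n = h (n 0 i + 1) + h (n 0 i - 1) - 2 * h (n 0 i).
Proof.
rewrite laplacianE (bigD1 i) //= big1 ?addr0.
  by rewrite entryD entryB entry_basis eqxx.
by move=> j ji; rewrite entryD entryB entry_basis eq_sym (negPf ji) /= !subr0; ring.
Qed.

Definition reflect_at (i : 'I_d) n : 'rV[int]_d := \row_j (if j == i then 1 - n 0 j else n 0 j).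

Lemma reflect_atE i n j : reflect_at i n 0 j = if j == i then 1 - n 0 j else n 0 j.
Proof. by rewrite mxE. Qed.

Lemma reflect_atK i : involutive (reflect_at i).
Proof. by move=> n; apply/rowP => j; rewrite !reflect_atE; case: eqP => // _; rewrite opprB addrC subrK. Qed.

Lemma reflect_at_add i j n : reflect_at i (n + basis_vec j) =
  if j == i then reflect_at i n - basis_vec j else reflect_at i n + basis_vec j.
Proof.
apply/rowP => k; case: (eqVneq j i) => [->|ji].
  rewrite entryB !reflect_atE entryD entry_basis; case: (eqVneq k i) => _ /=; lia.
rewrite entryD !reflect_atE entryD entry_basis; case: (eqVneq k i) => [->|_] //=.
by rewrite eq_sym (negPf ji) /= !addr0.
Qed.

Lemma reflect_at_sub i j n : reflect_at i (n - basis_vec j) =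
  if j == i then reflect_at i n + basis_vec j else reflect_at i n - basis_vec j.
Proof.
have := reflect_at_add i j (n - basis_vec j); rewrite subrK => ->.
by case: eqP => _; rewrite ?subrK ?addrK.
Qed.

Lemma laplacian_reflect u i n :
  laplacian (fun m => u (reflect_at i m)) n = laplacian u (reflect_at i n).
Proof.
rewrite !laplacianE; apply: eq_bigr => j _.
by rewrite reflect_at_add reflect_at_sub; case: eqP => _ //; ring.
Qed.

Lemma int_pred_ge1 (z : int) : 1 <= z -> z != 1 -> 1 <= z - 1.
Proof. lia. Qed.

Lemma seq_argmin (T : eqType) (s : seq T) (f : T -> R) (x0 : T) : x0 \in s ->
  exists2 x, x \in s & forall y, y \in s -> f x <= f y.
Proof.
elim: s x0 => // a s IH x0 _.
case: s IH => [|b s] IH.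
  by exists a; rewrite ?mem_head // => y; rewrite inE => /eqP ->.
have [|x xs xmin] := IH b; first exact: mem_head.
have [ax|xa] := leP (f a) (f x).
  exists a; rewrite ?mem_head // => y; rewrite inE => /orP[/eqP -> //|/xmin].
  exact: le_trans.
exists x; first by rewrite in_cons xs orbT.
move=> y; rewrite in_cons => /orP[/eqP ->|/xmin //].
exact: ltW.
Qed.

(* Reflection across the hyperplane x_i = 1/2 turns the increment of u across it into
   the value of an odd function, which the quadratic barrier dominates. *)
Lemma increment_at_origin u (i : 'I_d) (A B : R) (M : nat) : (0 < M)%N -> 0 < B ->
  (forall n, (nsup n <= M.+1)%N -> `|u n| <= A) ->
  (forall n, (nsup n <= M)%N -> `|laplacian u n| <= B) ->
  u (basis_vec i) - u 0 <= 2 * d%:R * A / M%:R + 2 * B * M%:R.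
Proof.
move=> M0 B0 uA uB.
have M1 : 1 <= (M%:R : R) by rewrite ler1n.
have Mgt0 : 0 < (M%:R : R) by lra.
have A0 : 0 <= A by apply: le_trans (uA 0 _); rewrite ?nsup0.
have d1 : 1 <= (d%:R : R) by rewrite ler1n; case: d i => // -[].
pose a n : R := (n 0 i)%:~R.
(* Two barriers in the half box n_i >= 1: [P] is harmonic and at least M^2 on the outer layer, so
   [c * P] dominates |v| <= 2A there; [Q] is nonnegative on that layer and has Laplacian -2, so
   [2 * B * Q] contributes -4B, strictly beating |laplacian v| <= 2B because B > 0. *)
pose P n : R := sq n + (- a n ^+ 2 - (d%:R - 1) * (a n * (a n - 1)) + 2 * d%:R * M%:R * (a n - 1/2)).
pose Q n : R := - (a n * (a n - 1)) + 2 * M%:R * (a n - 1/2).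
pose v n := u n - u (reflect_at i n).
pose c : R := 2 * A / M%:R ^+ 2.
have c0 : 0 <= c by rewrite divr_ge0 ?mulr_ge0 ?exprn_ge0 //; lra.
pose b n := c * P n + 2 * B * Q n.
pose g n := b n - v n.
have lapP n : laplacian P n = 0.
  pose h (z : int) : R := - z%:~R ^+ 2 - (d%:R - 1) * (z%:~R * (z%:~R - 1)) + 2 * d%:R * M%:R * (z%:~R - 1/2).
  rewrite (laplacianD sq (fun m => h (m 0 i))) laplacian_sq laplacian_coord /h.
  rewrite intrD intrB /=; ring.
have lapQ n : laplacian Q n = - 2.
  pose h (z : int) : R := - (z%:~R * (z%:~R - 1)) + 2 * M%:R * (z%:~R - 1/2).
  by rewrite (laplacian_coord h) /h intrD intrB /=; ring.
have reflM n : (1 <= n 0 i) -> (nsup (reflect_at i n) <= nsup n)%N.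
  move=> n1; apply/nsup_leP => j; rewrite reflect_atE; have := leq_nsup n j.
  by case: eqP => [->|//]; lia.
have lapg n : (nsup n <= M)%N -> (1 <= n 0 i) -> laplacian g n < 0.
  move=> nM n1; rewrite /g laplacianB laplacianD !laplacianZ lapP lapQ.
  rewrite laplacianB laplacian_reflect.
  have := uB _ nM; have := uB _ (leq_trans (reflM _ n1) nM).
  rewrite !ler_norml; lra.
have a1 n : 1 <= n 0 i -> 1 <= a n by move=> n1; rewrite /a -(ler_int R) in n1 *.
have aM n : n 0 i <= M.+1%:Z -> a n <= M%:R + 1.
  by move=> n1; rewrite natr1 /a -(ler_int R) in n1 *.
have bnd n : (nsup n = M.+1)%N -> (1 <= n 0 i) -> 0 <= g n.
  move=> nM n1.
  have an1 := a1 n n1.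
  have anM : a n <= M%:R + 1 by apply: aM; have := leq_nsup n i; lia.
  have Q0 : 0 <= Q n by rewrite /Q; nra.
  have vA : v n <= 2 * A.
    have := uA n; have := uA (reflect_at i n); rewrite nM leqnn.
    rewrite (leq_trans (reflM _ n1)) ?nM // => /(_ isT) + /(_ isT).
    rewrite /v !ler_norml; lra.
  have br : 0 <= - (d%:R - 1) * (a n * (a n - 1)) + 2 * d%:R * M%:R * (a n - 1/2).
    have h1 : a n * (a n - 1) <= a n * M%:R by rewrite ler_wpM2l; lra.
    have h2 : (d%:R - 1) * (a n * (a n - 1)) <= (d%:R - 1) * (a n * M%:R) by rewrite ler_wpM2l; lra.
    have h3 : 0 <= M%:R * ((d%:R + 1) * a n - d%:R) by rewrite mulr_ge0; nra.
    lra.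
  have PM : M%:R ^+ 2 <= P n.
    have [j jM] : exists j : 'I_d, absz (n 0 j) = M.+1.
      apply/not_existsP => H.
      suff : (nsup n <= M)%N by rewrite nM ltnn.
      apply/nsup_leP => j; have := leq_nsup n j; have := H j; rewrite nM => h1 h2.
      by rewrite -ltnS ltn_neqAle h2 andbT; apply/eqP.
    have sj : (M%:R + 1) ^+ 2 = (n 0 j)%:~R ^+ 2 :> R.
      by rewrite natr1 -jM -abs_coord real_normK ?num_real.
    have [ji|ji] := eqVneq j i.
      have anE : a n = M%:R + 1.
        move: sj an1; rewrite ji -/(a n) => sj an1.
        have : (M%:R + 1 - a n) * (M%:R + 1 + a n) = 0 by rewrite -subr_sqr sj subrr.
        by move/eqP; rewrite mulf_eq0 => /orP[] /eqP; lra.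
      have := coord_sq n i; rewrite -/(a n) => s1.
      rewrite /P anE in s1 *; nra.
    have s2 : a n ^+ 2 + (n 0 j)%:~R ^+ 2 <= sq n.
      rewrite /sq (bigD1 i) //= lerD2l (bigD1 j) //= lerDl.
      by apply: sumr_ge0 => k _; exact: sqr_ge0.
    rewrite -sj in s2; rewrite /P; nra.
  have : 2 * A <= c * P n.
    have -> : 2 * A = c * M%:R ^+ 2 by rewrite /c divfK // expf_neq0 // gt_eqF.
    by rewrite ler_wpM2l.
  have : 0 <= 2 * B * Q n by rewrite !mulr_ge0; lra.
  by rewrite /g /b; lra.
(* Minimum principle: at a negative minimum every neighbour would be at least as large, against
   [lapg]. The only neighbour outside the half space is reached from n_i = 1 and is the mirror image
   of [x]; there [v] cancels by oddness and [cross] reduces to the sign of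
   [b x + b (x - basis_vec i)]. *)
have gpos n : (nsup n <= M)%N -> 1 <= n 0 i -> 0 <= g n.
  pose s := [seq m : 'rV[int]_d <- box d M | 1 <= m 0 i].
  have ms m : (m \in s) = (1 <= m 0 i) && (nsup m <= M)%N by rewrite mem_filter mem_box.
  move=> nM n1; have ns : n \in s by rewrite ms n1.
  have [x xs xmin] : exists2 x : 'rV[int]_d, x \in s & forall y, y \in s -> g x <= g y.
    exact: seq_argmin ns.
  move: (xs); rewrite ms => /andP[x1 xM].
  apply: le_trans (xmin _ ns); rewrite leNgt; apply/negP => gx0.
  have nbr y : (nsup y <= M.+1)%N -> 1 <= y 0 i -> g x <= g y.
    move=> yM y1; have [yM2|yM2] := leqP (nsup y) M.
      by apply: xmin; rewrite ms y1.
    apply: le_trans (ltW gx0) (bnd _ _ y1).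
    by apply/eqP; rewrite eqn_leq yM yM2.
  have cross : x 0 i = 1 -> g x <= g (x - basis_vec i).
    move=> xi; suff : 0 <= g x + g (x - basis_vec i) by lra.
    have -> : g x + g (x - basis_vec i) = b x + b (x - basis_vec i).
      rewrite /g /v.
      have -> : reflect_at i (x - basis_vec i) = x.
        apply/rowP => j; rewrite reflect_atE entryB entry_basis.
        by case: eqP => [->|_] /=; [rewrite xi|rewrite subr0].
      have -> : reflect_at i x = x - basis_vec i.
        apply/rowP => j; rewrite reflect_atE entryB entry_basis.
        by case: eqP => [->|_] /=; [rewrite xi|rewrite subr0].
      ring.
    have ax : a x = 1 by rewrite /a xi.
    have ax' : a (x - basis_vec i) = 0 by rewrite /a entryB entry_basis eqxx xi.
    rewrite /b /P /Q ax ax' sq_subb xi.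
    have := coord_sq x i; rewrite xi => s1.
    have : 0 <= c * (2 * (sq x - 1)) by rewrite mulr_ge0 //; lra.
    lra.
  have := lapg _ xM x1; rewrite ltNge => /negP; apply.
  rewrite laplacianE; apply: sumr_ge0 => j _.
  have h1 : g x <= g (x + basis_vec j).
    apply: nbr; first by rewrite (leq_trans (nsup_addb _ _)).
    by rewrite entryD entry_basis (le_trans x1) // lerDl.
  suff : g x <= g (x - basis_vec j) by lra.
  have [xi|xi] := boolP ((j == i) && (x 0 i == 1)).
    by case/andP: xi => /eqP -> /eqP; exact: cross.
  apply: nbr; first by rewrite (leq_trans (nsup_subb _ _)).
  rewrite entryB entry_basis; move: xi; rewrite negb_and eq_sym.
  by case: eqP => [_|_ _] /=; [exact: int_pred_ge1|rewrite subr0].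
have := gpos (basis_vec i); rewrite nsup_basis entry_basis eqxx => /(_ M0 isT).
rewrite /g /v.
have -> : reflect_at i (basis_vec i) = 0.
  by apply/rowP => j; rewrite reflect_atE entry_basis mxE; case: eqP.
have -> : b (basis_vec i) = 2 * d%:R * A / M%:R + 2 * B * M%:R.
  rewrite /b /P /Q.
  have -> : a (basis_vec i) = 1 by rewrite /a entry_basis eqxx.
  have -> : sq (basis_vec i) = 1.
    have -> : basis_vec i = 0 + basis_vec i by rewrite add0r.
    rewrite sq_addb mxE /sq big1 ?mulr0 ?add0r // => j _.
    by rewrite mxE expr0n.
  by rewrite /c; field; rewrite gt_eqF.
lra.
Qed.

Lemma gradient_estimate u (i : 'I_d) x (A B : R) (M : nat) : (0 < M)%N -> 0 < B ->
  (forall n, (nsup (n - x) <= M.+1)%N -> `|u n| <= A) ->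
  (forall n, (nsup (n - x) <= M)%N -> `|laplacian u n| <= B) ->
  `|u (x + basis_vec i) - u x| <= 2 * d%:R * A / M%:R + 2 * B * M%:R.
Proof.
move=> M0 B0 uA uB; rewrite ler_norml; apply/andP; split; last first.
  have := @increment_at_origin (fun n => u (n + x)) i A B M M0 B0.
  rewrite add0r (addrC (basis_vec i)); apply => n nM.
    by apply: uA; rewrite addrK.
  by rewrite laplacian_shift; apply: uB; rewrite addrK.
rewrite lerNl opprB.
have := @increment_at_origin (fun n => - u (n + x)) i A B M M0 B0.
rewrite add0r (addrC (basis_vec i)) opprK [- _ + _]addrC; apply => n nM.
  by rewrite normrN; apply: uA; rewrite addrK.
by rewrite laplacianN laplacian_shift normrN; apply: uB; rewrite addrK.
Qed.

End GradientEstimate.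

Lemma powR_half_sqrt (R : realType) (u : R) (d : nat) : 0 <= u ->
  u `^ (- (d%:R / 2)) = (Num.sqrt u)^-1 ^+ d.
Proof.
move=> u0; rewrite powRN mulrC powRrM powR12_sqrt // powR_mulrn ?sqrtr_ge0 //.
by rewrite exprVn.
Qed.

(** * Differences of powers of a shifted squared norm *)

Section SecondDifference.
Variables (R : realType).
Implicit Types p u b : R.

Definition remainder_cst p : R := p * ((p + 1) * ((p + 2) * ((p + 3) * 2 `^ (p + 4)))).

Lemma remainder_cst_ge0 p : 0 <= p -> 0 <= remainder_cst p.
Proof.
move=> p0.
have := powR_ge0 2 (p + 4) => c.
by rewrite /remainder_cst; do !apply: mulr_ge0 => //; lra.
Qed.

(** One constant serves both difference estimates below. The two fourth-order remainders total 2 *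
    81 in the second difference and 2 * 256 = 512 in the first; the cubic terms give 26/6 and 28/6,
    and the quadratic term 4 of the first difference also fits under the coefficient 30. *)
Definition taylor_cst p : R :=
  p * (p + 1) * (p + 2) * 30 + p * (p + 1) + remainder_cst p * 512.

Lemma taylor_cst_ge0 p : 0 <= p -> 0 <= taylor_cst p.
Proof.
move=> p0.
have h1 : 0 <= p * (p + 1) by rewrite mulr_ge0 //; lra.
have h2 : 0 <= p * (p + 1) * (p + 2) by rewrite mulr_ge0 //; lra.
have := remainder_cst_ge0 p0; rewrite /taylor_cst; lra.
Qed.

(** From (1 + 2b)^2 <= 9u one gets ((1 + 2b)/u)^2 <= 9/u, and 36 is the value of [u] from which this
    is at most (1/2)^2, the range of the Taylor estimates. *)
Lemma step_bounds u b : 36 <= u -> b ^+ 2 <= u ->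
  `|(1 + 2 * b) / u| <= 1/2 /\ `|(1 + 2 * b) / u| ^+ 4 <= 81 / u ^+ 2.
Proof.
move=> u36 bu; have u0 : 0 < u by lra.
have h1 : (1 + 2 * b) ^+ 2 <= 9 * u by nra.
have h2 : ((1 + 2 * b) / u) ^+ 2 <= 9 / u.
  by rewrite expr_div_n ler_pdivrMr ?exprn_gt0 // [leRHS](_ : _ = 9 * u) //; field; exact: lt0r_neq0.
split.
  have h3 : ((1 + 2 * b) / u) ^+ 2 <= (1/2) ^+ 2.
    by apply: le_trans h2 _; rewrite ler_pdivrMr //; lra.
  by rewrite -(@ler_pXn2r _ 2) ?nnegrE ?real_normK ?num_real //; lra.
rewrite (exprM _ 2 2) real_normK ?num_real //.
have -> : 81 / u ^+ 2 = (9 / u) ^+ 2 by field; exact: lt0r_neq0.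
by rewrite lerXn2r ?nnegrE ?sqr_ge0 // divr_ge0 //; lra.
Qed.

Lemma second_difference_powT p u b : 0 <= p -> 36 <= u -> b ^+ 2 <= u ->
  `|powT p ((1 + 2 * b) / u) + powT p ((1 - 2 * b) / u) - 2
     - (- (2 * p) / u + 4 * p * (p + 1) * b ^+ 2 / u ^+ 2)| <= taylor_cst p / u ^+ 2.
Proof.
move=> p0 u36 bu; have u0 : 0 < u by lra.
have h' : 0 <= p * (p + 1) by rewrite mulr_ge0 //; lra.
have h'' : 0 <= p * (p + 1) * (p + 2) by rewrite mulr_ge0 //; lra.
have h : 0 <= p * (p + 1) * (p + 2) / 6 by lra.
have b20 := sqr_ge0 b.
have q1 : 0 <= 2 / u + 24 * b ^+ 2 / u by rewrite -mulrDl divr_ge0 //; lra.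
have q2 : 2 / u + 24 * b ^+ 2 / u <= 26 by rewrite -mulrDl ler_pdivrMr //; lra.
set C := remainder_cst p; have C0 : 0 <= C := remainder_cst_ge0 p0.
have [s1 f1] := step_bounds u36 bu.
have bu' : (- b) ^+ 2 <= u by rewrite sqrrN.
have [] := step_bounds u36 bu'; rewrite mulrN => s2 f2.
have t1 := powT_taylor4 p0 s1; have t2 := powT_taylor4 p0 s2.
set x := (1 + 2 * b) / u in s1 f1 t1 *; set y := (1 - 2 * b) / u in s2 f2 t2 *.
have t1' := le_trans t1 (ler_wpM2l C0 f1); have t2' := le_trans t2 (ler_wpM2l C0 f2).
have e1 : x + y = 2 / u by rewrite /x /y; field; exact: lt0r_neq0.
have e2 : x ^+ 2 + y ^+ 2 = 2 / u ^+ 2 + 8 * b ^+ 2 / u ^+ 2 by rewrite /x /y; field; exact: lt0r_neq0.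
have e3 : x ^+ 3 + y ^+ 3 = (2 / u + 24 * b ^+ 2 / u) / u ^+ 2 by rewrite /x /y; field; exact: lt0r_neq0.
have iu : 0 <= (u ^+ 2)^-1 by rewrite invr_ge0 sqr_ge0.
have e3' : 0 <= x ^+ 3 + y ^+ 3 <= 26 / u ^+ 2.
  by rewrite e3 mulr_ge0 //= ler_wpM2r.
have k1 : 0 <= p * (p + 1) * (p + 2) / 6 * (x ^+ 3 + y ^+ 3) <= p * (p + 1) * (p + 2) / 6 * (26 / u ^+ 2).
  case/andP: e3' => a1 a2.
  by rewrite mulr_ge0 // ler_wpM2l.
have k2 : 0 <= p * (p + 1) / u ^+ 2 by rewrite mulr_ge0.
have k3 : 0 <= p * (p + 1) * (p + 2) / u ^+ 2 by rewrite mulr_ge0.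
have k4 : 0 <= C / u ^+ 2 by rewrite mulr_ge0.
have -> : powT p x + powT p y - 2 - (- (2 * p) / u + 4 * p * (p + 1) * b ^+ 2 / u ^+ 2) =
  (powT p x - (1 - p * x + p * (p + 1) / 2 * x ^+ 2 - p * (p + 1) * (p + 2) / 6 * x ^+ 3)) +
  (powT p y - (1 - p * y + p * (p + 1) / 2 * y ^+ 2 - p * (p + 1) * (p + 2) / 6 * y ^+ 3))
  + p * (p + 1) / u ^+ 2 - p * (p + 1) * (p + 2) / 6 * (x ^+ 3 + y ^+ 3).
  have -> : - (2 * p) / u = - p * (x + y) by rewrite e1; ring.
  have -> : 4 * p * (p + 1) * b ^+ 2 / u ^+ 2 = p * (p + 1) / 2 * (x ^+ 2 + y ^+ 2) - p * (p + 1) / u ^+ 2.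
    by rewrite e2; field; exact: lt0r_neq0.
  ring.
have -> : taylor_cst p / u ^+ 2 = 30 * (p * (p + 1) * (p + 2) / u ^+ 2) + p * (p + 1) / u ^+ 2 + 512 * (C / u ^+ 2).
  by rewrite /taylor_cst -/C; ring.
have k1' : p * (p + 1) * (p + 2) / 6 * (26 / u ^+ 2) = 26/6 * (p * (p + 1) * (p + 2) / u ^+ 2) by field; exact: lt0r_neq0.
rewrite k1' in k1.
have t1'' : C * (81 / u ^+ 2) = 81 * (C / u ^+ 2) by ring.
rewrite -/C t1'' in t1'; rewrite -/C t1'' in t2'.
move: t1' t2'; rewrite !ler_norml; lra.
Qed.

(** The error keeps a factor [b], to be comparable with the height by which the barrier is
    multiplied. The condition 1/2 <= b gives |1 + 2b| <= 4b and |1 - 2b| <= 4b. *)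
Lemma first_difference_powT p u b : 0 <= p -> 36 <= u -> b ^+ 2 <= u -> 1/2 <= b ->
  `|powT p ((1 + 2 * b) / u) - powT p ((1 - 2 * b) / u) - (- (4 * p * b) / u)|
    <= taylor_cst p * b / u ^+ 2.
Proof.
move=> p0 u36 bu b2; have u0 : 0 < u by lra.
have h' : 0 <= p * (p + 1) by rewrite mulr_ge0 //; lra.
have h'' : 0 <= p * (p + 1) * (p + 2) by rewrite mulr_ge0 //; lra.
have h : 0 <= p * (p + 1) * (p + 2) / 6 by lra.
have b20 := sqr_ge0 b.
have q1 : 0 <= 12 / u + 16 * b ^+ 2 / u by rewrite -mulrDl divr_ge0 //; lra.
have q2 : 12 / u + 16 * b ^+ 2 / u <= 28 by rewrite -mulrDl ler_pdivrMr //; lra.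
have pp : p * (p + 1) <= p * (p + 1) * (p + 2) by rewrite ler_peMr //; lra.
have bu0 : 0 <= b / u ^+ 2 by rewrite divr_ge0 ?sqr_ge0 //; lra.
set C := remainder_cst p; have C0 : 0 <= C := remainder_cst_ge0 p0.
have [s1 _] := step_bounds u36 bu.
have bu' : (- b) ^+ 2 <= u by rewrite sqrrN.
have [] := step_bounds u36 bu'; rewrite mulrN => s2 _.
have bleu : b <= u by nra.
have f0 (z : R) : `|z| <= 4 * b -> `|z / u| ^+ 4 <= 256 * b / u ^+ 2.
  move=> z4; have -> : `|z / u| = `|z| / u by rewrite normrM normfV (gtr0_norm u0).
  rewrite expr_div_n.
  rewrite ler_pdivrMr ?exprn_gt0 //.
  have -> : 256 * b / u ^+ 2 * u ^+ 4 = 256 * b * u ^+ 2 by field; exact: lt0r_neq0.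
  have : `|z| ^+ 4 <= (4 * b) ^+ 4 by rewrite lerXn2r ?nnegrE //; lra.
  have e : (4 * b) ^+ 4 = 256 * b * (b * b ^+ 2) by ring.
  have : b * b ^+ 2 <= u ^+ 2 by rewrite expr2; apply: ler_pM => //; nra.
  by rewrite e => h1 h2; apply: (le_trans h2); apply: ler_wpM2l h1; lra.
have f1 : `|(1 + 2 * b) / u| ^+ 4 <= 256 * b / u ^+ 2.
  by apply: f0; rewrite ger0_norm; lra.
have f2 : `|(1 - 2 * b) / u| ^+ 4 <= 256 * b / u ^+ 2.
  by apply: f0; rewrite ler_norml; lra.
have t1 := powT_taylor4 p0 s1; have t2 := powT_taylor4 p0 s2.
set x := (1 + 2 * b) / u in s1 f1 t1 *; set y := (1 - 2 * b) / u in s2 f2 t2 *.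
have t1' := le_trans t1 (ler_wpM2l C0 f1); have t2' := le_trans t2 (ler_wpM2l C0 f2).
have e1 : x - y = 4 * b / u by rewrite /x /y; field; exact: lt0r_neq0.
have e2 : x ^+ 2 - y ^+ 2 = 8 * (b / u ^+ 2) by rewrite /x /y; field; exact: lt0r_neq0.
have e3 : x ^+ 3 - y ^+ 3 = (12 / u + 16 * b ^+ 2 / u) * (b / u ^+ 2) by rewrite /x /y; field; exact: lt0r_neq0.
have e3' : 0 <= x ^+ 3 - y ^+ 3 <= 28 * (b / u ^+ 2).
  by rewrite e3 mulr_ge0 //= ler_wpM2r.
have k1 : 0 <= p * (p + 1) * (p + 2) / 6 * (x ^+ 3 - y ^+ 3) <= p * (p + 1) * (p + 2) / 6 * (28 * (b / u ^+ 2)).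
  case/andP: e3' => a1 a2.
  by rewrite mulr_ge0 // ler_wpM2l.
have k2 : 0 <= p * (p + 1) * (b / u ^+ 2) by rewrite mulr_ge0.
have k2' : p * (p + 1) * (b / u ^+ 2) <= p * (p + 1) * (p + 2) * (b / u ^+ 2) by rewrite ler_wpM2r.
have k4 : 0 <= C * (b / u ^+ 2) by rewrite mulr_ge0.
have -> : powT p x - powT p y - (- (4 * p * b) / u) =
  (powT p x - (1 - p * x + p * (p + 1) / 2 * x ^+ 2 - p * (p + 1) * (p + 2) / 6 * x ^+ 3)) -
  (powT p y - (1 - p * y + p * (p + 1) / 2 * y ^+ 2 - p * (p + 1) * (p + 2) / 6 * y ^+ 3))
  + 4 * (p * (p + 1) * (b / u ^+ 2)) - p * (p + 1) * (p + 2) / 6 * (x ^+ 3 - y ^+ 3).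
  have -> : - (4 * p * b) / u = - p * (x - y) by rewrite e1; ring.
  have -> : 4 * (p * (p + 1) * (b / u ^+ 2)) = p * (p + 1) / 2 * (x ^+ 2 - y ^+ 2).
    by rewrite e2; field; exact: lt0r_neq0.
  ring.
have -> : taylor_cst p * b / u ^+ 2 = 30 * (p * (p + 1) * (p + 2) * (b / u ^+ 2)) + p * (p + 1) * (b / u ^+ 2) + 512 * (C * (b / u ^+ 2)).
  by rewrite /taylor_cst -/C; ring.
have k1' : p * (p + 1) * (p + 2) / 6 * (28 * (b / u ^+ 2)) = 28/6 * (p * (p + 1) * (p + 2) * (b / u ^+ 2)) by field; exact: lt0r_neq0.
rewrite k1' in k1.
have t1'' : C * (256 * b / u ^+ 2) = 256 * (C * (b / u ^+ 2)) by ring.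
rewrite -/C t1'' in t1'; rewrite -/C t1'' in t2'.
move: t1' t2'; rewrite !ler_norml; lra.
Qed.

End SecondDifference.

(** * A superharmonic barrier for the half-space problem *)

Section Barrier.
Variables (R : realType) (d : nat) (k : 'I_d).
Implicit Types (n m : 'rV[int]_d).

Definition height n : R := 1/2 - (n 0 k)%:~R.

Definition centred (i : 'I_d) n : R := (n 0 i)%:~R - (i == k)%:R / 2.

(** Squared Euclidean distance to the midpoint of 0 and [basis_vec k], regularised by [r2]; the term
    1/4 completes the square. *)
Definition offset (r2 : R) n : R := sq R n - (n 0 k)%:~R + 1/4 + r2.

Lemma offsetE r2 n : offset r2 n = \sum_i centred i n ^+ 2 + r2.
Proof.
rewrite /offset /sq; congr (_ + _).
rewrite (bigD1 k) //= [in RHS](bigD1 k) //= /centred eqxx /=.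
rewrite (eq_bigr (fun i => (n 0 i)%:~R ^+ 2)); last by [].
rewrite [in RHS](eq_bigr (fun i => (n 0 i)%:~R ^+ 2)); last first.
  by move=> i /negPf ->; rewrite mul0r subr0.
by field.
Qed.

Lemma offset_add r2 n i : offset r2 (n + basis_vec i) = offset r2 n + (1 + 2 * centred i n).
Proof.
rewrite /offset /centred sq_addb entryD entry_basis intrD eq_sym.
by case: (i == k) => /=; field.
Qed.

Lemma offset_sub r2 n i : offset r2 (n - basis_vec i) = offset r2 n + (1 - 2 * centred i n).
Proof.
rewrite /offset /centred sq_subb entryB entry_basis intrB eq_sym.
by case: (i == k) => /=; field.
Qed.

Lemma height_add n i : height (n + basis_vec i) = height n - (i == k)%:R.
Proof. by rewrite /height entryD entry_basis intrD eq_sym; case: (i == k) => /=; ring. Qed.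

Lemma height_sub n i : height (n - basis_vec i) = height n + (i == k)%:R.
Proof. by rewrite /height entryB entry_basis intrB eq_sym; case: (i == k) => /=; ring. Qed.

Lemma height_reflect n : height (reflect_at k n) = - height n.
Proof. by rewrite /height reflect_atE eqxx intrB /=; field. Qed.

Lemma offset_reflect r2 n : offset r2 (reflect_at k n) = offset r2 n.
Proof.
rewrite !offsetE; congr (_ + _); apply: eq_bigr => i _.
rewrite /centred reflect_atE; case: eqP => // _; rewrite intrB /=; by field.
Qed.

Lemma centred_height n : centred k n = - height n.
Proof. by rewrite /centred /height eqxx /=; field. Qed.

Lemma centred_le r2 n i : 0 <= r2 -> centred i n ^+ 2 <= offset r2 n.
Proof.
move=> r0; rewrite offsetE (bigD1 i) //= -addrA lerDl addr_ge0 //.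
by apply: sumr_ge0 => j _; exact: sqr_ge0.
Qed.

Lemma offset_ge r2 n : r2 <= offset r2 n.
Proof. by rewrite offsetE lerDr; apply: sumr_ge0 => j _; exact: sqr_ge0. Qed.

Lemma jap_le_offset r2 n : 36 <= r2 -> jap R n <= 2 * Num.sqrt (offset r2 n).
Proof.
move=> r36; have o36 := le_trans r36 (offset_ge r2 n).
have j0 := ltW (jap_gt0 R n).
rewrite -(@ler_pXn2r _ 2) ?nnegrE // ?mulr_ge0 ?sqrtr_ge0 //.
rewrite exprMn sqr_sqrtr; last lra.
rewrite /offset.
have := sq_ge R n; have := coord_sq R n k; have := abs_coord R n k => _.
rewrite /jap -natr1; move: ((nsup n)%:R : R) (ler0n R (nsup n)) => m m0 h1 h2.
have : (n 0 k)%:~R <= sq R n / 2 + 1/2.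
  have := sqr_ge0 ((n 0 k)%:~R - 1 : R); rewrite sqrrB; lra.
have := sqr_ge0 (m - 1); rewrite sqrrB sqrrD; lra.
Qed.

Local Notation p := (d%:R / 2 : R).

(** The 36 brings [offset] into the range of the difference estimates. The second term outweighs the
    d + 1 Taylor errors: one second difference in each direction and one first difference in
    direction [k]. *)
Definition barrier_radius : R := 36 + (d%:R + 1) * taylor_cst p.

(* Up to a factor, a regularized k-derivative of |n|^(2-d) centred at the midpoint of 0 and e_k. *)
Definition barrier n : R := height n * offset barrier_radius n `^ (- p).

Lemma p_ge0 : 0 <= p. Proof. by rewrite divr_ge0. Qed.

Lemma barrier_radius_ge36 : 36 <= barrier_radius.
Proof.
rewrite /barrier_radius lerDl mulr_ge0 ?taylor_cst_ge0 ?p_ge0 //.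
Qed.

(** In the continuum, height times |x|^(-d) is harmonic. The regularisation makes it strictly
    superharmonic on the positive side, with a margin that exceeds the errors of discretisation. *)
Lemma barrier_superharmonic n : (2 <= d)%N -> n 0 k <= 0 -> 
  barrier n / offset barrier_radius n ^+ 2 <= - laplacian barrier n.
Proof.
move=> d2 nk.
have r36 := barrier_radius_ge36.
set u := offset barrier_radius n.
have u36 : 36 <= u := le_trans r36 (offset_ge _ _).
have u0 : 0 < u by lra.
have y2 : 1/2 <= height n.
  have : (n 0 k)%:~R <= 0 :> R by rewrite lerz0.
  by rewrite /height; lra.
set y := height n in y2 *.
set f := u `^ (- p).
have f0 : 0 <= f by exact: powR_ge0.
pose K := taylor_cst p.
have K0 : 0 <= K := taylor_cst_ge0 p_ge0.
have cu i : centred i n ^+ 2 <= u by apply: centred_le; lra.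
have f1 m t : `|t| <= 1/2 -> offset barrier_radius m = u + u * t -> 
    offset barrier_radius m `^ (- p) = f * powT p t.
  rewrite ler_norml => t2 ->; have -> : u + u * t = u * (1 + t) by ring.
  by rewrite powRM //; lra.
have term i : barrier (n + basis_vec i) + barrier (n - basis_vec i) - 2 * barrier n <=
   y * f * (- (2 * p) / u + 4 * p * (p + 1) * centred i n ^+ 2 / u ^+ 2 + K / u ^+ 2)
   + (i == k)%:R * (y * f * (- (4 * p) / u + K / u ^+ 2)).
  have [s1 _] := step_bounds u36 (cu i).
  have c2 : (- centred i n) ^+ 2 <= u by rewrite sqrrN.
  have [] := step_bounds u36 c2; rewrite mulrN => s2 _.
  rewrite /barrier -/u -/f -/y.
  rewrite (f1 _ _ s1); last by rewrite offset_add -/u [u * _]mulrC divfK ?gt_eqF.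
  rewrite (f1 _ _ s2); last by rewrite offset_sub -/u [u * _]mulrC divfK ?gt_eqF.
  rewrite height_add height_sub -/y.
  have := second_difference_powT p_ge0 u36 (cu i); rewrite -/K.
  set tp := powT p _; set tm := powT p _ => sd.
  have yf : 0 <= y * f by rewrite mulr_ge0 //; lra.
  have sd1 : tp + tm - 2 <= - (2 * p) / u + 4 * p * (p + 1) * centred i n ^+ 2 / u ^+ 2 + K / u ^+ 2.
    by move: sd; rewrite ler_norml; lra.
  have sd2 := ler_wpM2l yf sd1.
  have fd : (i == k)%:R * (f * (tm - tp)) <= (i == k)%:R * (y * f * (- (4 * p) / u + K / u ^+ 2)).
    case: eqP => [ik|_]; last by rewrite !mul0r.
    rewrite !mul1r [y * f]mulrC -mulrA ler_wpM2l //.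
    have yu : y ^+ 2 <= u by have := cu k; rewrite centred_height sqrrN.
    have := first_difference_powT p_ge0 u36 yu y2; rewrite -/K.
    rewrite /tm /tp ik centred_height mulrN opprK ler_norml => /andP[_].
    have -> : y * (- (4 * p) / u + K / u ^+ 2) = - (4 * p * y) / u + K * y / u ^+ 2 by ring.
    lra.
  apply: le_trans (lerD sd2 fd).
  by rewrite le_eqVlt; apply/orP; left; apply/eqP; ring.
rewrite lerNr laplacianE.
apply: le_trans (ler_sum _ (fun i _ => term i)) _.
rewrite big_split /= -mulr_sumr !big_split /= !sumr_const !card_ord.
rewrite -mulr_suml -mulr_sumr.
have -> : \sum_i centred i n ^+ 2 = u - barrier_radius by rewrite /u offsetE; ring.
rewrite (bigD1 k) //= eqxx mul1r [X in _ + (_ + X)]big1 ?addr0; last first.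
  by move=> i /negPf ->; rewrite mul0r.
rewrite -[(- (2 * p) / u) *+ d]mulr_natr -[(K / u ^+ 2) *+ d]mulr_natr.
have -> : - (barrier n / u ^+ 2) = y * f * (- 1 / u ^+ 2) by rewrite /barrier -/u -/f -/y; ring.
rewrite -mulrDr ler_wpM2l ?mulr_ge0 //; first lra.
(* The terms of order 1/u cancel because 2p = d. What is left of order 1/u^2 is the gain from
   [barrier_radius] against the Taylor errors. *)
have -> : - (2 * p) / u * d%:R + 4 * p * (p + 1) * (u - barrier_radius) / u ^+ 2 + K / u ^+ 2 * d%:R 
  + (- (4 * p) / u + K / u ^+ 2) = ((d%:R + 1) * K - 4 * p * (p + 1) * barrier_radius) / u ^+ 2.
  by field; rewrite gt_eqF.
rewrite ler_wpM2r ?invr_ge0 ?sqr_ge0 //.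
have p1 : 1 <= p by rewrite ler_pdivlMr // mul1r ler_nat.
have : barrier_radius <= 4 * p * (p + 1) * barrier_radius by rewrite ler_peMl //; nra.
rewrite {1}/barrier_radius -/K; lra.
Qed.

Lemma barrier_gt0 n : n 0 k <= 0 -> 0 < barrier n.
Proof.
move=> nk; have r36 := barrier_radius_ge36; have := offset_ge barrier_radius n => o.
rewrite mulr_gt0 ?powR_gt0 //; last lra.
have : (n 0 k)%:~R <= 0 :> R by rewrite lerz0.
by rewrite /height; lra.
Qed.

Lemma barrier_reflect n : barrier (reflect_at k n) = - barrier n.
Proof. by rewrite /barrier height_reflect offset_reflect mulNr. Qed.

Lemma barrier_decay n : (0 < d)%N -> `|barrier n| <= 2 ^+ d.-1 * (jap R n)^-1 ^+ d.-1.
Proof.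
move=> d0; have r36 := barrier_radius_ge36; have o := offset_ge barrier_radius n.
set u := offset _ n in o; have u0 : 0 < u by lra.
have su0 : 0 < Num.sqrt u by rewrite sqrtr_gt0.
have yu : `|height n| <= Num.sqrt u.
  rewrite -(@ler_pXn2r _ 2) ?nnegrE ?sqrtr_ge0 // real_normK ?num_real // sqr_sqrtr ?(ltW u0) //.
  have <- : (centred k n) ^+ 2 = height n ^+ 2 by rewrite centred_height sqrrN.
  by apply: centred_le; lra.
rewrite normrM (ger0_norm (powR_ge0 _ _)) -/u powR_half_sqrt; last exact: ltW.
have -> : (Num.sqrt u)^-1 ^+ d = (Num.sqrt u)^-1 * (Num.sqrt u)^-1 ^+ d.-1.
  by rewrite -exprS prednK.
rewrite mulrA -exprMn.
apply: (@le_trans _ _ (1 * (Num.sqrt u)^-1 ^+ d.-1)).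
  by rewrite ler_wpM2r ?exprn_ge0 ?invr_ge0 ?sqrtr_ge0 // ler_pdivrMr // mul1r.
rewrite mul1r lerXn2r ?nnegrE ?invr_ge0 ?(ltW su0) //.
  by rewrite divr_ge0 // ltW // jap_gt0.
have := jap_le_offset n r36; rewrite -/u => j.
rewrite -[leLHS]mul1r ler_pdivrMr // mulrAC ler_pdivlMr ?jap_gt0 //; lra.
Qed.

End Barrier.

(** * Existence of the dipole potential by monotone iteration *)

Section Dipole.
Variables (R : realType) (d : nat) (k : 'I_d).
Implicit Types (n m : 'rV[int]_d) (u v f g : 'rV[int]_d -> R).

Definition delta m n : R := (n == m)%:R.

Definition dipole_source n : R := delta 0 n - delta (basis_vec k) n.

Let odd u := forall n, u (reflect_at k n) = - u n.

Lemma laplacian_odd u : odd u -> odd (laplacian u).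
Proof.
move=> ou n; rewrite -laplacian_reflect.
by rewrite -laplacianN; congr laplacian; apply/funext.
Qed.

Lemma reflect_at_basis : reflect_at k (basis_vec k) = 0.
Proof.
by apply/rowP => j; rewrite reflect_atE entry_basis mxE; case: eqP.
Qed.

Lemma dipole_source_odd : odd dipole_source.
Proof.
move=> n; rewrite /dipole_source /delta opprB.
have inj := inj_eq (inv_inj (reflect_atK k)).
have -> : (reflect_at k n == 0) = (n == basis_vec k) by rewrite -(inj n) reflect_at_basis.
have -> // : (reflect_at k n == basis_vec k) = (n == 0).
by rewrite -(inj _ (basis_vec k)) reflect_atK reflect_at_basis.
Qed.

(** A lazy Jacobi step: dividing by 4d rather than 2d keeps half of the weight at [n]. Its fixed
    points solve the dipole equation. *)
Definition relax u n : R := u n + (laplacian u n + dipole_source n) / (4 * d%:R).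

Lemma relax_odd u : odd u -> odd (relax u).
Proof.
by move=> ou n; rewrite /relax ou laplacian_odd // dipole_source_odd; ring.
Qed.

Lemma d_gt0 : 0 < (d%:R : R).
Proof. by rewrite ltr0n; case: d k => // -[]. Qed.

(** Only the neighbour across n_k = 1/2 can carry a negative value, and it is then the mirror image
    of [n] itself, with value [- g n]. The share of the weight kept at [n] cancels it exactly, which
    is why the averaging is lazy. *)
Lemma odd_lazy_average_ge0 g n : odd g -> (forall m, m 0 k <= 0 -> 0 <= g m) ->
  n 0 k <= 0 -> 0 <= g n + laplacian g n / (4 * d%:R).
Proof.
move=> og g0 nk.
have dd := d_gt0.
have -> : g n + laplacian g n / (4 * d%:R) =
   (\sum_i ((g n + g (n + basis_vec i)) + (g n + g (n - basis_vec i)))) / (4 * d%:R) .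
  apply: (mulIf (x := 4 * d%:R)); first by rewrite gt_eqF //; lra.
  rewrite mulrDl !divfK ?gt_eqF //; try lra.
  have -> : g n * (4 * d%:R) = \sum_(i < d) 4 * g n.
    by rewrite sumr_const card_ord -[RHS]mulr_natl; ring.
  rewrite laplacianE -big_split /=.
  by apply: eq_bigr => i _; ring.
rewrite divr_ge0 //.
apply: sumr_ge0 => i _; rewrite addr_ge0 //; last first.
  rewrite addr_ge0 ?g0 //  entryB entry_basis; case: (_ == _) => //=; lia.
have [nb|nb] := leP ((n + basis_vec i) 0 k) 0; first by rewrite addr_ge0 ?g0.
have ik : i = k.
  apply/eqP; apply: contraT => ik; move: nb.
  by rewrite entryD entry_basis eq_sym (negPf ik) /= addr0 ltNge nk.
have nk0 : n 0 k = 0.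
  move: nb; rewrite ik entryD entry_basis eqxx /=; lia.
have -> : n + basis_vec i = reflect_at k n.
  apply/rowP => j; rewrite ik entryD entry_basis reflect_atE.
  by case: eqP => [->|_] /=; [rewrite nk0|rewrite addr0].
by rewrite og subrr.
Qed.

Lemma relax_mono u v n : odd u -> odd v -> (forall m, m 0 k <= 0 -> u m <= v m) ->
  n 0 k <= 0 -> relax u n <= relax v n.
Proof.
move=> ou ov uv nk; rewrite -subr_ge0.
have -> : relax v n - relax u n = (v n - u n) + laplacian (fun m => v m - u m) n / (4 * d%:R).
  by rewrite laplacianB /relax; ring.
apply: (odd_lazy_average_ge0 (g := fun m => v m - u m)) => // [m|m mk].
  by rewrite ou ov; ring.
by rewrite subr_ge0 uv.
Qed.

Lemma laplacian_cvg (u_ : nat -> 'rV[int]_d -> R) u n :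
  (forall m, u_ j m @[j --> \oo] --> u m) ->
  laplacian (u_ j) n @[j --> \oo] --> laplacian u n.
Proof.
move=> cu.
rewrite laplacianE; under eq_fun do rewrite laplacianE.
apply: cvg_big => [|i _]; first exact: add_continuous.
by apply: cvgB; [apply: cvgD; exact: cu|apply: cvgM; [exact: cvg_cst|exact: cu]].
Qed.

(* Monotone relaxation from 0 on the half space n_k <= 0, with odd reflection across
   n_k = 1/2, stays below the superharmonic barrier. *)
Lemma dipole_exists : (2 <= d)%N -> exists w : 'rV[int]_d -> R,
  (forall n, - laplacian w n = delta 0 n - delta (basis_vec k) n) /\
  exists2 C : R, 0 < C & forall n, `|w n| <= C * (jap R n)^-1 ^+ d.-1.
Proof.
move=> d2.
have d0 : (0 < d)%N by apply: leq_trans d2.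
(* Dividing the barrier by [c0] makes its negative Laplacian at least 1 at the origin, the only
   point of the half space n_k <= 0 that carries a source. *)
pose c0 : R := barrier R k 0 / offset k (barrier_radius R d) 0 ^+ 2.
have c00 : 0 < c0.
  rewrite divr_gt0 ?barrier_gt0 ?mxE // exprn_gt0 //.
  have := barrier_radius_ge36 R d; have := offset_ge k (barrier_radius R d) 0; lra.
pose s n : R := c0^-1 * barrier R k n.
have os : odd s by move=> n; rewrite /s barrier_reflect mulrN.
have s0 n : n 0 k <= 0 -> 0 <= s n.
  by move=> nk; rewrite mulr_ge0 ?invr_ge0 ?ltW // barrier_gt0.
have relax_s n : n 0 k <= 0 -> relax s n <= s n.
  move=> nk; rewrite /relax gerDl ler_pdivrMr; last by have := d_gt0; lra.
  rewrite mul0r laplacianZ /dipole_source /delta.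
  have -> : (n == basis_vec k) = false.
    by apply/eqP => E; move: nk; rewrite E entry_basis eqxx.
  rewrite subr0.
  have sup := barrier_superharmonic R d2 nk.
  have [n0|_] := eqVneq n 0.
    rewrite n0 -/c0 in sup *.
    have ic0 : 0 <= c0^-1 by rewrite invr_ge0 ltW.
    have := ler_wpM2l ic0 sup.
    by rewrite mulVf ?gt_eqF // mulrN /=; lra.
  rewrite addr0 pmulr_rle0 ?invr_gt0 // -oppr_ge0; apply: le_trans sup.
  by rewrite divr_ge0 ?sqr_ge0 // ltW // barrier_gt0.
pose u_ (j : nat) := iter j relax (fun=> 0).
have ou j : odd (u_ j).
  elim: j => [|j IH] /=; first by move=> n; rewrite oppr0.
  exact: relax_odd.
have u_s j n : n 0 k <= 0 -> u_ j n <= s n.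
  elim: j n => [|j IH] n nk; first exact: s0.
  by apply: le_trans (relax_s _ nk); exact: relax_mono.
have u_mono j n : n 0 k <= 0 -> u_ j n <= u_ j.+1 n.
  elim: j n => [|j IH] n nk; last first.
    exact: (relax_mono (ou j) (ou j.+1) IH nk).
  rewrite /= /relax.
  have -> : laplacian (fun=> 0 : R) n = 0.
    by rewrite laplacianE big1 // => i _; rewrite mulr0 subr0 addr0.
  rewrite !add0r divr_ge0 //.
  rewrite /dipole_source /delta.
  have -> : (n == basis_vec k) = false.
    by apply/eqP => E; move: nk; rewrite E entry_basis eqxx.
  by rewrite subr0.
have u_ge0 j n : n 0 k <= 0 -> 0 <= u_ j n.
  move=> nk; elim: j => [//|j IH]; exact: le_trans IH (u_mono _ _ nk).
have cH n : n 0 k <= 0 -> cvgn (u_ ^~ n).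
  move=> nk; apply: nondecreasing_is_cvgn.
    by apply/nondecreasing_seqP => j; exact: u_mono.
  by exists (s n) => _ [j _ <-]; exact: u_s.
have H01 n : ~~ (n 0 k <= 0) -> reflect_at k n 0 k <= 0.
  by rewrite reflect_atE eqxx; lia.
have cA n : cvgn (u_ ^~ n).
  have [nk|/H01 nk] := boolP (n 0 k <= 0); first exact: cH.
  have -> : u_ ^~ n = (fun j => - u_ j (reflect_at k n)).
    by apply/funext => j; rewrite ou opprK.
  by apply: is_cvgN; exact: cH.
have u_abs j n : `|u_ j n| <= `|s n|.
  have [nk|/H01 nk] := boolP (n 0 k <= 0).
    by rewrite !ger0_norm ?u_ge0 ?s0 ?u_s.
  rewrite -[n](reflect_atK k) ou os !normrN.
  by rewrite !ger0_norm ?u_ge0 ?s0 ?u_s.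
pose w n := limn (u_ ^~ n).
have cw n : u_ j n @[j --> \oo] --> w n by exact: cA.
exists w; split.
  move=> n.
  have c1 : relax (u_ j) n @[j --> \oo] --> relax w n.
    apply: cvgD; first exact: cw.
    apply: cvgM; last exact: cvg_cst.
    by apply: cvgD; [exact: laplacian_cvg|exact: cvg_cst].
  have c2 : u_ j.+1 n @[j --> \oo] --> w n.
    by have := cw n; rewrite -(cvg_shiftS (u_ ^~ n)).
  have : relax w n = w n.
    by apply: (cvg_unique _ c1 c2); exact: Rhausdorff.
  rewrite /relax => /eqP; rewrite eq_sym -subr_eq0 opprD addrA subrr add0r oppr_eq0.
  rewrite mulf_eq0 invr_eq0 => /orP[/eqP|]; first by rewrite /dipole_source; lra.
  by rewrite gt_eqF //; have := d_gt0; lra.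
exists (c0^-1 * 2 ^+ d.-1); first by rewrite mulr_gt0 ?invr_gt0 ?exprn_gt0.
move=> n; apply: (@le_trans _ _ `|s n|).
  have cn : `|u_ j n| @[j --> \oo] --> `|w n| by apply: cvg_norm; exact: cw.
  rewrite -(cvg_lim (@Rhausdorff R) cn); apply: limr_le; first by apply/cvg_ex; eexists; exact: cn.
  by apply: nearW => j; exact: u_abs.
have ic0 : 0 <= c0^-1 by rewrite invr_ge0 ltW.
rewrite normrM (ger0_norm ic0) -mulrA ler_wpM2l //.
exact: barrier_decay.
Qed.

End Dipole.

Section DipoleDecay.
Variables (R : realType) (d : nat).
Implicit Types (n m : 'rV[int]_d) (u w : 'rV[int]_d -> R).

Lemma gradient_decay u (i : 'I_d) n (A B : R) : (4 <= nsup n)%N -> 0 < B ->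
  (forall m, (nsup n <= 2 * nsup m)%N -> `|u m| <= A) ->
  (forall m, (nsup n <= 2 * nsup m)%N -> `|laplacian u m| <= B) ->
  `|u (n + basis_vec i) - u n| <= 16 * d%:R * A / jap R n + 2 * B * jap R n.
Proof.
move=> n4 B0 uA uB.
pose M := (nsup n %/ 4)%N.
have M1 : (0 < M)%N by rewrite divn_gt0.
have near m : (nsup (m - n)%R <= M.+1)%N -> (nsup n <= 2 * nsup m)%N.
  move=> mM; have := nsupD (n - m) m; rewrite subrK -opprB nsupN.
  move=> h; have := leq_trans h (leq_add mM (leqnn _)); rewrite /M; move: n4; clear; lia.
have A0 : 0 <= A by apply: le_trans (uA n _); rewrite ?leq_pmull.
have := @gradient_estimate R d u i n A B M M1 B0 (fun m mM => uA m (near m mM))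
  (fun m mM => uB m (near m (leqW mM))).
move=> /le_trans; apply.
have Mr : 0 < (M%:R : R) by rewrite ltr0n.
have jM : jap R n <= 8 * M%:R by rewrite /jap -natrM ler_nat /M; lia.
have Mj : M%:R <= jap R n by rewrite /jap ler_nat /M; lia.
have j0 := jap_gt0 R n.
apply: lerD; last by rewrite ler_wpM2l //; lra.
rewrite ler_pdivrMr // -[leRHS]mulrA -[leRHS]mulrA [X in _ <= X](_ : _ = (2 * d%:R * A) * (8 * M%:R / jap R n)); last by ring.
rewrite ler_peMr ?mulr_ge0 // ler_pdivlMr // mul1r //.
Qed.

Definition is_dipole k w (C : R) :=
  [/\ forall n, - laplacian w n = delta R 0 n - delta R (basis_vec k) n,
      forall n, `|w n| <= C * (jap R n)^-1 ^+ d.-1 &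
      forall n i, `|w (n + basis_vec i) - w n| <= C * (jap R n)^-1 ^+ d].

Lemma jap_le_nsup_half n m : (nsup n <= 2 * nsup m)%N -> (jap R m)^-1 <= 2 * (jap R n)^-1.
Proof.
move=> h; rewrite -[leLHS]mul1r ler_pdivrMr ?jap_gt0 // mulrAC ler_pdivlMr ?jap_gt0 // mul1r.
by rewrite /jap -natrM ler_nat; lia.
Qed.

Lemma dipoles_exist : (2 <= d)%N -> exists (w : 'I_d -> 'rV[int]_d -> R) (C : R),
  0 < C /\ forall k, is_dipole k (w k) C.
Proof.
move=> d2.
have d0 : (0 < d)%N by apply: leq_trans d2.
have one k : exists wC : ('rV[int]_d -> R) * R, 0 < wC.2 /\ is_dipole k wC.1 wC.2.
  have [w [lw [C C0 wC]]] := dipole_exists R k d2.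
  pose C' : R := C + 16 * d%:R * (C * 2 ^+ d.-1) + 2 + 2 * C * 4 ^+ d.
  have t1 : 0 <= 16 * d%:R * (C * 2 ^+ d.-1) by rewrite !mulr_ge0 ?exprn_ge0 // ltW.
  have t2 : 0 <= 2 * C * 4 ^+ d by rewrite !mulr_ge0 ?exprn_ge0 // ltW.
  have CC' : C <= C' by rewrite /C'; lra.
  exists (w, C'); split; first by rewrite /=; lra.
  have j0 n : 0 <= (jap R n)^-1 by rewrite invr_ge0 ltW // jap_gt0.
  split=> //= [n|n i].
    by apply: le_trans (wC n) _; rewrite ler_wpM2r // exprn_ge0.
  have [n4|n4] := leqP 4 (nsup n).
    have harm m : (nsup n <= 2 * nsup m)%N -> laplacian w m = 0.
      move=> h; have := lw m; rewrite /delta.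
      have -> : (m == 0) = false by apply/eqP => E; move: h; rewrite E nsup0; lia.
      have -> : (m == basis_vec k) = false.
        by apply/eqP => E; move: h; rewrite E nsup_basis; lia.
      by rewrite subr0 /= => /eqP; rewrite oppr_eq0 => /eqP.
    (* The Laplacian vanishes here, but [gradient_decay] asks for a positive bound; this one
       contributes a term of the same order jap^(-d) as the main one. *)
    have Bp : 0 < (jap R n)^-1 ^+ d.+1 by rewrite exprn_gt0 // invr_gt0 jap_gt0.
    have A m : (nsup n <= 2 * nsup m)%N -> `|w m| <= C * 2 ^+ d.-1 * (jap R n)^-1 ^+ d.-1.
      move=> h; apply: le_trans (wC m) _; rewrite -mulrA ler_wpM2l ?(ltW C0) //.
      rewrite -exprMn lerXn2r ?nnegrE ?mulr_ge0 //.
      exact: jap_le_nsup_half.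
    have := gradient_decay i n4 Bp A; move=> /(_ _)/le_trans; apply.
      by move=> m /harm ->; rewrite normr0 ltW.
    have -> : 16 * d%:R * (C * 2 ^+ d.-1 * (jap R n)^-1 ^+ d.-1) / jap R n =
       16 * d%:R * (C * 2 ^+ d.-1) * (jap R n)^-1 ^+ d.
      have -> : (jap R n)^-1 ^+ d = (jap R n)^-1 ^+ d.-1 / jap R n.
        by rewrite -exprSr prednK.
      ring.
    have -> : 2 * (jap R n)^-1 ^+ d.+1 * jap R n = 2 * (jap R n)^-1 ^+ d.
      by rewrite exprSr mulrA divfK ?jap_neq0.
    rewrite -mulrDl ler_wpM2r ?exprn_ge0 // /C'; lra.
  apply: (@le_trans _ _ (2 * C)).
    have b m : `|w m| <= C.
      apply: le_trans (wC m) _; rewrite ler_piMr ?(ltW C0) // exprn_ile1 //.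
      by rewrite invf_le1 ?jap_gt0 // jap_ge1.
    apply: le_trans (ler_normB _ _) _; have := b n; have := b (n + basis_vec i); lra.
  apply: (@le_trans _ _ (2 * C * 4 ^+ d * (jap R n)^-1 ^+ d)).
    rewrite -mulrA -exprMn ler_peMr ?mulr_ge0 ?(ltW C0) //.
    rewrite exprn_ege1 // ler_pdivlMr ?jap_gt0 // mul1r /jap ler_nat; lia.
  by rewrite ler_wpM2r ?exprn_ge0 // /C'; lra.
have [wC wCP] := choice one.
exists (fun k => (wC k).1), (1 + \sum_k (wC k).2).
have s0 : 0 <= \sum_k (wC k).2 by apply: sumr_ge0 => k _; case: (wCP k) => /ltW.
split; first by lra.
move=> k; have [C0 [h1 h2 h3]] := wCP k.
have le : (wC k).2 <= 1 + \sum_k (wC k).2.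
  rewrite (bigD1 k) //= addrCA lerDl addr_ge0 // sumr_ge0 // => j _.
  by case: (wCP j) => /ltW.
have j0 n : 0 <= (jap R n)^-1 by rewrite invr_ge0 ltW // jap_gt0.
split=> // [n|n i].
  by apply: le_trans (h2 n) _; rewrite ler_wpM2r ?exprn_ge0.
by apply: le_trans (h3 n i) _; rewrite ler_wpM2r ?exprn_ge0.
Qed.

End DipoleDecay.

(** * Cutoff at scale N with quantitative differences *)

Section Cutoff.
Variables (R : realType) (d : nat).
Implicit Types (n m : 'rV[int]_d) (t : R) (N : nat).

Definition pospart_sqr t : R := Num.max 0 t ^+ 2.

Lemma pospart_sqr_taylor a b : `|pospart_sqr b - pospart_sqr a - 2 * Num.max 0 a * (b - a)| <= (b - a) ^+ 2.
Proof.
rewrite /pospart_sqr ler_norml.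
have s1 := sqr_ge0 (b - a); have s2 := sqr_ge0 a; have s3 := sqr_ge0 b.
by case: (leP 0 a) => ha; case: (leP 0 b) => hb; apply/andP; split; nra.
Qed.

(* Of class C^{1,1}, so that the second differences of the cutoff are O(N^-2). *)
Definition spline t : R := 1 - (pospart_sqr (t - 1) - 2 * pospart_sqr (t - 2) + pospart_sqr (t - 3)) / 2.

Lemma spline_eq1 t : t <= 1 -> spline t = 1.
Proof.
move=> t1; rewrite /spline /pospart_sqr !(max_idPl _); lra.
Qed.

Lemma spline_eq0 t : 3 <= t -> spline t = 0.
Proof.
move=> t1; rewrite /spline /pospart_sqr !(max_idPr _); lra.
Qed.

Lemma spline_norm t : `|spline t| <= 1.
Proof.
rewrite /spline /pospart_sqr ler_norml.
by case: (leP 0 (t - 1)) => h1; case: (leP 0 (t - 2)) => h2; case: (leP 0 (t - 3)) => h3;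
  apply/andP; split; nra.
Qed.

Definition spline' t : R := - (Num.max 0 (t - 1) - 2 * Num.max 0 (t - 2) + Num.max 0 (t - 3)).

Lemma spline'_norm t : `|spline' t| <= 1.
Proof.
rewrite /spline' ler_norml.
by case: (leP 0 (t - 1)) => h1; case: (leP 0 (t - 2)) => h2; case: (leP 0 (t - 3)) => h3;
  apply/andP; split; lra.
Qed.

Lemma spline_taylor a b : `|spline b - spline a - spline' a * (b - a)| <= 2 * (b - a) ^+ 2.
Proof.
have := pospart_sqr_taylor (a - 1) (b - 1); have := pospart_sqr_taylor (a - 2) (b - 2).
have := pospart_sqr_taylor (a - 3) (b - 3).
have e c : b - c - (a - c) = b - a by ring.
by rewrite !e /spline /spline' !ler_norml; lra.
Qed.

(** Taken as a function of |n|^2, whose increments are exact affine expressions in n. The divisor d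
    N^2 bounds |n|^2 on the box of radius N, so the cutoff equals 1 there. *)
Definition cutoff N n : R := spline (sq R n / (d%:R * N%:R ^+ 2)).

Hypothesis d0 : (0 < d)%N.

Lemma cutoff_eq1 N n : (0 < N)%N -> (nsup n <= N)%N -> cutoff N n = 1.
Proof.
move=> N0 nN; apply: spline_eq1.
rewrite ler_pdivrMr ?mul1r ?mulr_gt0 ?exprn_gt0 ?ltr0n //.
apply: le_trans (sq_le R n) _; rewrite ler_wpM2l // lerXn2r ?nnegrE ?ler0n //.
by rewrite ler_nat.
Qed.

Lemma cutoff_eq0 N n : (0 < N)%N -> (2 * d * N <= nsup n)%N -> cutoff N n = 0.
Proof.
move=> N0 nN; apply: spline_eq0.
have dr : 1 <= (d%:R : R) by rewrite ler1n.
have Nr : 1 <= (N%:R : R) by rewrite ler1n.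
rewrite ler_pdivlMr ?mulr_gt0 ?exprn_gt0 ?ltr0n //.
apply: le_trans (sq_ge R n).
apply: (@le_trans _ _ ((2 * d * N)%:R ^+ 2)).
  rewrite !natrM; set N2 := N%:R ^+ 2.
  rewrite exprMn -/N2 mulrA ler_wpM2r ?sqr_ge0 //; nra.
by rewrite lerXn2r ?nnegrE ?ler0n // ler_nat.
Qed.

Lemma cutoff_norm N n : `|cutoff N n| <= 1.
Proof. exact: spline_norm. Qed.

(** On this box the argument of the spline moves by at most 7/N, so its second-order error is at
    most 2 * 49 / N^2. The first-order parts are kept explicit because the two opposite ones cancel,
    up to 2/(d N^2), in the second difference. *)
Lemma cutoff_step N n i : (0 < N)%N -> (nsup n <= 2 * d * N + 1)%N ->
  exists e1 e2 : R,
  [/\ [/\ cutoff N (n + basis_vec i) - cutoff N n = spline' (sq R n / (d%:R * N%:R ^+ 2)) * (2 * (n 0 i)%:~R + 1) / (d%:R * N%:R ^+ 2) + e1,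
   cutoff N (n - basis_vec i) - cutoff N n = spline' (sq R n / (d%:R * N%:R ^+ 2)) * (- 2 * (n 0 i)%:~R + 1) / (d%:R * N%:R ^+ 2) + e2,
   `|e1| <= 98 / N%:R ^+ 2 & `|e2| <= 98 / N%:R ^+ 2],
   `|(2 * (n 0 i)%:~R + 1 : R) / (d%:R * N%:R ^+ 2)| <= 7 / N%:R &
   `|(- 2 * (n 0 i)%:~R + 1 : R) / (d%:R * N%:R ^+ 2)| <= 7 / N%:R].
Proof.
move=> N0 nN.
have dr : 1 <= (d%:R : R) by rewrite ler1n.
have Nr : 1 <= (N%:R : R) by rewrite ler1n.
set D := d%:R * N%:R ^+ 2.
have D0 : 0 < D by rewrite mulr_gt0 ?exprn_gt0 //; lra.
set z : R := (n 0 i)%:~R.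
have zb : `|z| <= 2 * d%:R * N%:R + 1.
  rewrite /z abs_coord; apply: (@le_trans _ _ (2 * d * N + 1)%:R).
    by rewrite ler_nat (leq_trans (leq_nsup _ _)).
  by rewrite natrD !natrM.
have dN : 1 <= d%:R * N%:R :> R by rewrite -natrM ler1n muln_gt0 d0.
have s1 : `|(2 * z + 1) / D| <= 7 / N%:R.
  rewrite normrM normfV (gtr0_norm D0) ler_pdivrMr //.
  have -> : 7 / N%:R * D = 7 * (d%:R * N%:R) :> R by rewrite /D; field; lra.
  move: zb; rewrite !ler_norml; lra.
have s2 : `|(- 2 * z + 1) / D| <= 7 / N%:R.
  rewrite normrM normfV (gtr0_norm D0) ler_pdivrMr //.
  have -> : 7 / N%:R * D = 7 * (d%:R * N%:R) :> R by rewrite /D; field; lra.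
  move: zb; rewrite !ler_norml; lra.
have sqle (x : R) : `|x| <= 7 / N%:R -> 2 * x ^+ 2 <= 98 / N%:R ^+ 2.
  move=> xb; have -> : 98 / N%:R ^+ 2 = 2 * (7 / N%:R) ^+ 2 :> R by field; lra.
  rewrite ler_wpM2l // -real_normK ?num_real // lerXn2r ?nnegrE ?divr_ge0 //; lra.
exists (cutoff N (n + basis_vec i) - cutoff N n - spline' (sq R n / D) * (2 * z + 1) / D).
exists (cutoff N (n - basis_vec i) - cutoff N n - spline' (sq R n / D) * (- 2 * z + 1) / D).
split=> //; split.
- by rewrite addrCA subrr addr0.
- by rewrite addrCA subrr addr0.
- apply: le_trans (sqle _ s1); rewrite /cutoff -/D sq_addb -/z.
  have := spline_taylor (sq R n / D) ((sq R n + 2 * z + 1) / D).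
  have -> : (sq R n + 2 * z + 1) / D - sq R n / D = (2 * z + 1) / D by ring.
  by rewrite mulrA.
- apply: le_trans (sqle _ s2); rewrite /cutoff -/D sq_subb -/z.
  have := spline_taylor (sq R n / D) ((sq R n - 2 * z + 1) / D).
  have -> : (sq R n - 2 * z + 1) / D - sq R n / D = (- 2 * z + 1) / D by ring.
  by rewrite mulrA.
Qed.

Lemma cutoff_out N n i : (0 < N)%N -> (2 * d * N + 1 <= nsup n)%N ->
  [/\ cutoff N n = 0, cutoff N (n + basis_vec i) = 0 & cutoff N (n - basis_vec i) = 0].
Proof.
move=> N0 nN; split; apply: cutoff_eq0 => //; first by rewrite (leq_trans _ nN) // leq_addr.
  have := nsup_subb (n + basis_vec i) i; rewrite addrK; lia.
have := nsup_addb (n - basis_vec i) i; rewrite subrK; lia.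
Qed.

Lemma cutoff_diff N n i : (0 < N)%N ->
  `|cutoff N (n + basis_vec i) - cutoff N n| <= 105 / N%:R /\
  `|cutoff N (n - basis_vec i) - cutoff N n| <= 105 / N%:R.
Proof.
move=> N0; have Nr : 1 <= (N%:R : R) by rewrite ler1n.
have N1 : 98 / N%:R ^+ 2 <= 98 / N%:R :> R.
  rewrite ler_wpM2l // lef_pV2 ?posrE ?exprn_gt0 //; try lra.
  by rewrite expr2 ler_peMl //; lra.
have e105 : 105 / N%:R = 7 / N%:R + 98 / N%:R :> R by rewrite -mulrDl; congr (_ / _); ring.
have [nN|nN] := leqP (nsup n) (2 * d * N + 1); last first.
  have [//||-> -> ->] := @cutoff_out N n i; first by lia.
  by rewrite subrr normr0 divr_ge0 //; lra.
have [e1 [e2 [[-> -> h1 h2] h3 h4]]] := cutoff_step i N0 nN.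
have sp x y : `|spline' x * y| <= `|y|.
  by rewrite normrM ler_piMl // spline'_norm.
rewrite -!mulrA; split.
  apply: le_trans (ler_normD _ _) _; have := sp (sq R n / (d%:R * N%:R ^+ 2)) ((2 * (n 0 i)%:~R + 1) / (d%:R * N%:R ^+ 2)).
  lra.
apply: le_trans (ler_normD _ _) _; have := sp (sq R n / (d%:R * N%:R ^+ 2)) ((- 2 * (n 0 i)%:~R + 1) / (d%:R * N%:R ^+ 2)).
lra.
Qed.

Lemma cutoff_diff2 N n i : (0 < N)%N ->
  `|cutoff N (n + basis_vec i) + cutoff N (n - basis_vec i) - 2 * cutoff N n| <= 200 / N%:R ^+ 2.
Proof.
move=> N0; have Nr : 1 <= (N%:R : R) by rewrite ler1n.
have dr : 1 <= (d%:R : R) by rewrite ler1n.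
have [nN|nN] := leqP (nsup n) (2 * d * N + 1); last first.
  have [//||-> -> ->] := @cutoff_out N n i; first by lia.
  by rewrite addr0 mulr0 subrr normr0 divr_ge0 ?sqr_ge0.
have [e1 [e2 [[E1 E2 h1 h2] h3 h4]]] := cutoff_step i N0 nN.
have -> : cutoff N (n + basis_vec i) + cutoff N (n - basis_vec i) - 2 * cutoff N n
   = (cutoff N (n + basis_vec i) - cutoff N n) + (cutoff N (n - basis_vec i) - cutoff N n) by ring.
rewrite E1 E2.
set D := d%:R * N%:R ^+ 2; set s := spline' _.
have -> : s * (2 * (n 0 i)%:~R + 1) / D + e1 + (s * (-2 * (n 0 i)%:~R + 1) / D + e2) = s * (2 / D) + e1 + e2 by ring.
have D0 : 0 < D by rewrite mulr_gt0 ?exprn_gt0 //; lra.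
have sD : `|s * (2 / D)| <= 2 / N%:R ^+ 2.
  rewrite normrM (@ger0_norm _ (2 / D)) ?divr_ge0 ?(ltW D0) //.
  apply: (@le_trans _ _ (1 * (2 / D))).
    by rewrite ler_wpM2r ?spline'_norm // divr_ge0 // ltW.
  rewrite mul1r ler_wpM2l // lef_pV2 ?posrE ?exprn_gt0 //; try lra.
  by rewrite ler_peMl // sqr_ge0.
have -> : 200 / N%:R ^+ 2 = 2 / N%:R ^+ 2 + 98 / N%:R ^+ 2 + 98 / N%:R ^+ 2 + 2 / N%:R ^+ 2 :> R by field; lra.
have : 0 <= 2 / N%:R ^+ 2 :> R by rewrite divr_ge0 ?sqr_ge0.
have := ler_normD (s * (2 / D) + e1) e2; have := ler_normD (s * (2 / D)) e1; lra.
Qed.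

End Cutoff.

(** * Increments of lattice functions in terms of the dipole *)

Section Representation.
Variables (R : realType) (d : nat).
Hypothesis d0 : (0 < d)%N.
Implicit Types (n m : 'rV[int]_d) (u w f g : 'rV[int]_d -> R).

Lemma laplacianM f g n : laplacian (fun m => f m * g m) n = g n * laplacian f n +
  \sum_i (f n * (g (n + basis_vec i) + g (n - basis_vec i) - 2 * g n)
    + (f (n + basis_vec i) - f n) * (g (n + basis_vec i) - g n)
    + (f (n - basis_vec i) - f n) * (g (n - basis_vec i) - g n)).
Proof.
by rewrite !laplacianE mulr_sumr -big_split; apply: eq_bigr => i _ /=; ring.
Qed.

Lemma sum_delta f m N : (nsup m <= N)%N ->
  \sum_(n <- box d N) f n * delta R m n = f m.
Proof.
move=> mN; rewrite (bigD1_seq m) ?mem_box ?box_uniq //= big1 => [|n /negPf nm].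
  by rewrite /delta eqxx mulr1 addr0.
by rewrite /delta nm mulr0.
Qed.

Lemma jap_pow_step n m k : (nsup m <= 1)%N ->
  (jap R (n + m))^-1 ^+ k <= 2 ^+ k * (jap R n)^-1 ^+ k.
Proof.
move=> m1; have j1 := jap_gt0 R (n + m); have j2 := jap_gt0 R n.
rewrite -exprMn lerXn2r ?nnegrE ?mulr_ge0 ?invr_ge0 ?(ltW j1) ?(ltW j2) //.
rewrite -[leLHS]mul1r ler_pdivrMr // mulrAC ler_pdivlMr // mul1r.
exact: jap_step.
Qed.

Lemma sum_ord_le (F : 'I_d -> R) (c : R) : (forall i, F i <= c) -> \sum_i F i <= d%:R * c.
Proof.
move=> Fc; rewrite mulr_natl -[X in _ *+ X]card_ord -sumr_const.
by apply: ler_sum => i _.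
Qed.

Section OneDipole.
Variables (k : 'I_d) (w : 'rV[int]_d -> R) (C : R).
Hypothesis wC : is_dipole k w C.

Lemma dipole_cst_ge0 : 0 <= C.
Proof.
case: wC => _ h _; have := le_trans (normr_ge0 _) (h 0).
by rewrite /jap nsup0 invr1 expr1n mulr1.
Qed.

Lemma dipole_step_sub n i : `|w (n - basis_vec i) - w n| <= C * 2 ^+ d * (jap R n)^-1 ^+ d.
Proof.
case: wC => _ _ h; rewrite distrC; have := h (n - basis_vec i) i; rewrite subrK.
move=> /le_trans; apply; rewrite -mulrA ler_wpM2l ?dipole_cst_ge0 //.
by apply: jap_pow_step; rewrite nsupN nsup_basis.
Qed.

Definition cutoff_cst : R := d%:R * (200 + 105 + 105 * 2 ^+ d).

Lemma cutoff_cst_ge0 : 0 <= cutoff_cst.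
Proof.
exact: mulr_ge0 (ler0n R d) (addr_ge0 (addr_ge0 (ler0n R 200) (ler0n R 105))
  (mulr_ge0 (ler0n R 105) (exprn_ge0 d (ler0n R 2)))).
Qed.

(** The commutator vanishes where the cutoff is locally 1, that is for nsup n < N. Elsewhere the
    decay of [w] and of its gradient applies at distance N: w times a second difference is
    N^(-(d-1)) N^(-2), and a product of first differences is N^(-d) N^(-1). *)
Lemma cutoff_commutator N n : (0 < N)%N ->
  `|laplacian (fun m => w m * cutoff R N m) n - cutoff R N n * laplacian w n|
   <= cutoff_cst * C * N%:R^-1 ^+ d.+1.
Proof.
move=> N0; have C0 := dipole_cst_ge0.
have Nr : 0 < (N%:R : R) by rewrite ltr0n.
have iN0 : 0 <= N%:R^-1 :> R by rewrite invr_ge0 ltW.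
rewrite laplacianM addrC addKr.
have [nN|nN] := leqP N (nsup n); last first.
  have K0 := mulr_ge0 (mulr_ge0 cutoff_cst_ge0 C0) (exprn_ge0 d.+1 iN0).
  rewrite big1 ?normr0 // => i _.
  rewrite !cutoff_eq1 ?(leq_trans (nsup_addb _ _)) ?(leq_trans (nsup_subb _ _)) //; last exact: ltnW.
  ring.
have jN : (jap R n)^-1 <= N%:R^-1.
  by rewrite lef_pV2 ?posrE ?jap_gt0 // /jap ler_nat; lia.
have jNk e : (jap R n)^-1 ^+ e <= N%:R^-1 ^+ e.
  by rewrite lerXn2r ?nnegrE ?invr_ge0 // ltW // jap_gt0.
case: (wC) => _ w1 w2.
apply: le_trans (ler_norm_sum _ _ _) _.
rewrite /cutoff_cst -!mulrA; apply: sum_ord_le => i.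
have [c1 c2] := cutoff_diff R d0 n i N0; have c3 := cutoff_diff2 R d0 n i N0.
have a1 : `|w n * (cutoff R N (n + basis_vec i) + cutoff R N (n - basis_vec i) - 2 * cutoff R N n)|
   <= 200 * (C * N%:R^-1 ^+ d.+1).
  have -> : 200 * (C * N%:R^-1 ^+ d.+1) = (C * N%:R^-1 ^+ d.-1) * (200 / N%:R ^+ 2) :> R.
    have -> : N%:R^-1 ^+ d.+1 = N%:R^-1 ^+ d.-1 / N%:R ^+ 2 :> R.
      by rewrite -exprVn -exprD addn2 prednK.
    ring.
  rewrite normrM ler_pM //; apply: le_trans (w1 n) _; by rewrite ler_wpM2l.
have a2 : `|(w (n + basis_vec i) - w n) * (cutoff R N (n + basis_vec i) - cutoff R N n)|
   <= 105 * (C * N%:R^-1 ^+ d.+1).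
  have -> : 105 * (C * N%:R^-1 ^+ d.+1) = (C * N%:R^-1 ^+ d) * (105 / N%:R) :> R by rewrite exprSr; ring.
  rewrite normrM ler_pM //; apply: le_trans (w2 n i) _; by rewrite ler_wpM2l.
have a3 : `|(w (n - basis_vec i) - w n) * (cutoff R N (n - basis_vec i) - cutoff R N n)|
   <= 105 * 2 ^+ d * (C * N%:R^-1 ^+ d.+1).
  have -> : 105 * 2 ^+ d * (C * N%:R^-1 ^+ d.+1) = (C * 2 ^+ d * N%:R^-1 ^+ d) * (105 / N%:R) :> R by rewrite exprSr; ring.
  rewrite normrM ler_pM //; apply: le_trans (dipole_step_sub n i) _.
  by rewrite ler_wpM2l // mulr_ge0 // exprn_ge0.
apply: le_trans (ler_normD _ _) _; apply: le_trans (lerD (ler_normD _ _) (lexx _)) _.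
by apply: le_trans (lerD (lerD a1 a2) a3) _; rewrite -!mulrDl.
Qed.

(* The equation is tested against w * cutoff, whose Laplacian differs from that of w only by the
   commutator term, of size N^(-d-1) on a box of volume N^d. *)
Lemma dipole_representation u (A : R) N : (0 < N)%N ->
  (forall n, (nsup n <= 2 * d * N + 1)%N -> `|u n| <= A) ->
  `|u (basis_vec k) - u 0 -
     \sum_(n <- box d (2 * d * N + 1)) laplacian u n * (w n * cutoff R N n)|
  <= cutoff_cst * C * (7 * d%:R) ^+ d * A / N%:R.
Proof.
move=> N0 uA; set N' := (2 * d * N + 1)%N.
have C0 := dipole_cst_ge0; have K0 := cutoff_cst_ge0.
have Nr : 0 < (N%:R : R) by rewrite ltr0n.
have A0 : 0 <= A by apply: le_trans (uA 0 _); rewrite ?nsup0.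
rewrite -(@sum_laplacian_sym _ _ u (fun n => w n * cutoff R N n) (2 * d * N)); last 2 first.
- by move=> n nN; rewrite cutoff_eq0 ?mulr0 // ltnW.
- by rewrite /N' addn1.
have -> : u (basis_vec k) - u 0 = \sum_(n <- box d N') u n * (cutoff R N n * laplacian w n).
  case: (wC) => lw _ _.
  rewrite (eq_bigr (fun n => (u n * cutoff R N n) * delta R (basis_vec k) n - (u n * cutoff R N n) * delta R 0 n)); last first.
    by move=> n _; rewrite -[laplacian w n]opprK lw; ring.
  rewrite sumrB !(@sum_delta (fun n => u n * cutoff R N n)) ?nsup0 ?nsup_basis ?/N' ?addn1 //.
  by rewrite !cutoff_eq1 ?nsup0 ?nsup_basis // !mulr1.
rewrite -sumrB.
apply: le_trans (ler_norm_sum _ _ _) _.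
apply: (@le_trans _ _ (\sum_(n <- box d N') A * (cutoff_cst * C * N%:R^-1 ^+ d.+1))).
  rewrite big_seq [leRHS]big_seq; apply: ler_sum => n; rewrite mem_box => nN.
  rewrite -mulrBr normrM ler_pM // ?uA // distrC; exact: cutoff_commutator.
rewrite big_const_seq iter_addr_0 count_predT size_box.
(* The side of the box is 4dN + 3 <= 7dN. *)
have sz : (((2 * N').+1 ^ d)%N%:R : R) <= (7 * d%:R) ^+ d * N%:R ^+ d.
  rewrite -exprMn natrX lerXn2r ?nnegrE ?mulr_ge0 //.
  rewrite -!natrM ler_nat /N'; have : (d * N >= 1)%N by rewrite muln_gt0 d0.
  by nia.
rewrite -[leLHS]mulr_natl.
have -> : cutoff_cst * C * (7 * d%:R) ^+ d * A / N%:R =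
   ((7 * d%:R) ^+ d * N%:R ^+ d) * (A * (cutoff_cst * C * N%:R^-1 ^+ d.+1)).
  have -> : N%:R^-1 ^+ d.+1 = (N%:R ^+ d)^-1 * N%:R^-1 :> R by rewrite exprSr exprVn.
  have Nd : N%:R ^+ d != 0 :> R by rewrite expf_neq0 // gt_eqF.
  by field; rewrite ?Nd ?(gt_eqF Nr).
by rewrite ler_wpM2r // !mulr_ge0 // exprn_ge0 // invr_ge0 ltW.
Qed.

End OneDipole.

End Representation.

(** * The radial potential as a function of the squared norm *)

Section Potential.
Variable (R : realType).

(** A logarithm for d = 2, a power for d >= 3. The common growth bound x^(1/4), with x of order
    |n|^2, makes the potential O(|n|^(1/2)): slow enough for the error A/N of
    [dipole_representation] to vanish. *)
Lemma potential_profile (d : nat) : (2 <= d)%N -> exists q : R -> R,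
  (forall x : R, 0 < x -> is_derive x 1 q (- x `^ (- (d%:R / 2)))) /\
  (forall x : R, 1 <= x -> `|q x| <= 4 * x `^ (1/4)).
Proof.
rewrite leq_eqVlt => /orP[/eqP <-|d3].
  exists (fun x => - ln x); split.
    move=> x x0; have -> : - x `^ (- (2%:R / 2)) = - x^-1.
      by rewrite divff // powR_inv1 // ltW.
    exact: (is_deriveN (is_derive1_ln x0)).
  move=> x x1; have x0 : 0 < x by lra.
  rewrite normrN ger0_norm ?ln_ge0 //.
  have h : 0 < x `^ (1/4) by rewrite powR_gt0.
  have := ln_sublinear h; rewrite ln_powR; lra.
pose p : R := d%:R / 2; have p32 : 3/2 <= p.
  by rewrite /p ler_pM2r ?invr_gt0 // ler_nat.
exists (fun x => (p - 1)^-1 * x `^ (1 - p)); split.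
  move=> x x0.
  have := is_deriveZ (p - 1)^-1 (is_derive1_powR (1 - p) x0).
  congr is_derive.
  rewrite -/p /GRing.scale /= (_ : 1 - p - 1 = - p); last by ring.
  by field; lra.
move=> x x1; have x0 : 0 < x by lra.
rewrite normrM !ger0_norm ?powR_ge0 ?invr_ge0; try lra.
have a1 : x `^ (1 - p) <= 1.
  have := @ler_powR R x x1 (1 - p) 0; rewrite powRr0; apply; lra.
have a2 : 1 <= x `^ (1/4).
  have := @ler_powR R x x1 0 (1/4); rewrite powRr0; apply; lra.
have a3 : (p - 1)^-1 <= 4 by rewrite invf_ple ?posrE; lra.
apply: (@le_trans _ _ (4 * 1)); last by lra.
by rewrite ler_pM ?powR_ge0 // invr_ge0; lra.
Qed.

Implicit Types (p u b : R) (q : R -> R).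

Definition primitive_cst p : R := p * ((p + 1) * ((p + 2) * 2 `^ (p + 3))).

Definition potential_cst p : R := p + 5 * (p * (p + 1)) + 162 * primitive_cst p.

Lemma primitive_cst_ge0 p : 0 <= p -> 0 <= primitive_cst p.
Proof.
move=> p0; have := powR_ge0 2 (p + 3) => c.
by rewrite /primitive_cst; do !apply: mulr_ge0 => //; lra.
Qed.

Lemma potential_cst_ge0 p : 0 <= p -> 0 <= potential_cst p.
Proof.
move=> p0; have := primitive_cst_ge0 p0.
have : 0 <= p * (p + 1) by rewrite mulr_ge0 //; lra.
rewrite /potential_cst; lra.
Qed.

Lemma second_difference_primitive p u b q : 0 <= p -> 36 <= u -> b ^+ 2 <= u ->
  (forall x : R, 0 < x -> is_derive x 1 q (- x `^ (- p))) ->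
  `|q (u + (1 + 2 * b)) + q (u + (1 - 2 * b)) - 2 * q u
     - u `^ (1 - p) * (- 2 / u + 4 * p * b ^+ 2 / u ^+ 2)| <= u `^ (1 - p) * (potential_cst p / u ^+ 2).
Proof.
move=> p0 u36 bu dq; have u0 : 0 < u by lra.
set C := primitive_cst p; have C0 : 0 <= C := primitive_cst_ge0 p0.
have [s1 f1] := step_bounds u36 bu.
have bu' : (- b) ^+ 2 <= u by rewrite sqrrN.
have [] := step_bounds u36 bu'; rewrite mulrN => s2 f2.
have t1 := primitive_taylor p0 u0 s1 dq; have t2 := primitive_taylor p0 u0 s2 dq.
have eu c : u * (1 + c / u) = u + c by field; rewrite gt_eqF.
rewrite !eu in t1 t2.
set x := (1 + 2 * b) / u in s1 f1 t1 *; set y := (1 - 2 * b) / u in s2 f2 t2 *.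
set v := u `^ (1 - p) in t1 t2 *; have v0 : 0 <= v := powR_ge0 _ _.
have vC : 0 <= v * C by rewrite mulr_ge0.
have t1' := le_trans t1 (ler_wpM2l vC f1); have t2' := le_trans t2 (ler_wpM2l vC f2).
clear t1 t2.
have e1 : x + y = 2 / u by rewrite /x /y; field; lra.
have e2 : x ^+ 2 + y ^+ 2 = 2 / u ^+ 2 + 8 * b ^+ 2 / u ^+ 2 by rewrite /x /y; field; lra.
have e3 : x ^+ 3 + y ^+ 3 = (2 / u + 24 * b ^+ 2 / u) / u ^+ 2 by rewrite /x /y; field; lra.
have iu : 0 <= (u ^+ 2)^-1 by rewrite invr_ge0 sqr_ge0.
have b20 := sqr_ge0 b.
have e3' : 0 <= x ^+ 3 + y ^+ 3 <= 26 / u ^+ 2.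
  have q1 : 0 <= 2 / u + 24 * b ^+ 2 / u by rewrite -mulrDl divr_ge0 //; lra.
  have q2 : 2 / u + 24 * b ^+ 2 / u <= 26 by rewrite -mulrDl ler_pdivrMr //; lra.
  by rewrite e3 mulr_ge0 //= ler_wpM2r.
have h' : 0 <= v * (p * (p + 1) / 6) by rewrite !mulr_ge0 //; lra.
have k1 : 0 <= v * (p * (p + 1) / 6) * (x ^+ 3 + y ^+ 3) <= v * (p * (p + 1) / 6) * (26 / u ^+ 2).
  case/andP: e3' => a1 a2.
  by rewrite mulr_ge0 // ler_wpM2l.
have k2 : 0 <= v * p / u ^+ 2 by rewrite !mulr_ge0.
have k3 : 0 <= v * (p * (p + 1)) / u ^+ 2 by rewrite !mulr_ge0 //; lra.
have k4 : 0 <= v * C / u ^+ 2 by rewrite mulr_ge0.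
have -> : q (u + (1 + 2 * b)) + q (u + (1 - 2 * b)) - 2 * q u - v * (- 2 / u + 4 * p * b ^+ 2 / u ^+ 2)
  = (q (u + (1 + 2 * b)) - q u - v * (- x + p / 2 * x ^+ 2 - p * (p + 1) / 6 * x ^+ 3))
  + (q (u + (1 - 2 * b)) - q u - v * (- y + p / 2 * y ^+ 2 - p * (p + 1) / 6 * y ^+ 3))
  + v * p / u ^+ 2 - v * (p * (p + 1) / 6) * (x ^+ 3 + y ^+ 3).
  have -> : - 2 / u = - (x + y) by rewrite e1; ring.
  have -> : 4 * p * b ^+ 2 / u ^+ 2 = p / 2 * (x ^+ 2 + y ^+ 2) - p / u ^+ 2.
    by rewrite e2; field; lra.
  ring.
have -> : v * (potential_cst p / u ^+ 2) = v * p / u ^+ 2 + 5 * (v * (p * (p + 1)) / u ^+ 2) + 162 * (v * C / u ^+ 2).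
  by rewrite /potential_cst -/C; ring.
have k1' : v * (p * (p + 1) / 6) * (26 / u ^+ 2) = 26/6 * (v * (p * (p + 1)) / u ^+ 2) by field; lra.
rewrite k1' in k1.
have t1'' : v * C * (81 / u ^+ 2) = 81 * (v * C / u ^+ 2) by ring.
rewrite -/(primitive_cst p) -/C t1'' in t1'; rewrite -/(primitive_cst p) -/C t1'' in t2'.
clear e1 e2 e3 e3' h' iu b20 bu bu' s1 s2 f1 f2.
move: t1' t2'; rewrite !ler_norml; lra.
Qed.

End Potential.

(** * Asymptotics of the dipole gradient *)

Section Lipschitz.
Variables (R : realType) (d : nat).
Implicit Types (n m x y z : 'rV[int]_d) (w g : 'rV[int]_d -> R).

Lemma absz_pred (a : int) : 0 <= a -> a != 0 -> absz a = (absz (a - 1)%R).+1.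
Proof. lia. Qed.

Lemma absz_succ (a : int) : a < 0 -> absz a = (absz (a + 1)%R).+1.
Proof. lia. Qed.

Definition norm1 z : nat := (\sum_i absz (z 0%R i))%N.

Lemma norm1_le z : (norm1 z <= d * nsup z)%N.
Proof.
rewrite /norm1 -[X in (_ <= X * _)%N]card_ord -sum_nat_const.
by apply: leq_sum => i _; exact: leq_nsup.
Qed.

(** Induction on the l^1 length of [z]: each step moves one coordinate towards zero, so the path
    from x + z to x never leaves the box of radius [m]. *)
Lemma lipschitz_box w x z (B : R) (m : nat) : 0 <= B ->
  (forall y i, (nsup (y - x)%R <= m)%N -> `|w (y + basis_vec i) - w y| <= B) ->
  (nsup z <= m)%N -> `|w (x + z) - w x| <= (norm1 z)%:R * B.
Proof.
move=> B0 wB; have [s] := ubnP (norm1 z); elim: s z => // s IH z zs zm.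
have [->|z0] := eqVneq z 0; first by rewrite addr0 subrr normr0 mulr_ge0.
have [i zi] : exists i, z 0 i != 0.
  apply/existsP; apply: contraT => /existsPn H; case/eqP: z0.
  by apply/rowP => i; rewrite mxE; apply/eqP; have := H i; rewrite negbK.
have step z' : (norm1 z = (norm1 z').+1)%N -> (nsup z' <= m)%N ->
   `|w (x + z) - w (x + z')| <= B -> `|w (x + z) - w x| <= (norm1 z)%:R * B.
  move=> e z'm h; have := IH z' _ z'm; rewrite -ltnS -e => /(_ zs) h2.
  have -> : w (x + z) - w x = (w (x + z) - w (x + z')) + (w (x + z') - w x) by ring.
  by apply: le_trans (ler_normD _ _) _; rewrite e -natr1 mulrDl mul1r addrC lerD.
have split1 (a : 'rV[int]_d) : norm1 a = (absz (a 0%R i) + \sum_(j | j != i) absz (a 0%R j))%N.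
  by rewrite /norm1 (bigD1 i).
have mono (a b : 'rV[int]_d) : (forall j, (absz (a 0%R j) <= absz (b 0%R j))%N) -> (nsup a <= nsup b)%N.
  by move=> H; apply/nsup_leP => j; rewrite (leq_trans (H j)) // leq_nsup.
have [zp|zn] := leP 0 (z 0 i).
  have ej j : (z - basis_vec i) 0 j = z 0 j - (j == i)%:Z by rewrite entryB entry_basis.
  apply: (step (z - basis_vec i)).
  - have es : (\sum_(j | j != i) absz ((z - basis_vec i)%R 0%R j) = \sum_(j | j != i) absz (z 0%R j))%N.
      by apply: eq_bigr => j /negPf ji; rewrite ej ji subr0.
    by rewrite !split1 es ej eqxx (absz_pred zp zi) addSn.
  - apply: leq_trans zm; apply: mono => j; rewrite ej; case: eqP => [->|_] /=; last by rewrite subr0.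
    by rewrite (absz_pred zp zi).
  - have -> : x + z = x + (z - basis_vec i) + basis_vec i by rewrite -addrA subrK.
    apply: wB; rewrite addrAC subrr add0r.
    apply: leq_trans zm; apply: mono => j; rewrite ej; case: eqP => [->|_] /=; last by rewrite subr0.
    by rewrite (absz_pred zp zi).
have ej j : (z + basis_vec i) 0 j = z 0 j + (j == i)%:Z by rewrite entryD entry_basis.
apply: (step (z + basis_vec i)).
- have es : (\sum_(j | j != i) absz ((z + basis_vec i)%R 0%R j) = \sum_(j | j != i) absz (z 0%R j))%N.
    by apply: eq_bigr => j /negPf ji; rewrite ej ji addr0.
  by rewrite !split1 es ej eqxx (absz_succ zn) addSn.
- apply: leq_trans zm; apply: mono => j; rewrite ej; case: eqP => [->|_] /=; last by rewrite addr0.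
  by rewrite (absz_succ zn).
- by rewrite addrA distrC; apply: wB; rewrite addrAC subrr add0r.
Qed.

Lemma box_shift_le g x N M : (forall n, 0 <= g n) -> (N + nsup x <= M)%N ->
  \sum_(n <- box d N) g (n + x) <= \sum_(n <- box d M) g n.
Proof.
move=> g0 NM.
rewrite -(big_map (fun n => n + x) predT g).
have us : uniq [seq n + x | n <- box d N] by rewrite map_inj_uniq ?box_uniq //; exact: addIr.
have sub : {subset [seq n + x | n <- box d N] <= box d M}.
  move=> _ /mapP[n + ->]; rewrite !mem_box => nN.
  by apply: leq_trans (nsupD _ _) (leq_trans _ NM); rewrite leq_add2r.
rewrite [leRHS](bigID (fun n => n \in [seq n + x | n <- box d N])) /=.
rewrite -[X in _ <= X + _]big_filter.
rewrite -[X in X <= _]addr0 lerD //; last by apply: sumr_ge0.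
rewrite le_eqVlt; apply/orP; left; apply/eqP; apply: perm_big.
apply: uniq_perm; rewrite ?filter_uniq ?box_uniq // => n.
rewrite mem_filter; have [/sub ->|] := boolP (n \in _); rewrite ?andbT //.
Qed.

End Lipschitz.

Section Gamma.
Variables (R : realType) (d : nat).
Hypothesis d2 : (2 <= d)%N.
Variable q : R -> R.
Let p : R := d%:R / 2.
Hypothesis dq : forall x : R, 0 < x -> is_derive x 1 q (- x `^ (- p)).
Hypothesis bq : forall x : R, 1 <= x -> `|q x| <= 4 * x `^ (1/4).
Implicit Types (n m x y z : 'rV[int]_d).

Let d0 : (0 < d)%N. Proof. exact: leq_trans d2. Qed.

(** Twice this radius is the main term of [rho], up to a common factor, and it exceeds the Taylor
    error [potential_cst]; hence [rho] is positive everywhere. *)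
Definition gamma_radius : R := 36 + potential_cst (d%:R / 2).

Lemma gamma_radius_ge : 36 <= gamma_radius.
Proof. by rewrite /gamma_radius lerDl potential_cst_ge0 // divr_ge0. Qed.

Definition gamma_arg n : R := sq R n + gamma_radius.

Lemma gamma_arg_ge n : gamma_radius <= gamma_arg n.
Proof. by rewrite lerDr sq_ge0. Qed.

Lemma gamma_arg_ge36 n : 36 <= gamma_arg n.
Proof. exact: le_trans gamma_radius_ge (gamma_arg_ge n). Qed.

(* With q' = - u^(-d/2) this is a multiple of a regularized |n|^(2-d) (of - log |n| if d = 2). *)
Definition gamma n : R := q (gamma_arg n).

Lemma sqN n : sq R (- n) = sq R n.
Proof. by apply: eq_bigr => i _; rewrite entryN intrN sqrrN. Qed.

Lemma gammaN n : gamma (- n) = gamma n.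
Proof. by rewrite /gamma /gamma_arg sqN. Qed.

Definition rho n : R := - laplacian gamma n.

Definition rho_cst : R := d%:R * (2 * gamma_radius + potential_cst (d%:R / 2)) * 2 ^+ d.+2.

Lemma jap_le_gamma_arg n : jap R n <= 2 * Num.sqrt (gamma_arg n).
Proof.
have u36 := gamma_arg_ge36 n; have j0 := ltW (jap_gt0 R n).
rewrite -(@ler_pXn2r _ 2) ?nnegrE // ?mulr_ge0 ?sqrtr_ge0 //.
rewrite exprMn sqr_sqrtr; last lra.
have e : (nsup n).+1%:R = (nsup n)%:R + 1 :> R by rewrite natr1.
have := sq_ge R n; have := gamma_radius_ge; rewrite /gamma_arg /jap e.
move: ((nsup n)%:R : R) (ler0n R (nsup n)) => m m0 h1 h2.
have := sqr_ge0 (m - 1); rewrite sqrrB sqrrD; lra.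
Qed.

(** The terms of order 1/u cancel, as |n|^(2-d), or log |n| for d = 2, is harmonic in the continuum.
    The regularisation and the Taylor errors leave u^(1-p)/u^2, which is the power -(d + 2) of the
    square root of [u], two orders better than the borderline of summability. *)
Lemma rho_bounds n : 0 < rho n /\ rho n <= rho_cst * (jap R n)^-1 ^+ d.+2.
Proof.
set u := gamma_arg n; have u36 : 36 <= u := gamma_arg_ge36 n.
have u0 : 0 < u by lra.
have p0 : 0 <= p by rewrite divr_ge0.
pose K := potential_cst p; have K0 : 0 <= K := potential_cst_ge0 p0.
set v := u `^ (1 - p); have v0 : 0 < v by exact: powR_gt0.
have cu i : (n 0 i)%:~R ^+ 2 <= u.
  by apply: le_trans (coord_sq R n i) _; have := gamma_radius_ge; rewrite /u /gamma_arg; lra.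
have term i : `|gamma (n + basis_vec i) + gamma (n - basis_vec i) - 2 * gamma n
   - v * (- 2 / u + 4 * p * (n 0 i)%:~R ^+ 2 / u ^+ 2)| <= v * (K / u ^+ 2).
  have := second_difference_primitive p0 u36 (cu i) dq.
  rewrite /gamma -/u /gamma_arg sq_addb sq_subb.
  have -> : sq R n + 2 * (n 0 i)%:~R + 1 + gamma_radius = u + (1 + 2 * (n 0 i)%:~R) by rewrite /u /gamma_arg; ring.
  by have -> : sq R n - 2 * (n 0 i)%:~R + 1 + gamma_radius = u + (1 - 2 * (n 0 i)%:~R) by rewrite /u /gamma_arg; ring.
have main : \sum_i v * (- 2 / u + 4 * p * (n 0 i)%:~R ^+ 2 / u ^+ 2) = - (v / u ^+ 2 * (d%:R * (2 * gamma_radius))).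
  rewrite -mulr_sumr big_split /= sumr_const card_ord -mulr_suml -mulr_sumr -/(sq R n).
  have -> : sq R n = u - gamma_radius by rewrite /u /gamma_arg; ring.
  rewrite -[(- 2 / u) *+ d]mulr_natr /p; field; exact: lt0r_neq0.
have dev : `|laplacian gamma n + v / u ^+ 2 * (d%:R * (2 * gamma_radius))| <= v / u ^+ 2 * (d%:R * K).
  rewrite laplacianE -[v / u ^+ 2 * (d%:R * (2 * _))]opprK -main -sumrB.
  apply: le_trans (ler_norm_sum _ _ _) _.
  have -> : v / u ^+ 2 * (d%:R * K) = d%:R * (v * (K / u ^+ 2)) by ring.
  exact: sum_ord_le.
have dr : 0 < d%:R :> R by rewrite ltr0n.
have vu : 0 < v / u ^+ 2 by rewrite divr_gt0 // exprn_gt0.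
have r2 : gamma_radius = 36 + K by [].
rewrite /rho; split.
  have g : 0 < 2 * gamma_radius - K by lra.
  have := mulr_gt0 vu (mulr_gt0 dr g).
  move: dev; rewrite ler_norml; lra.
apply: (@le_trans _ _ (v / u ^+ 2 * (d%:R * (2 * gamma_radius + K)))).
  by move: dev; rewrite ler_norml; lra.
rewrite /rho_cst -/p -/K -[leRHS]mulrA [leRHS]mulrC.
have g : 0 <= 2 * gamma_radius + K by lra.
rewrite ler_wpM2r ?(mulr_ge0 (ltW dr) g) //.
rewrite -exprMn.
have -> : v / u ^+ 2 = (Num.sqrt u)^-1 ^+ d.+2.
  have -> : v = u * u `^ (- p).
    by rewrite /v powRD ?(gt_eqF u0) ?implybT // powRr1 // ltW.
  rewrite powR_half_sqrt; last exact: ltW.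
  rewrite -(addn2 d) exprD (exprVn (Num.sqrt u) 2) sqr_sqrtr; last exact: ltW.
  by field; exact: lt0r_neq0.
have su : 0 < Num.sqrt u by rewrite sqrtr_gt0.
have j0 := jap_gt0 R n.
apply: lerXn2r; rewrite ?nnegrE ?invr_ge0 ?sqrtr_ge0 ?divr_ge0 ?(ltW j0) //.
rewrite -[leLHS]mul1r ler_pdivrMr // mulrAC ler_pdivlMr // mul1r.
exact: jap_le_gamma_arg.
Qed.

Lemma rho_cst_ge0 : 0 <= rho_cst.
Proof.
have [h1 h2] := rho_bounds 0; have := ltW (lt_le_trans h1 h2).
by rewrite /jap nsup0 invr1 expr1n mulr1.
Qed.

Lemma rho_tail : exists2 T : R, 0 < T & forall m N : nat,
  \sum_(n <- box d N | (m <= nsup n)%N) rho n <= T / m.+1%:R.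
Proof.
have [C C0 sC] := sum_jap R d.
exists ((rho_cst + 1) * C); first by rewrite mulr_gt0 //; have := rho_cst_ge0; lra.
move=> m N; rewrite -mulrA; apply: le_trans (ler_wpM2l _ (sC m N)); last by have := rho_cst_ge0; lra.
rewrite mulr_sumr; apply: ler_sum => n _.
apply: le_trans (proj2 (rho_bounds n)) _.
have j0 := jap_gt0 R n.
rewrite ler_pM ?rho_cst_ge0 ?exprn_ge0 ?invr_ge0 ?(ltW j0) //; first lra.
rewrite exprS ler_piMl ?exprn_ge0 ?invr_ge0 ?(ltW j0) //.
by rewrite invf_le1 // jap_ge1.
Qed.

(** Here [kappa] is the total mass of [rho], the limit of its nondecreasing box sums; the tail bound
    gives the rate at which they reach it. *)
Lemma rho_mass : exists kappa T : R, [/\ 0 < kappa, 0 < T,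
  forall m N : nat, \sum_(n <- box d N | (m <= nsup n)%N) rho n <= T / m.+1%:R,
  forall N : nat, \sum_(n <- box d N) rho n <= kappa &
  forall N : nat, kappa <= \sum_(n <- box d N) rho n + T / N.+1%:R].
Proof.
have [T T0 tail] := rho_tail.
pose S N := \sum_(n <- box d N) rho n.
have r0 n : 0 <= rho n by case: (rho_bounds n) => /ltW.
have SS N : S N.+1 = S N + \sum_(n <- box d N.+1 | nsup n == N.+1) rho n.
  by rewrite /S (box_split N xpredT).
have ndS : nondecreasing_seq S.
  by apply/nondecreasing_seqP => N; rewrite SS lerDl; apply: sumr_ge0.
have gap N M : S (N + M)%N <= S N + T / N.+1%:R.
  rewrite /S (bigID (fun n => (N.+1 <= nsup n)%N)) /= addrC lerD //.
    rewrite le_eqVlt; apply/orP; left; apply/eqP.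
    rewrite -big_filter; apply: perm_big; apply: uniq_perm; rewrite ?filter_uniq ?box_uniq // => n.
    by rewrite mem_filter !mem_box -leqNgt; case: leqP => //= h; rewrite (leq_trans h) // leq_addr.
  apply: le_trans (tail _ _) _; rewrite ler_wpM2l ?(ltW T0) //.
  by rewrite lef_pV2 ?posrE ?ltr0n // ler_nat.
have ubS : has_ubound (range S).
  by exists (S 0%N + T / 1) => _ [N _ <-]; exact: (gap 0%N N).
have cS := nondecreasing_is_cvgn ndS ubS.
have leS N : S N <= limn S by exact: nondecreasing_cvgn_le.
exists (limn S), T; split=> //.
  apply: lt_le_trans (leS 0%N); rewrite /S (bigD1_seq 0) ?mem_box ?nsup0 ?box_uniq //=.
  apply: (lt_le_trans (proj1 (rho_bounds 0))); rewrite lerDl; exact: sumr_ge0.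
move=> N; apply: limr_le => //; exists N => // M /= NM.
by rewrite -(subnKC NM); exact: gap.
Qed.

Lemma gamma_growth n N : (0 < N)%N -> (nsup n <= N)%N ->
  `|gamma n| <= 4 * (d%:R + gamma_radius) * Num.sqrt N%:R.
Proof.
move=> N0 nN; have u36 := gamma_arg_ge36 n.
have r36 := gamma_radius_ge.
have Nr : 1 <= (N%:R : R) by rewrite ler1n.
apply: le_trans (bq _) _; first lra.
rewrite -mulrA ler_wpM2l //.
set B := d%:R + gamma_radius; have B1 : 1 <= B by rewrite /B; have := ler0n R d; lra.
have uB : gamma_arg n <= B * N%:R ^+ 2.
  have N2 : 1 <= N%:R ^+ 2 :> R by rewrite exprn_ege1.
  have := sq_le R n; rewrite /gamma_arg /B mulrDl => h.
  apply: lerD; last by rewrite ler_peMr //; lra.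
  by apply: le_trans h _; rewrite ler_wpM2l // lerXn2r ?nnegrE ?ler0n // ler_nat.
apply: (@le_trans _ _ ((B * N%:R ^+ 2) `^ (1/4))).
  by apply: ge0_ler_powR; rewrite ?nnegrE ?mulr_ge0 //; lra.
rewrite powRM ?sqr_ge0 //; last lra.
apply: ler_pM; rewrite ?powR_ge0 //.
  by apply: le_trans (ler_powR B1 (_ : 1/4 <= 1)) _; [lra|rewrite powRr1 //; lra].
have -> : N%:R ^+ 2 = N%:R `^ 2 :> R by rewrite powR_mulrn.
by rewrite -powRrM (_ : 2 * (1/4) = 2^-1) ?powR12_sqrt //; field.
Qed.

(** [dipole_representation] for the translate n |-> gamma (n - x): by evenness its increment at the
    origin is gamma (x - e_k) - gamma x. The potential is O(N^(1/2)) on the box, so the error is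
    O(N^(-1/2)). *)
Lemma gamma_increment_limit k (w : 'rV[int]_d -> R) C x (eps : R) : is_dipole k w C -> 0 < eps ->
  exists N0 : nat, forall N, (N0 <= N)%N ->
  `|gamma x - gamma (x - basis_vec k) -
     \sum_(n <- box d (2 * d * N + 1)) rho (n - x) * (w n * cutoff R N n)| <= eps.
Proof.
move=> wC e0.
have C0 := dipole_cst_ge0 wC.
pose r := (2 * d + 1 + nsup x)%N.
pose K := cutoff_cst R d * C * (7 * d%:R) ^+ d * (4 * (d%:R + gamma_radius) * Num.sqrt r%:R).
have K0 : 0 <= K.
  have := cutoff_cst_ge0 R d => h; have := gamma_radius_ge => h2.
  do ![apply: mulr_ge0 => //]; rewrite ?exprn_ge0 ?mulr_ge0 ?sqrtr_ge0 //.
  by rewrite addr_ge0 //; lra.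
have [N0 hN0] : exists N0 : nat, (K / eps) ^+ 2 < N0%:R.
  exists (Num.truncn ((K / eps) ^+ 2)).+1; exact: truncnS_gt.
exists N0.+1 => N NN0.
have N1 : (0 < N)%N by apply: leq_trans NN0.
have Nr : 0 < (N%:R : R) by rewrite ltr0n.
pose u n := gamma (n - x).
have lu n : laplacian u n = - rho (n - x) by rewrite /u laplacian_shift /rho opprK.
have uA n : (nsup n <= 2 * d * N + 1)%N -> `|u n| <= 4 * (d%:R + gamma_radius) * Num.sqrt (r * N)%:R.
  move=> nN; apply: gamma_growth; first by rewrite muln_gt0 N1 andbT /r; lia.
  apply: leq_trans (nsupD _ _) _; rewrite nsupN /r; nia.
have := dipole_representation d0 wC N1 uA.
under eq_bigr do rewrite lu mulNr.
have ue : u (basis_vec k) = gamma (x - basis_vec k) by rewrite /u -gammaN opprB.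
have u0 : u 0 = gamma x by rewrite /u sub0r gammaN.
rewrite sumrN ue u0; set S := \sum_(n <- _) _.
have -> : gamma (x - basis_vec k) - gamma x - - S = - (gamma x - gamma (x - basis_vec k) - S) by ring.
rewrite normrN => h; apply: (@le_trans _ _ (K / Num.sqrt N%:R)).
  apply: le_trans h _.
  rewrite natrM sqrtrM // /K -!mulrA; do 6 (rewrite ler_wpM2l //; try (by rewrite ?exprn_ge0 ?mulr_ge0 // ?cutoff_cst_ge0 // addr_ge0 //; have := gamma_radius_ge; lra)).
  rewrite ler_wpM2l ?sqrtr_ge0 // ler_pdivrMr // ler_pdivlMl ?sqrtr_gt0 //.
  by rewrite -expr2 sqr_sqrtr // ltW.
rewrite ler_pdivrMr ?sqrtr_gt0 // mulrC -ler_pdivrMr //.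
rewrite -(@ler_pXn2r _ 2) ?nnegrE ?sqrtr_ge0 ?divr_ge0 ?(ltW e0) // sqr_sqrtr ?(ltW Nr) //.
by apply: ltW; apply: lt_le_trans hN0 _; rewrite ler_nat ltnW.
Qed.

End Gamma.

Section Asymptotics.
Variables (R : realType) (d : nat).
Hypothesis d2 : (2 <= d)%N.
Variable q : R -> R.
Let p : R := d%:R / 2.
Hypothesis dq : forall x : R, 0 < x -> is_derive x 1 q (- x `^ (- p)).
Hypothesis bq : forall x : R, 1 <= x -> `|q x| <= 4 * x `^ (1/4).
Implicit Types (n m x y z : 'rV[int]_d).

Let d0 : (0 < d)%N. Proof. exact: leq_trans d2. Qed.

Local Notation gamma := (gamma q).
Local Notation rho := (rho q).

Variables (kappa T : R).
Hypothesis T0 : 0 < T.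
Hypothesis tail : forall m N : nat,
  \sum_(n <- box d N | (m <= nsup n)%N) rho n <= T / m.+1%:R.
Hypothesis mass_le : forall N : nat, \sum_(n <- box d N) rho n <= kappa.
Hypothesis mass_ge : forall N : nat, kappa <= \sum_(n <- box d N) rho n + T / N.+1%:R.

Let rho_ge0 n : 0 <= rho n.
Proof. by have [/ltW] := rho_bounds d2 dq n. Qed.

Lemma tail_le (x : 'rV[int]_d) (m N : nat) :
  \sum_(n <- box d N | (m <= nsup (n - x)%R)%N) rho (n - x) <= T / m.+1%:R.
Proof.
rewrite big_mkcond /=.
apply: le_trans (tail m (N + nsup x)); rewrite [leRHS]big_mkcond /=.
apply: (box_shift_le (x := - x) (g := fun z => if (m <= nsup z)%N then rho z else 0)).
  by move=> n; case: ifP.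
by rewrite nsupN.
Qed.

Lemma mass_shift_le x N : \sum_(n <- box d N) rho (n - x) <= kappa.
Proof.
apply: le_trans (mass_le (N + nsup x)).
by apply: (box_shift_le (x := - x)) => //; rewrite nsupN.
Qed.

Lemma mass_shift_ge x (N M : nat) : (N + nsup x <= M)%N ->
  kappa <= \sum_(n <- box d M) rho (n - x) + T / N.+1%:R.
Proof.
move=> NM; apply: le_trans (mass_ge N) _; rewrite lerD2r.
have := @box_shift_le R d (fun n => rho (n - x)) x N M (fun n => rho_ge0 _) NM.
by under eq_bigr do rewrite addrK.
Qed.

Variables (k : 'I_d) (w : 'rV[int]_d -> R) (C : R).
Hypothesis wC : is_dipole k w C.

Let C0 : 0 <= C. Proof. exact: dipole_cst_ge0 wC. Qed.

Let w_le n : `|w n| <= C.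
Proof.
case: wC => _ h _; apply: le_trans (h n) _.
by rewrite ler_piMr // exprn_ile1 // ?invr_ge0 ?invf_le1 ?jap_gt0 ?jap_ge1 // ltW // jap_gt0.
Qed.

Let inv_jap_ge0 n : 0 <= (jap R n)^-1.
Proof. by rewrite invr_ge0 ltW // jap_gt0. Qed.

Let w_half x y : (nsup x <= 2 * nsup y)%N ->
  `|w y| <= C * 2 ^+ d.-1 * (jap R x)^-1 ^+ d.-1.
Proof.
move=> h; case: wC => _ + _ => /(_ y)/le_trans; apply.
by rewrite -mulrA ler_wpM2l // -exprMn lerXn2r ?nnegrE ?mulr_ge0 //; exact: jap_le_nsup_half.
Qed.

(** Three regimes, one for each summand. For |z| <= m the Lipschitz bound applies. For larger z with
    x + z not near the origin, both values of [w] are O(|x|^(-(d-1))) and the tail of [rho] gives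
    smallness. For x + z near the origin, [rho z] is itself O(|x|^(-d-2)), and two of these powers
    are traded to make the decay of [w (x + z)] summable. *)
Lemma far_near_split x z (m : nat) : (4 * m <= nsup x)%N ->
  rho z * `|w (x + z) - w x| <=
    (d * m)%:R * (C * 2 ^+ d * (jap R x)^-1 ^+ d) * rho z
  + (if (m < nsup z)%N then C * 2 ^+ d * (jap R x)^-1 ^+ d.-1 * rho z else 0)
  + rho_cst R d * C * 2 ^+ d.+2 * (jap R x)^-1 ^+ d * (jap R (x + z))^-1 ^+ d.+1.
Proof.
move=> mx.
have rc0 : 0 <= rho_cst R d := rho_cst_ge0 d2 dq.
have a0 : 0 <= (d * m)%:R * (C * 2 ^+ d * (jap R x)^-1 ^+ d).
  by rewrite mulr_ge0 // mulr_ge0 ?exprn_ge0 // mulr_ge0 // exprn_ge0.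
have b0 : 0 <= C * 2 ^+ d * (jap R x)^-1 ^+ d.-1.
  by rewrite mulr_ge0 ?exprn_ge0 // mulr_ge0 // exprn_ge0.
have c0 : 0 <= rho_cst R d * C * 2 ^+ d.+2 * (jap R x)^-1 ^+ d * (jap R (x + z))^-1 ^+ d.+1.
  by do !apply: mulr_ge0 => //; exact: exprn_ge0.
have rz := rho_ge0 z.
have [zm|mz] := leqP (nsup z) m.
  rewrite addr0; apply: le_trans (_ : _ <= (d * m)%:R * (C * 2 ^+ d * (jap R x)^-1 ^+ d) * rho z) _; last by rewrite lerDl.
  rewrite mulrC ler_wpM2r //.
  have B0 : 0 <= C * 2 ^+ d * (jap R x)^-1 ^+ d by rewrite mulr_ge0 ?exprn_ge0 // mulr_ge0 // exprn_ge0.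
  apply: le_trans (lipschitz_box B0 _ zm) _.
    move=> y i ym; case: wC => _ _ /(_ y i)/le_trans; apply.
    rewrite -mulrA ler_wpM2l // -exprMn lerXn2r ?nnegrE ?mulr_ge0 //.
    apply: jap_le_nsup_half; have := nsupD (x - y) y; rewrite subrK -opprB nsupN => h.
    have aux (a b c : nat) : (a <= c + b -> c <= m -> 4 * m <= a -> a <= 2 * b)%N by clear; lia.
    exact: aux h ym mx.
  by rewrite ler_wpM2r // ler_nat (leq_trans (norm1_le z)) // leq_mul2l zm orbT.
have w2d : `|w x| <= C * 2 ^+ d.-1 * (jap R x)^-1 ^+ d.-1.
  by apply: w_half; rewrite leq_pmull.
have e2 : C * 2 ^+ d * (jap R x)^-1 ^+ d.-1 = C * 2 ^+ d.-1 * (jap R x)^-1 ^+ d.-1 + C * 2 ^+ d.-1 * (jap R x)^-1 ^+ d.-1.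
  have -> : 2 ^+ d = 2 * 2 ^+ d.-1 :> R by rewrite -exprS prednK.
  ring.
have p1 := mulr_ge0 a0 rz.
have [h|h] := leqP (nsup x) (2 * nsup (x + z)%R).
  suff : rho z * `|w (x + z) - w x| <= C * 2 ^+ d * (jap R x)^-1 ^+ d.-1 * rho z by lra.
  rewrite mulrC ler_wpM2r // e2; apply: le_trans (ler_normB _ _) _.
  by rewrite lerD // w_half.
have rz2 : rho z <= rho_cst R d * 2 ^+ d.+2 * (jap R x)^-1 ^+ d.+2.
  apply: le_trans (proj2 (rho_bounds d2 dq z)) _.
  rewrite -mulrA ler_wpM2l // -exprMn lerXn2r ?nnegrE ?mulr_ge0 //.
  apply: jap_le_nsup_half.
  have := nsupD (x + z) (- z); rewrite addrK nsupN => h2; move: h h2; clear; lia.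
apply: (@le_trans _ _ (rho z * `|w x| + rho z * `|w (x + z)|)).
  by rewrite -mulrDr ler_wpM2l // [leRHS]addrC ler_normB.
have q1 : rho z * `|w x| <= C * 2 ^+ d * (jap R x)^-1 ^+ d.-1 * rho z.
  rewrite mulrC ler_wpM2r //; apply: le_trans w2d _.
  by rewrite e2 lerDl mulr_ge0 ?exprn_ge0 // mulr_ge0 // exprn_ge0.
suff q2 : rho z * `|w (x + z)| <= rho_cst R d * C * 2 ^+ d.+2 * (jap R x)^-1 ^+ d * (jap R (x + z))^-1 ^+ d.+1 by lra.
have w3 : `|w (x + z)| <= C * (jap R x ^+ 2 * (jap R (x + z))^-1 ^+ d.+1).
  case: wC => _ /(_ (x + z)) + _ => /le_trans; apply; rewrite ler_wpM2l //.
  have -> : (jap R (x + z))^-1 ^+ d.-1 = jap R (x + z) ^+ 2 * (jap R (x + z))^-1 ^+ d.+1.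
    have -> : d.+1 = (2 + d.-1)%N by rewrite add2n prednK.
    by rewrite exprD mulrA -exprMn divff ?expr1n ?mul1r // jap_neq0.
  rewrite ler_wpM2r ?exprn_ge0 // lerXn2r ?nnegrE ?(ltW (jap_gt0 _ _)) //.
  by rewrite /jap ler_nat; move: h; clear; lia.
apply: le_trans (ler_pM _ _ rz2 w3) _ => //.
have -> : (jap R x)^-1 ^+ d = (jap R x)^-1 ^+ d.+2 * jap R x ^+ 2.
  by rewrite -(addn2 d) exprD exprVn -mulrA exprVn mulVf ?mulr1 // expf_neq0 // jap_neq0.
by rewrite le_eqVlt; apply/orP; left; apply/eqP; ring.
Qed.

(* The convolution of rho with w is kappa * w up to lower order, because the increments of
   w decay faster than w. *)
Lemma dipole_asymptotics (eps : R) : 0 < eps -> exists r0 : nat, forall x, (r0 <= nsup x)%N ->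
  `|gamma x - gamma (x - basis_vec k) - kappa * w x| <= eps * (jap R x)^-1 ^+ d.-1.
Proof.
move=> e0.
have [Cs Cs0 sCs] := sum_jap R d.
have rc0 : 0 <= rho_cst R d := rho_cst_ge0 d2 dq.
have kap0 : 0 <= kappa by apply: le_trans (mass_le 0%N); exact: sumr_ge0.
pose K2 := C * 2 ^+ d * T.
have K20 : 0 <= K2 by rewrite mulr_ge0 ?(ltW T0) // mulr_ge0 // exprn_ge0.
(* Order of choice: [m] makes the tail of [rho] small; then [r1] makes the contribution of |z| <= m,
   which is smaller by a factor 1/|x| but grows with [m], negligible. *)
have [m hm] : exists m : nat, 2 * K2 / eps < m%:R.
  exists (Num.truncn (2 * K2 / eps)).+1; exact: truncnS_gt.
pose K1 := (d * m)%:R * (C * 2 ^+ d) * kappa + rho_cst R d * C * 2 ^+ d.+2 * Cs.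
have K10 : 0 <= K1.
  by apply: addr_ge0; do !apply: mulr_ge0 => //; rewrite ?exprn_ge0 // ltW.
have [r1 hr1] : exists r1 : nat, 2 * K1 / eps < r1%:R.
  exists (Num.truncn (2 * K1 / eps)).+1; exact: truncnS_gt.
exists (4 * m + r1)%N => x xr.
have j0 := jap_gt0 R x.
have mx : (4 * m <= nsup x)%N by apply: leq_trans xr; rewrite leq_addr.
pose bnd := K1 * (jap R x)^-1 ^+ d + C * 2 ^+ d * (jap R x)^-1 ^+ d.-1 * (T / m.+2%:R).
have sum_bnd M : \sum_(n <- box d M) rho (n - x) * `|w n - w x| <= bnd.
  apply: (@le_trans _ _ (\sum_(n <- box d M) ((d * m)%:R * (C * 2 ^+ d * (jap R x)^-1 ^+ d) * rho (n - x)
    + (if (m < nsup (n - x)%R)%N then C * 2 ^+ d * (jap R x)^-1 ^+ d.-1 * rho (n - x) else 0)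
    + rho_cst R d * C * 2 ^+ d.+2 * (jap R x)^-1 ^+ d * (jap R n)^-1 ^+ d.+1))).
    by apply: ler_sum => n _; have := far_near_split (n - x) mx; rewrite [x + _]addrC subrK.
  rewrite !big_split /= -!mulr_sumr.
  have h1 := mass_shift_le x M.
  have h2 := tail_le x m.+1 M.
  have h3 := sCs 0%N M; rewrite divr1 in h3.
  have a0 : 0 <= (d * m)%:R * (C * 2 ^+ d * (jap R x)^-1 ^+ d).
    by rewrite mulr_ge0 // mulr_ge0 ?exprn_ge0 // mulr_ge0 // exprn_ge0.
  have b0 : 0 <= C * 2 ^+ d * (jap R x)^-1 ^+ d.-1.
    by rewrite mulr_ge0 ?exprn_ge0 // mulr_ge0 // exprn_ge0.
  have c0 : 0 <= rho_cst R d * C * 2 ^+ d.+2 * (jap R x)^-1 ^+ d.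
    by do !apply: mulr_ge0 => //; exact: exprn_ge0.
  have g1 := ler_wpM2l a0 h1; have g2 := ler_wpM2l b0 h2; have g3 := ler_wpM2l c0 h3.
  rewrite -big_mkcond -mulr_sumr.
  have -> : bnd = (d * m)%:R * (C * 2 ^+ d * (jap R x)^-1 ^+ d) * kappa
     + C * 2 ^+ d * (jap R x)^-1 ^+ d.-1 * (T / m.+2%:R)
     + rho_cst R d * C * 2 ^+ d.+2 * (jap R x)^-1 ^+ d * Cs by rewrite /bnd /K1; ring.
  by apply: lerD g3; apply: lerD.
have bnd_le : bnd <= eps * (jap R x)^-1 ^+ d.-1.
  have J0 : 0 <= (jap R x)^-1 ^+ d.-1 by exact: exprn_ge0.
  have a1 : K1 * (jap R x)^-1 <= eps / 2.
    rewrite ler_pdivrMr // mulrC -ler_pdivrMr ?divr_gt0 //.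
    have -> : K1 / (eps / 2) = 2 * K1 / eps by field; exact: lt0r_neq0.
    apply: le_trans (ltW hr1) _; rewrite /jap ler_nat.
    by apply: leq_trans (leqnSn _); apply: leq_trans xr; rewrite leq_addl.
  have a2 : K2 / m.+2%:R <= eps / 2.
    rewrite ler_pdivrMr // mulrC -ler_pdivrMr ?divr_gt0 //.
    have -> : K2 / (eps / 2) = 2 * K2 / eps by field; exact: lt0r_neq0.
    by apply: le_trans (ltW hm) _; rewrite ler_nat; apply: leqW; apply: leqnSn.
  have -> : bnd = (K1 * (jap R x)^-1 + K2 / m.+2%:R) * (jap R x)^-1 ^+ d.-1.
    have jE : (jap R x)^-1 ^+ d = (jap R x)^-1 * (jap R x)^-1 ^+ d.-1 by rewrite -exprS prednK.
    by rewrite /bnd jE /K2; ring.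
  by rewrite ler_wpM2r // (splitr eps) lerD.
(* For fixed [x] the cutoff radius N goes to infinity; [del] absorbs both the representation error
   and the part of the mass of [rho] far from [x]. *)
apply: le_trans bnd_le; apply/ler_addgt0Pr => del del0.
have [N0 hN0] := gamma_increment_limit d2 bq x wC (divr_gt0 del0 (ltr0Sn R 1)).
have [N1 hN1] : exists N1 : nat, 6 * C * T / del < N1%:R.
  exists (Num.truncn (6 * C * T / del)).+1; exact: truncnS_gt.
pose N := (N0 + N1.+1 + nsup x)%N.
have Npos : (0 < N)%N by rewrite /N addnS addSn.
have := hN0 N; have -> : (N0 <= N)%N by rewrite /N -addnA leq_addr.
move=> /(_ isT).
set S := \sum_(n <- _) _ => hS.
set M := (2 * d * N + 1)%N in S hS.
have NM : (N + nsup x <= M)%N by rewrite /M; move: d2; rewrite /N; clear; nia.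
have tl : 3 * C * T / (N - nsup x).+1%:R <= del / 2.
  rewrite ler_pdivrMr // [leRHS]mulrC -ler_pdivrMr ?divr_gt0 //.
  have -> : 3 * C * T / (del / 2) = 6 * C * T / del by field; exact: lt0r_neq0.
  by apply: le_trans (ltW hN1) _; rewrite ler_nat /N addnK; apply: leqW; apply: leq_trans (leqnSn _) _; rewrite leq_addl.
suff : `|S - kappa * w x| <= bnd + 3 * C * T / (N - nsup x).+1%:R.
  move=> h; have := ler_distD S (gamma x - gamma (x - basis_vec k)) (kappa * w x).
  move=> /le_trans; apply; apply: le_trans (lerD hS h) _.
  by rewrite addrCA lerD2l [leRHS]splitr lerD2l.
have -> : S - kappa * w x = \sum_(n <- box d M) rho (n - x) * (w n * cutoff R N n - w x)
     + w x * (\sum_(n <- box d M) rho (n - x) - kappa).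
  rewrite (eq_bigr (fun n => rho (n - x) * (w n * cutoff R N n) - rho (n - x) * w x)); last by move=> n _; rewrite mulrBr.
  by rewrite sumrB -mulr_suml /S; ring.
have t2 : `|w x * (\sum_(n <- box d M) rho (n - x) - kappa)| <= C * (T / (N - nsup x).+1%:R).
  rewrite normrM; apply: ler_pM => //.
  have h1 := mass_shift_le x M.
  have h2 := @mass_shift_ge x (N - nsup x)%N M.
  rewrite ler0_norm ?subr_le0 // opprB lerBlDr addrC; apply: h2.
  by apply: leq_trans NM; rewrite leq_add2r leq_subr.
have t1 : `|\sum_(n <- box d M) rho (n - x) * (w n * cutoff R N n - w x)| <= bnd + 2 * C * (T / (N - nsup x).+1%:R).
  apply: le_trans (ler_norm_sum _ _ _) _.
  apply: (@le_trans _ _ (\sum_(n <- box d M) (rho (n - x) * `|w n - w x| + 2 * C * (if (N - nsup x <= nsup (n - x)%R)%N then rho (n - x) else 0)))).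
    apply: ler_sum => n _; rewrite normrM (ger0_norm (rho_ge0 _)).
    have cc : 0 <= 2 * C by rewrite mulr_ge0.
    have [nN|Nn] := leqP (nsup n) N.
      by rewrite (@cutoff_eq1 R d d0 N n Npos nN) mulr1 lerDl mulr_ge0 //; case: ifP.
    have -> : (N - nsup x <= nsup (n - x)%R)%N.
      by have := nsupD (n - x) x; rewrite subrK => h; move: h Nn; clear; lia.
    rewrite [2 * C * _]mulrC -mulrDr ler_wpM2l //.
    have -> : w n * cutoff R N n - w x = (w n - w x) + w n * (cutoff R N n - 1) by ring.
    apply: le_trans (ler_normD _ _) _; rewrite lerD2l normrM mulrC ler_pM //.
    apply: le_trans (ler_normB _ _) _; rewrite normr1.
    by have := cutoff_norm R N n; lra.
  rewrite big_split /= -mulr_sumr lerD // ler_wpM2l ?mulr_ge0 // -big_mkcond.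
  exact: tail_le.
apply: le_trans (ler_normD _ _) _; apply: le_trans (lerD t1 t2) _.
rewrite -addrA lerD2l le_eqVlt; apply/orP; left; apply/eqP; ring.
Qed.

End Asymptotics.

(** * Mixed second differences of the potential *)

Section MixedDifference.
Variable R : realType.

(** With increments bounded by 3r, 3r and 8r, where r = u^(-1/2): 19 = 4 + 1 + 12 + 2 collects the
    quadratic cross terms, 566 = 8^3 + 2 * 3^3 the cubic terms and 4258 = 8^4 + 2 * 3^4 the Taylor
    remainders. *)
Definition mixed_cst (p : R) : R :=
  19 * p + 566 * (p * (p + 1) / 6) + 4258 * (p * ((p + 1) * ((p + 2) * 2 `^ (p + 3)))).

Let remainder_le (p c r al be de s t sg : R) : 0 <= p -> 0 <= c -> 0 <= r <= 1 ->
  `|al| <= 1 -> `|be| <= 1 -> 0 <= de <= 1 ->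
  `|s| <= 3 * r -> `|t| <= 3 * r -> `|sg| <= 8 * r ->
  `|- p * (2 * al - 2 * be) * r ^+ 3 - p * r ^+ 4 + 2 * p * de * r ^+ 2 * (s + t)
    - 2 * p * de ^+ 2 * r ^+ 4 + c * (sg ^+ 3 - s ^+ 3 - t ^+ 3)|
   <= (19 * p + 566 * c) * r ^+ 3.
Proof.
move=> p0 c0 /andP[r0 r1] a1 b1 /andP[de0 de1] s1 t1 g1.
have r3 : 0 <= r ^+ 3 by rewrite exprn_ge0.
have r43 : r ^+ 4 <= r ^+ 3 by rewrite (exprS r 3) ler_piMl.
have cube (x y : R) : `|x| <= y -> `|x ^+ 3| <= y ^+ 3.
  by move=> h; rewrite normrX lerXn2r // nnegrE // (le_trans _ h).
have h1 : `|- p * (2 * al - 2 * be) * r ^+ 3| <= 4 * p * r ^+ 3.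
  rewrite normrM (ger0_norm r3) ler_wpM2r // normrM normrN (ger0_norm p0) mulrC ler_wpM2r //.
  by move: a1 b1; rewrite !ler_norml; lra.
have h2 : `|- p * r ^+ 4| <= p * r ^+ 3.
  by rewrite normrM normrN (ger0_norm p0) ger0_norm ?exprn_ge0 // ler_wpM2l.
have h3 : `|2 * p * de * r ^+ 2 * (s + t)| <= 12 * p * r ^+ 3.
  have -> : 12 * p * r ^+ 3 = 2 * p * 1 * r ^+ 2 * (6 * r) by ring.
  have r2 : 0 <= r ^+ 2 by rewrite exprn_ge0.
  rewrite normrM ger0_norm; last by rewrite !mulr_ge0.
  apply: ler_pM; rewrite ?normr_ge0 ?mulr_ge0 //.
    by rewrite ler_wpM2r // ler_wpM2l // mulr_ge0.
  by apply: le_trans (ler_normD _ _) _; lra.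
have h4 : `|- (2 * p * de ^+ 2 * r ^+ 4)| <= 2 * p * r ^+ 3.
  rewrite normrN ger0_norm; last by do !apply: mulr_ge0; rewrite ?exprn_ge0.
  apply: ler_pM; rewrite ?exprn_ge0 //; first by do !apply: mulr_ge0; rewrite ?exprn_ge0.
  by rewrite ler_piMr ?mulr_ge0 // exprn_ile1.
have h5 : `|c * (sg ^+ 3 - s ^+ 3 - t ^+ 3)| <= 566 * c * r ^+ 3.
  have -> : 566 * c * r ^+ 3 = c * ((8 * r) ^+ 3 + (3 * r) ^+ 3 + (3 * r) ^+ 3) by ring.
  rewrite normrM (ger0_norm c0) ler_wpM2l //.
  apply: le_trans (ler_normB _ _) _; rewrite lerD ?cube //.
  by apply: le_trans (ler_normB _ _) _; rewrite lerD ?cube.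
have -> : (19 * p + 566 * c) * r ^+ 3 =
  4 * p * r ^+ 3 + p * r ^+ 3 + 12 * p * r ^+ 3 + 2 * p * r ^+ 3 + 566 * c * r ^+ 3 by ring.
do 4 (apply: le_trans (ler_normD _ _) _; apply: lerD => //).
by rewrite -mulNr.
Qed.

(** The four arguments are the shifted squared norms at n, n + e_i, n - e_k and n + e_i - e_k, with
    a = n_i, b = n_k and [de] the Kronecker symbol. After scaling by [u] the linear Taylor terms
    leave -2 [de] and the quadratic ones the product 4 p a b / u. *)
Lemma mixed_difference (p u a b de : R) (q : R -> R) : 0 <= p -> 256 <= u ->
  (forall x : R, 0 < x -> is_derive x 1 q (- x `^ (- p))) ->
  a ^+ 2 <= u -> b ^+ 2 <= u -> 0 <= de <= 1 ->
  `|q (u + 2 * a + 1) - q (u + 2 * a + 1 - 2 * b + 1 - 2 * de) - (q u - q (u - 2 * b + 1))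
    - u `^ (- p) * (- 2 * de + 4 * p * (a * b / u))| <= mixed_cst p * u `^ (- p) / Num.sqrt u.
Proof.
move=> p0 u256 dq au bu deI.
have u0 : 0 < u by apply: lt_le_trans u256; rewrite ltr0n.
set x := Num.sqrt u; have xx : x ^+ 2 = u by rewrite sqr_sqrtr // ltW.
have x16 : 16 <= x by rewrite -(@ler_pXn2r _ 2) ?nnegrE ?sqrtr_ge0 // xx; lra.
have x0 : 0 < x by lra.
have xn : x != 0 by rewrite lt0r_neq0.
set r := x^-1; have r0 : 0 < r by rewrite invr_gt0.
(* This is where 256 comes from: the largest increment 8r must stay below 1/2. *)
have r16 : r <= 1 / 16 by rewrite div1r lef_pV2 ?posrE.
pose al := a / x; pose be := b / x.
have sm y : y ^+ 2 <= u -> `|y / x| <= 1.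
  move=> yu; rewrite normrM normfV (gtr0_norm x0) ler_pdivrMr // mul1r.
  by rewrite -(@ler_pXn2r _ 2) ?nnegrE ?(ltW x0) // xx real_normK ?num_real.
have a1 : `|al| <= 1 := sm _ au. have b1 : `|be| <= 1 := sm _ bu.
pose s := 2 * al * r + r ^+ 2; pose t := - 2 * be * r + r ^+ 2.
pose sg := s + t - 2 * de * r ^+ 2.
have ur : u * r ^+ 2 = 1 by rewrite -xx -exprMn divff // expr1n.
have r2r : r ^+ 2 <= r by rewrite expr2 ler_piMl // ltW //; lra.
have r2p : 0 <= r ^+ 2 by rewrite exprn_ge0 // ltW.
have sB : `|s| <= 3 * r.
  apply: le_trans (ler_normD _ _) _; rewrite (ger0_norm r2p) normrM (gtr0_norm r0).
  have : `|2 * al| * r <= 2 * r by rewrite ler_wpM2r ?(ltW r0) // normrM (ger0_norm (ler0n _ 2)); lra.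
  by clear -r2r; lra.
have tB : `|t| <= 3 * r.
  apply: le_trans (ler_normD _ _) _; rewrite (ger0_norm r2p) normrM (gtr0_norm r0).
  have : `|- 2 * be| * r <= 2 * r by rewrite ler_wpM2r ?(ltW r0) // normrM normrN (ger0_norm (ler0n _ 2)); lra.
  by clear -r2r; lra.
have gB : `|sg| <= 8 * r.
  have h : `|2 * de * r ^+ 2| <= 2 * r.
    case/andP: deI => de0 de1; rewrite ger0_norm; last by do !apply: mulr_ge0 => //; exact: ltW.
    by apply: ler_pM => //; rewrite ?mulr_ge0 ?(ltW r0) //; lra.
  apply: le_trans (ler_normB _ _) _; have := ler_normD s t; move: h sB tB; clear; lra.
set V := u `^ (1 - p).
have V0 : 0 <= V by exact: powR_ge0.
have up : u `^ (- p) = V * r ^+ 2.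
  rewrite /V powRD ?(lt0r_neq0 u0) ?implybT // powRr1 ?(ltW u0) //.
  by rewrite mulrAC ur mul1r.
set M := p * ((p + 1) * ((p + 2) * 2 `^ (p + 3))).
have M0 : 0 <= M by rewrite /M; do !apply: mulr_ge0; rewrite ?powR_ge0 //; lra.
have T y B : `|y| <= B * r -> 0 <= B <= 8 ->
   `|q (u * (1 + y)) - q u - V * (- y + p / 2 * y ^+ 2 - p * (p + 1) / 6 * y ^+ 3)| <= V * M * B ^+ 4 * r ^+ 3.
  move=> yB /andP[B0 B8].
  apply: le_trans (primitive_taylor p0 u0 _ dq) _.
    by apply: le_trans yB _; apply: le_trans (ler_wpM2r (ltW r0) B8) _; move: r16; clear; lra.
  rewrite -/V -/M -[leRHS]mulrA ler_wpM2l ?(mulr_ge0 V0 M0) //.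
  apply: le_trans (_ : _ <= (B * r) ^+ 4) _.
    by rewrite lerXn2r ?nnegrE ?mulr_ge0 // ltW.
  rewrite exprMn ler_wpM2l ?exprn_ge0 // (exprS r 3) ler_piMl ?exprn_ge0 ?(ltW r0) //.
  by move: r16; clear; lra.
have e1 : u * (1 + s) = u + 2 * a + 1.
  rewrite /s mulrDr mulr1 mulrDr ur /al.
  have -> : u * (2 * (a / x) * r) = 2 * a * (u * r ^+ 2) by rewrite /r; ring.
  by rewrite ur mulr1 addrA.
have e2 : u * (1 + t) = u - 2 * b + 1.
  rewrite /t mulrDr mulr1 mulrDr ur /be.
  have -> : u * (- 2 * (b / x) * r) = - (2 * b * (u * r ^+ 2)) by rewrite /r; ring.
  by rewrite ur mulr1 addrA.
have e3 : u * (1 + sg) = u + 2 * a + 1 - 2 * b + 1 - 2 * de.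
  have -> : u * (1 + sg) = u * (1 + s) + u * (1 + t) - u - 2 * de * (u * r ^+ 2) by rewrite /sg; ring.
  by rewrite e1 e2 ur; ring.
have := T s 3 sB; have := T t 3 tB; have := T sg 8 gB; rewrite e1 e2 e3.
set Q1 := q (u + 2 * a + 1); set Q2 := q (_ - 2 * de); set Q3 := q (u - 2 * b + 1).
set c := p * (p + 1) / 6.
have c0 : 0 <= c by rewrite /c divr_ge0 // mulr_ge0 //; lra.
have i3 : 0 <= (3 : R) <= 8 by lra.
have i8 : 0 <= (8 : R) <= 8 by lra.
move=> /(_ i8) + /(_ i3) + /(_ i3).
set F := fun y => V * (- y + p / 2 * y ^+ 2 - c * y ^+ 3).
rewrite -/(F s) -/(F t) -/(F sg) => hg ht hs.
have rI : 0 <= r <= 1 by rewrite (ltW r0) /=; move: r16; clear; lra.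
have := remainder_le p0 c0 rI a1 b1 deI sB tB gB.
set Rem := (X in `|X| <= _) => hR.
have abu : a * b / u = al * be by rewrite /al /be -xx; field.
rewrite abu up.
have -> : Q1 - Q2 - (q u - Q3) - V * r ^+ 2 * (- 2 * de + 4 * p * (al * be)) =
  (Q1 - q u - F s) - (Q2 - q u - F sg) + (Q3 - q u - F t) + V * Rem.
  by rewrite /F /Rem /sg /s /t; field.
apply: (@le_trans _ _ (V * M * 3 ^+ 4 * r ^+ 3 + V * M * 8 ^+ 4 * r ^+ 3 + V * M * 3 ^+ 4 * r ^+ 3
   + V * ((19 * p + 566 * c) * r ^+ 3))).
  apply: le_trans (ler_normD _ _) _; apply: lerD; last by rewrite normrM (ger0_norm V0) ler_wpM2l.
  apply: le_trans (ler_normD _ _) _; apply: lerD => //.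
  by apply: le_trans (ler_normB _ _) _; apply: lerD.
rewrite le_eqVlt; apply/orP; left; apply/eqP; rewrite /mixed_cst -/M -/c -/r; ring.
Qed.

End MixedDifference.

Section FiniteSums.
Variable R : realType.

Lemma cauchy_schwarz (I : Type) (s : seq I) (a b : I -> R) :
  (\sum_(i <- s) a i * b i) ^+ 2 <= (\sum_(i <- s) a i ^+ 2) * (\sum_(i <- s) b i ^+ 2).
Proof.
have : 0 <= \sum_(i <- s) \sum_(j <- s) (a i * b j - a j * b i) ^+ 2.
  by apply: sumr_ge0 => i _; apply: sumr_ge0 => j _; exact: sqr_ge0.
rewrite (eq_bigr (fun i => a i ^+ 2 * (\sum_(j <- s) b j ^+ 2) + b i ^+ 2 * (\sum_(j <- s) a j ^+ 2)
   - 2 * (a i * b i) * (\sum_(j <- s) a j * b j))); last first.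
  move=> i _; rewrite !mulr_sumr -big_split -sumrB /=; apply: eq_bigr => j _; ring.
rewrite sumrB big_split /= -!mulr_suml -mulr_sumr; set A := \sum_(i <- s) a i ^+ 2.
by set B := \sum_(i <- s) b i ^+ 2; set C := \sum_(i <- s) _; rewrite expr2; lra.
Qed.

Lemma sqrD_ge (x y : R) : x ^+ 2 / 2 - y ^+ 2 <= (x + y) ^+ 2.
Proof. by have := sqr_ge0 (x + 2 * y); rewrite !sqrrD exprMn -mulr_natl; lra. Qed.

Lemma sqrD_le (x y : R) : (x + y) ^+ 2 <= 2 * x ^+ 2 + 2 * y ^+ 2.
Proof. by have := sqr_ge0 (x - y); rewrite !sqrrD sqrrN -mulr_natl; lra. Qed.

(** The matrix is -2 I + 2d x x^T / u. It has eigenvalue -2 across [x] and, without regularisation,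
    2(d - 1) >= 2 along [x], so it would expand squared lengths by at least 4; the condition on
    [rad] keeps half of that. *)
Lemma hessian_lower_bound (d : nat) (x xi : 'I_d -> R) (u rad : R) : (2 <= d)%N -> 0 <= rad ->
  u = \sum_i x i ^+ 2 + rad -> 0 < u -> 4 * d%:R * rad <= u ->
  2 * \sum_i xi i ^+ 2 <= \sum_k (\sum_i (- 2 * (i == k)%:R + 2 * d%:R * (x i * x k / u)) * xi i) ^+ 2.
Proof.
move=> d2 r0 uE u0 ur.
set m := \sum_i x i * xi i; set X := \sum_i xi i ^+ 2; set s := \sum_i x i ^+ 2.
have rowE k : \sum_i (- 2 * (i == k)%:R + 2 * d%:R * (x i * x k / u)) * xi i
    = - 2 * xi k + 2 * d%:R * (x k * m / u).
  under eq_bigr do rewrite mulrDl.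
  rewrite big_split /=; congr (_ + _).
    rewrite (bigD1 k) //= eqxx mulr1 big1 ?addr0 // => i /negPf ->.
    by rewrite mulr0 mul0r.
  rewrite /m mulr_sumr mulr_suml mulr_sumr; apply: eq_bigr => i _; ring.
have -> : \sum_k (\sum_i (- 2 * (i == k)%:R + 2 * d%:R * (x i * x k / u)) * xi i) ^+ 2
    = 4 * X - 8 * d%:R * (m ^+ 2 / u) + 4 * d%:R ^+ 2 * (m ^+ 2 / u) * (s / u).
  transitivity (\sum_k (4 * xi k ^+ 2 - 8 * d%:R * (m / u) * (x k * xi k)
     + 4 * d%:R ^+ 2 * (m ^+ 2 / u) / u * x k ^+ 2)).
    by apply: eq_bigr => k _; rewrite rowE; field; exact: lt0r_neq0.
  by rewrite big_split sumrB /= -!mulr_sumr -/m -/X -/s; field; exact: lt0r_neq0.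
have X0 : 0 <= X by apply: sumr_ge0 => i _; exact: sqr_ge0.
have mX : m ^+ 2 <= s * X := cauchy_schwarz (index_enum 'I_d) x xi.
have s0 : 0 <= s by apply: sumr_ge0 => i _; exact: sqr_ge0.
have su : s <= u by rewrite uE lerDl.
set a := m ^+ 2 / u.
have a0 : 0 <= a by rewrite divr_ge0 ?sqr_ge0 // ltW.
have aX : a <= X by rewrite ler_pdivrMr // mulrC; apply: le_trans mX _; rewrite ler_wpM2r.
have dr : 2 <= (d%:R : R) by rewrite ler_nat.
set z := rad / u.
have sz : s / u = 1 - z by rewrite /z uE -/s; field; rewrite -uE lt0r_neq0.
have z4 : 4 * d%:R * z <= 1 by rewrite /z mulrA ler_pdivrMr // mul1r.
rewrite sz.
have h1 : 4 * d%:R * a * z <= a by rewrite mulrAC ler_piMl.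
have z0 : 0 <= z by rewrite divr_ge0 // ltW.
have z1 : 0 <= 1 - z by rewrite -sz divr_ge0 // ltW.
have h2 : 0 <= a * (d%:R * (d%:R - 2) * (1 - z)).
  by rewrite mulr_ge0 // mulr_ge0 // mulr_ge0 // subr_ge0.
have -> : 4 * X - 8 * d%:R * a + 4 * d%:R ^+ 2 * a * (1 - z) =
   4 * X - 2 * (4 * d%:R * a * z) + 4 * (a * (d%:R * (d%:R - 2) * (1 - z))) by ring.
by move: aX h1 h2; clear; lra.
Qed.

End FiniteSums.

(** * Nondegeneracy of the family of dipole gradients *)

Section Nondegeneracy.
Variables (R : realType) (d : nat).
Hypothesis d2 : (2 <= d)%N.
Let p : R := d%:R / 2.
Variables (w : 'I_d -> 'rV[int]_d -> R) (C : R).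
Hypothesis wC : forall k, is_dipole k (w k) C.
Implicit Types (n m x y z : 'rV[int]_d).

Let d0 : (0 < d)%N. Proof. exact: leq_trans d2. Qed.
Let B : R := d%:R + gamma_radius R d.
Local Notation rt n := (Num.sqrt (gamma_arg R n)).

Let rad36 : 36 <= gamma_radius R d. Proof. exact: gamma_radius_ge. Qed.

Let B1 : 1 <= B.
Proof. by rewrite /B -[leLHS]add0r lerD // (le_trans _ rad36) // ler1n. Qed.

Let B0 : 0 < B. Proof. exact: lt_le_trans B1. Qed.

Lemma sqrt_gamma_arg_le n : rt n <= B * jap R n.
Proof.
have j1 := jap_ge1 R n.
have J0 : 0 <= B * jap R n by rewrite mulr_ge0 // ltW // jap_gt0.
rewrite -(@ler_pXn2r _ 2) ?nnegrE ?sqrtr_ge0 // sqr_sqrtr; last by have := gamma_arg_ge36 R n; lra.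
rewrite exprMn; apply: (@le_trans _ _ (B * jap R n ^+ 2)).
  have j2 : 1 <= jap R n ^+ 2 by rewrite exprn_ege1.
  rewrite /B mulrDl /gamma_arg; apply: lerD; last by rewrite ler_peMr // (le_trans _ rad36).
  apply: le_trans (sq_le R n) _; rewrite ler_wpM2l // lerXn2r ?nnegrE ?(ltW (jap_gt0 R n)) //.
  by rewrite /jap ler_nat.
by rewrite ler_wpM2r ?sqr_ge0 // expr2 ler_peMl // ltW.
Qed.

Lemma inv_sqrt_gamma_arg_ge n : (B * jap R n)^-1 ^+ d <= (rt n)^-1 ^+ d.
Proof.
have r0 : 0 < rt n by rewrite sqrtr_gt0; have := gamma_arg_ge36 R n; lra.
have h := sqrt_gamma_arg_le n.
rewrite lerXn2r ?nnegrE ?invr_ge0 ?(ltW r0) //; first exact: le_trans (ltW r0) h.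
by rewrite lef_pV2 ?posrE // (lt_le_trans r0).
Qed.

(** The error e of the pointwise asymptotics is o(|n|^(-(d-1))), and its Laplacian is O(|n|^(-d-2))
    away from the source because [w k] is harmonic there. [gradient_decay] then makes the gradient
    of e o(|n|^(-d)), and the gradient of the potential increment is the mixed difference computed
    above. *)
Lemma dipole_gradient_asymptotics : exists2 kappa : R, 0 < kappa & forall eta : R, 0 < eta ->
  exists r0 : nat, forall n i k, (r0 <= nsup n)%N ->
  `|kappa * (w k (n + basis_vec i) - w k n) -
     (rt n)^-1 ^+ d * (- 2 * (i == k)%:R + 2 * d%:R * ((n 0 i)%:~R * (n 0 k)%:~R / gamma_arg R n))|
  <= eta * (rt n)^-1 ^+ d.
Proof.
have [q [dq bq]] := potential_profile R d2.
have [kappa [T [k0 T0 tail mle mge]]] := rho_mass d2 dq.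
exists kappa => // eta eta0.
have rc0 : 0 <= rho_cst R d := rho_cst_ge0 d2 dq.
(* The divisor undoes the losses of [gradient_decay] (16 d), of halving the distance (2^(d-1)) and
   of passing from [jap] to the Euclidean norm (B^d), leaving eta/4. *)
pose eps := eta / (4 * 16 * d%:R * 2 ^+ d.-1 * B ^+ d).
have dr : 0 < (d%:R : R) by rewrite ltr0n.
have e0 : 0 < eps by rewrite divr_gt0 // ?mulr_gt0 ?exprn_gt0.
have asy k := dipole_asymptotics d2 dq bq T0 tail mle mge (wC k) e0.
have [r1 hr1] := choice asy.
pose K := rho_cst R d * (1 + 2 ^+ d.+2) * 2 ^+ d.+2 + 1.
have K0 : 0 < K.
  have p2 : 0 <= 2 ^+ d.+2 :> R by exact: exprn_ge0.
  by rewrite ltr_wpDl // mulr_ge0 // mulr_ge0 // addr_ge0.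
have [r2 hr2] : exists r2 : nat, 2 * K * (4 * B ^+ d) / eta < r2%:R.
  exists (Num.truncn (2 * K * (4 * B ^+ d) / eta)).+1; exact: truncnS_gt.
have [r3 hr3] : exists r3 : nat, mixed_cst p * 4 / eta < r3%:R.
  exists (Num.truncn (mixed_cst p * 4 / eta)).+1; exact: truncnS_gt.
exists (2 * (\sum_k r1 k) + r2 + r3 + 16)%N => n i k rn.
set V := (rt n)^-1 ^+ d.
have [nr1 nr2 nr3 n16] : [/\ (2 * r1 k <= nsup n)%N, (r2 <= nsup n)%N, (r3 <= nsup n)%N & (16 <= nsup n)%N].
  have : (r1 k <= \sum_k r1 k)%N by rewrite (bigD1 k) //= leq_addr.
  by move: rn; move: (\sum_k0 _)%N (r1 k) => a b; clear; split; lia.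
have V0 : 0 <= V by rewrite exprn_ge0 // invr_ge0 sqrtr_ge0.
have j0 := jap_gt0 R n.
have jV : (jap R n)^-1 ^+ d <= B ^+ d * V.
  have := inv_sqrt_gamma_arg_ge n; rewrite invfM exprMn [B^-1 ^+ d]exprVn -/V.
  by rewrite ler_pdivrMl ?exprn_gt0.
pose e m := gamma q m - gamma q (m - basis_vec k) - kappa * w k m.
have grad_e : `|e (n + basis_vec i) - e n| <= eta / 2 * V.
  have Bpos : 0 < K * (jap R n)^-1 ^+ d.+2 by rewrite mulr_gt0 // exprn_gt0 // invr_gt0.
  have := @gradient_decay R d e i n (eps * 2 ^+ d.-1 * (jap R n)^-1 ^+ d.-1) (K * (jap R n)^-1 ^+ d.+2)
     (leq_trans (isT : 4 <= 16)%N n16) Bpos.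
  have e1 (m : 'rV[int]_d) : (nsup n <= 2 * nsup m)%N -> `|e m| <= eps * 2 ^+ d.-1 * (jap R n)^-1 ^+ d.-1.
    move=> nm; have := hr1 k m; rewrite -/(e m) => /(_ _)/le_trans; apply.
      by move: nm nr1; clear; lia.
    rewrite -mulrA ler_wpM2l ?(ltW e0) // -exprMn lerXn2r ?nnegrE ?mulr_ge0 ?invr_ge0 ?(ltW (jap_gt0 R _)) //.
    exact: jap_le_nsup_half.
  have e2 (m : 'rV[int]_d) : (nsup n <= 2 * nsup m)%N -> `|laplacian e m| <= K * (jap R n)^-1 ^+ d.+2.
    move=> nm.
    have m2 : (2 <= nsup m)%N by move: nm n16; clear; lia.
    have lw : laplacian (w k) m = 0.
      case: (wC k) => /(_ m) + _ _; rewrite /delta.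
      have -> : (m == 0) = false by apply: contraTF m2 => /eqP ->; rewrite nsup0.
      have -> : (m == basis_vec k) = false by apply: contraTF m2 => /eqP ->; rewrite nsup_basis.
      by rewrite subrr => /eqP; rewrite oppr_eq0 => /eqP.
    have -> : laplacian e m = - rho q m + rho q (m - basis_vec k).
      rewrite /e laplacianB laplacianB laplacianZ lw mulr0 subr0.
      by rewrite (laplacian_shift (gamma q) (- basis_vec k)) /rho opprK.
    have jm : 0 <= (jap R m)^-1 by rewrite invr_ge0 ltW // jap_gt0.
    have jk : (jap R (m - basis_vec k))^-1 <= 2 * (jap R m)^-1.
      rewrite -[leLHS]div1r ler_pdivrMr ?jap_gt0 // mulrAC ler_pdivlMr ?jap_gt0 // mul1r.
      by apply: jap_step; rewrite nsupN nsup_basis.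
    have [b1 b2] := rho_bounds d2 dq m.
    have [b3 b4] := rho_bounds d2 dq (m - basis_vec k).
    have c1 : rho q m + rho q (m - basis_vec k) <= rho_cst R d * (1 + 2 ^+ d.+2) * (jap R m)^-1 ^+ d.+2.
      rewrite mulrDr mulr1 mulrDl; apply: lerD b2 _; apply: le_trans b4 _.
      by rewrite -mulrA ler_wpM2l // -exprMn lerXn2r ?nnegrE ?mulr_ge0 ?invr_ge0 // ltW // jap_gt0.
    apply: le_trans (ler_normD _ _) _; rewrite normrN (gtr0_norm b1) (gtr0_norm b3).
    apply: le_trans c1 _.
    apply: (@le_trans _ _ (rho_cst R d * (1 + 2 ^+ d.+2) * 2 ^+ d.+2 * (jap R n)^-1 ^+ d.+2)).
      have p2 : 0 <= 2 ^+ d.+2 :> R by exact: exprn_ge0.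
      have cc : 0 <= rho_cst R d * (1 + 2 ^+ d.+2) by rewrite mulr_ge0 // addr_ge0.
      rewrite -[leRHS]mulrA -exprMn; apply: ler_wpM2l cc _ _ _.
      by rewrite lerXn2r ?nnegrE ?mulr_ge0 ?invr_ge0 ?(ltW j0) // jap_le_nsup_half.
    by rewrite ler_wpM2r ?exprn_ge0 ?invr_ge0 ?(ltW j0) // /K lerDl.
  move=> /(_ e1 e2)/le_trans; apply.
  have J0 : 0 <= (jap R n)^-1 by rewrite invr_ge0 ltW.
  have t1 : 16 * d%:R * (eps * 2 ^+ d.-1 * (jap R n)^-1 ^+ d.-1) / jap R n <= eta / 4 * V.
    have -> : 16 * d%:R * (eps * 2 ^+ d.-1 * (jap R n)^-1 ^+ d.-1) / jap R n
       = 16 * d%:R * eps * 2 ^+ d.-1 * (jap R n)^-1 ^+ d.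
      have -> : (jap R n)^-1 ^+ d = (jap R n)^-1 * (jap R n)^-1 ^+ d.-1 by rewrite -exprS prednK.
      ring.
    apply: le_trans (ler_wpM2l _ jV) _.
      by rewrite mulr_ge0 ?exprn_ge0 // mulr_ge0 ?(ltW e0) // mulr_ge0.
    rewrite le_eqVlt; apply/orP; left; apply/eqP; rewrite /eps; field.
    by rewrite !expf_neq0 ?lt0r_neq0.
  have t2 : 2 * (K * (jap R n)^-1 ^+ d.+2) * jap R n <= eta / 4 * V.
    have -> : 2 * (K * (jap R n)^-1 ^+ d.+2) * jap R n = 2 * K * (jap R n)^-1 * (jap R n)^-1 ^+ d.
      by rewrite !exprS; field; rewrite lt0r_neq0.
    apply: le_trans (ler_wpM2l _ jV) _; first by rewrite mulr_ge0 // mulr_ge0 // ltW.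
    rewrite mulrA ler_wpM2r // mulrAC ler_pdivrMr // [leRHS]mulrC -ler_pdivrMr ?divr_gt0 //.
    have -> : 2 * K * B ^+ d / (eta / 4) = 2 * K * (4 * B ^+ d) / eta by field; rewrite lt0r_neq0.
    by apply: le_trans (ltW hr2) _; rewrite /jap ler_nat (leq_trans nr2).
  apply: le_trans (lerD t1 t2) _; rewrite -mulrDl ler_wpM2r //; lra.
have mixed : `|gamma q (n + basis_vec i) - gamma q (n + basis_vec i - basis_vec k) -
   (gamma q n - gamma q (n - basis_vec k)) -
   V * (- 2 * (i == k)%:R + 2 * d%:R * ((n 0 i)%:~R * (n 0 k)%:~R / gamma_arg R n))| <= eta / 2 * V.
  have u36 := gamma_arg_ge36 R n.
  have u256 : 256 <= gamma_arg R n.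
    rewrite /gamma_arg; apply: (@le_trans _ _ (sq R n)); last by rewrite lerDl (le_trans _ rad36).
    apply: le_trans (sq_ge R n); rewrite -natrX ler_nat.
    by apply: leq_trans (_ : 16 ^ 2 <= _)%N => //; rewrite leq_exp2r.
  have cu j : (n 0 j)%:~R ^+ 2 <= gamma_arg R n.
    by apply: le_trans (coord_sq R n j) _; rewrite /gamma_arg lerDl (le_trans _ rad36).
  have deI : 0 <= ((i == k)%:R : R) <= 1 by case: (i == k); rewrite ?lexx ?ler01.
  have p0 : 0 <= p by rewrite divr_ge0.
  have := mixed_difference p0 u256 dq (cu i) (cu k) deI.
  have -> : gamma q (n + basis_vec i) = q (gamma_arg R n + 2 * (n 0 i)%:~R + 1).
    by rewrite /gamma /gamma_arg sq_addb; congr q; ring.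
  have -> : gamma q (n - basis_vec k) = q (gamma_arg R n - 2 * (n 0 k)%:~R + 1).
    by rewrite /gamma /gamma_arg sq_subb; congr q; ring.
  have -> : gamma q (n + basis_vec i - basis_vec k) =
     q (gamma_arg R n + 2 * (n 0 i)%:~R + 1 - 2 * (n 0 k)%:~R + 1 - 2 * (i == k)%:R).
    rewrite /gamma /gamma_arg sq_subb sq_addb entryD entry_basis eq_sym intrD; congr q.
    by case: (k == i) => /=; ring.
  have -> : gamma_arg R n `^ (- p) = V by rewrite powR_half_sqrt // (le_trans _ u36).
  have -> : 4 * p = 2 * d%:R by rewrite /p; field.
  move=> /le_trans; apply.
  rewrite mulrAC ler_wpM2r // ler_pdivrMr ?sqrtr_gt0 ?(lt_le_trans _ u36) //.
  rewrite [leRHS]mulrC -ler_pdivrMr ?divr_gt0 //.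
  have -> : mixed_cst p / (eta / 2) = mixed_cst p * 4 / eta / 2 by field; rewrite lt0r_neq0.
  rewrite ler_pdivrMr // [leRHS]mulrC.
  apply: le_trans (jap_le_gamma_arg R n).
  by apply: le_trans (ltW hr3) _; rewrite /jap ler_nat (leq_trans nr3).
rewrite /e in grad_e.
apply: le_trans (_ : _ <= eta / 2 * V + eta / 2 * V) _; last by rewrite -mulrDl -splitr.
apply: le_trans (lerD mixed grad_e).
rewrite [leRHS]addrC; apply: le_trans (ler_normB _ _); rewrite distrC le_eqVlt; apply/orP; left; apply/eqP.
congr (`| _ |); ring.
Qed.

Lemma dipole_nondegenerate : exists (c : R) (r0 : nat), 0 < c /\
  forall n (xi : 'I_d -> R), (r0 <= nsup n)%N ->
  c * (jap R n)^-1 ^+ (2 * d) * \sum_i xi i ^+ 2 <=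
    \sum_k (\sum_i (w k (n + basis_vec i) - w k n) * xi i) ^+ 2.
Proof.
have [kappa k0 asy] := dipole_gradient_asymptotics.
have dr : 0 < (d%:R : R) by rewrite ltr0n.
(* With entries bounded by 1/(2d), the perturbation matrix costs at most X/4, against the X that
   [sqrD_ge] keeps of the Hessian bound 2X. *)
have eta0 : 0 < (2 * d%:R)^-1 :> R by rewrite invr_gt0 mulr_gt0.
have [r0 hr0] := asy _ eta0.
set eta := (2 * d%:R)^-1 in eta0 hr0.
pose rad := gamma_radius R d.
exists ((2 * kappa ^+ 2)^-1 * B^-1 ^+ (2 * d)), (r0 + (Num.truncn (4 * d%:R * rad)).+1)%N.
split; first by rewrite mulr_gt0 ?exprn_gt0 ?invr_gt0 ?mulr_gt0 ?exprn_gt0.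
move=> n xi nr.
have nr0 : (r0 <= nsup n)%N by apply: leq_trans nr; rewrite leq_addr.
set u := gamma_arg R n; have u36 : 36 <= u := gamma_arg_ge36 R n.
have u0 : 0 < u by apply: lt_le_trans u36.
have rad0 : 0 <= rad by apply: le_trans rad36.
have ur : 4 * d%:R * rad <= u.
  apply: (@le_trans _ _ (nsup n)%:R).
    apply: ltW; apply: lt_le_trans (truncnS_gt _) _; rewrite ler_nat.
    by apply: leq_trans nr; rewrite leq_addl.
  apply: (@le_trans _ _ (sq R n)); last by rewrite lerDl.
  apply: le_trans (sq_ge R n); rewrite -natrX ler_nat.
  by case: (nsup n) => // m; rewrite expnS expn1 leq_pmulr.
have hess := hessian_lower_bound (x := fun i => (n 0 i)%:~R) xi d2 rad0 erefl u0 ur.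
rewrite -/(sq R n) -/(gamma_arg R n) -/u in hess.
set H := fun k i => - 2 * (i == k)%:R + 2 * d%:R * ((n 0 i)%:~R * (n 0 k)%:~R / u) in hess.
set V := (rt n)^-1 ^+ d.
have V0 : 0 < V by rewrite exprn_gt0 // invr_gt0 sqrtr_gt0.
pose E k i := V^-1 * (kappa * (w k (n + basis_vec i) - w k n)) - H k i.
have EB k i : `|E k i| <= eta.
  have -> : E k i = V^-1 * (kappa * (w k (n + basis_vec i) - w k n) - V * H k i).
    by rewrite /E [RHS]mulrBr mulKf // lt0r_neq0.
  rewrite normrM gtr0_norm ?invr_gt0 // ler_pdivrMl // [leRHS]mulrC.
  exact: hr0.
set X := \sum_i xi i ^+ 2 in hess *.
have X0 : 0 <= X by apply: sumr_ge0 => i _; exact: sqr_ge0.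
have small : \sum_k (\sum_i E k i * xi i) ^+ 2 <= X / 4.
  apply: (@le_trans _ _ (\sum_(k < d) (d%:R * eta ^+ 2 * X))).
    apply: ler_sum => k _; apply: le_trans (cauchy_schwarz _ _ _) _; rewrite ler_wpM2r //.
    rewrite -[d in d%:R]card_ord mulr_natl -sumr_const; apply: ler_sum => i _.
    by rewrite -real_normK ?num_real // lerXn2r ?nnegrE // ltW.
  rewrite sumr_const card_ord -mulr_natl /eta le_eqVlt; apply/orP; left; apply/eqP.
  by field; rewrite lt0r_neq0.
have main : V ^+ 2 / (2 * kappa ^+ 2) * X <= \sum_k (\sum_i (w k (n + basis_vec i) - w k n) * xi i) ^+ 2.
  have -> : \sum_k (\sum_i (w k (n + basis_vec i) - w k n) * xi i) ^+ 2 =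
     V ^+ 2 / kappa ^+ 2 * \sum_k (\sum_i H k i * xi i + \sum_i E k i * xi i) ^+ 2.
    rewrite mulr_sumr; apply: eq_bigr => k _.
    rewrite -big_split /= -expr_div_n -exprMn mulr_sumr; congr (_ ^+ 2); apply: eq_bigr => i _.
    by rewrite /E; field; rewrite !lt0r_neq0.
  have -> : V ^+ 2 / (2 * kappa ^+ 2) * X = V ^+ 2 / kappa ^+ 2 * (X / 2).
    by field; rewrite lt0r_neq0.
  rewrite ler_wpM2l ?divr_ge0 ?sqr_ge0 //.
  apply: (@le_trans _ _ (\sum_k ((\sum_i H k i * xi i) ^+ 2 / 2 - (\sum_i E k i * xi i) ^+ 2))).
    rewrite sumrB -mulr_suml; move: hess small X0; rewrite /H; clear; lra.
  by apply: ler_sum => k _; exact: sqrD_ge.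
apply: le_trans main; rewrite ler_wpM2r //.
rewrite mulrAC -mulrA -[leRHS]mulrC ler_wpM2l //; first by rewrite invr_ge0 mulr_ge0 ?sqr_ge0.
rewrite -exprMn mulrC -invfM mulnC exprM lerXn2r ?nnegrE ?(ltW V0) ?exprn_ge0 ?invr_ge0 ?mulr_ge0 ?(ltW B0) ?(ltW (jap_gt0 R n)) //.
exact: inv_sqrt_gamma_arg_ge.
Qed.

End Nondegeneracy.

(** * Flux through annuli *)

Section Flux.
Variables (R : realType) (d : nat).
Implicit Types (n m x y z : 'rV[int]_d) (v : 'rV[int]_d -> R).

(** Summation by parts needs a factor of bounded support. Truncating [v] one layer beyond the
    support of [F] changes no term of the pairing. *)
Lemma sum_divfree (F : 'rV[int]_d -> 'rV[R]_d) v N N' :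
  (forall n, (N < nsup n)%N -> F n = 0) -> (forall n, div F n = 0) -> (N.+2 <= N')%N ->
  \sum_(n <- box d N') \sum_l F n 0 l * grad v n 0 l = 0.
Proof.
move=> F0 dF NN'.
pose g n := if (nsup n <= N.+1)%N then v n else 0.
have g0 : supported g N.+1 by move=> n; rewrite /g ltnNge => /negPf ->.
have := sum_div F g0 NN'; rewrite big1 => [|n _]; last by rewrite dF mul0r.
move/esym/eqP; rewrite oppr_eq0 => /eqP s0; rewrite -[RHS]s0; apply: eq_bigr => n _.
have [nN|/F0 ->] := leqP (nsup n) N; last by rewrite !big1 // => l _; rewrite mxE mul0r.
apply: eq_bigr => l _; congr (_ * _); rewrite !mxE /g (leqW nN).
by rewrite (leq_trans (nsup_addb n l)).
Qed.

Hypothesis d0 : (0 < d)%N.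

Definition ramp (i : 'I_d) N n : R := (n 0 i)%:~R * cutoff R N n.

Lemma ramp_supported i N : (0 < N)%N -> supported (ramp i N) (2 * d * N).
Proof. by move=> N0 n nN; rewrite /ramp (@cutoff_eq0 R d d0 N n N0 (ltnW nN)) mulr0. Qed.

Lemma ramp_inside i l N n : (nsup n < N)%N ->
  ramp i N (n + basis_vec l) - ramp i N n = (i == l)%:R /\
  ramp i N n - ramp i N (n - basis_vec l) = (i == l)%:R.
Proof.
move=> nN; have N0 : (0 < N)%N by apply: leq_trans nN.
rewrite /ramp (@cutoff_eq1 R d d0 N n N0 (ltnW nN)).
rewrite (@cutoff_eq1 R d d0 N _ N0 (leq_trans (nsup_addb n l) nN)).
rewrite (@cutoff_eq1 R d d0 N _ N0 (leq_trans (nsup_subb n l) nN)).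
rewrite entryB entryD entry_basis intrD intrB !mulr1.
by split; case: (i == l) => /=; ring.
Qed.

Lemma ramp_outside i l N n : (0 < N)%N -> (2 * d * N + 1 <= nsup n)%N ->
  ramp i N (n + basis_vec l) - ramp i N n = 0 /\
  ramp i N n - ramp i N (n - basis_vec l) = 0.
Proof.
move=> N0 nN; have [e1 e2 e3] := @cutoff_out R d d0 N n l N0 nN.
by rewrite /ramp e1 e2 e3 !mulr0 subrr.
Qed.

Lemma ramp_diff i l N n : (0 < N)%N ->
  `|ramp i N (n + basis_vec l) - ramp i N n| <= 316 * d%:R /\
  `|ramp i N n - ramp i N (n - basis_vec l)| <= 316 * d%:R.
Proof.
move=> N0; have [nN|nN] := leqP (nsup n) (2 * d * N + 1); last first.
  by have [-> ->] := @ramp_outside i l N n N0 (ltnW nN); rewrite normr0 (mulr_ge0 (ler0n R 316) (ler0n R d)).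
have dr : 1 <= (d%:R : R) by rewrite ler1n.
have Nr : 0 < (N%:R : R) by rewrite ltr0n.
have ni : `|(n 0 i)%:~R : R| <= 3 * d%:R * N%:R.
  rewrite abs_coord -!natrM ler_nat (leq_trans (leq_nsup n i)) // (leq_trans nN) //.
  by move: d0 N0; clear; nia.
have [h1 h2] := @cutoff_diff R d d0 N n l N0.
have del (b : bool) c : `|c| <= 1 -> `|b%:R * c| <= 1 :> R.
  by case: b; rewrite ?mul1r // mul0r normr0.
have bnd (c : R) : `|c| <= 105 / N%:R -> `|(n 0 i)%:~R * c| <= 315 * d%:R.
  move=> cN; rewrite normrM; apply: le_trans (ler_pM _ _ ni cN) _ => //.
  by rewrite le_eqVlt; apply/orP; left; apply/eqP; field; rewrite lt0r_neq0.
have e315 : 316 * d%:R = 315 * d%:R + d%:R :> R by ring.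
split.
  have -> : ramp i N (n + basis_vec l) - ramp i N n = (n 0 i)%:~R * (cutoff R N (n + basis_vec l) - cutoff R N n)
     + (i == l)%:R * cutoff R N (n + basis_vec l).
    by rewrite /ramp entryD entry_basis intrD; case: (i == l) => /=; ring.
  apply: le_trans (ler_normD _ _) _; rewrite e315 lerD ?bnd //.
  by apply: le_trans dr; apply: del; exact: cutoff_norm.
have -> : ramp i N n - ramp i N (n - basis_vec l) = (i == l)%:R * cutoff R N (n - basis_vec l)
   - (n 0 i)%:~R * (cutoff R N (n - basis_vec l) - cutoff R N n).
  by rewrite /ramp entryB entry_basis intrB; case: (i == l) => /=; ring.
apply: le_trans (ler_normB _ _) _; rewrite e315 addrC lerD ?bnd //.
by apply: le_trans dr; apply: del; exact: cutoff_norm.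
Qed.

(* A divergence-free field equal to e_i near the origin. *)
Definition swirl (i j : 'I_d) N n : 'rV[R]_d :=
  \row_l ((l == i)%:R * (ramp j N n - ramp j N (n - basis_vec j))
        - (l == j)%:R * (ramp j N n - ramp j N (n - basis_vec i))).

(** The swirl is a rotated gradient in the (i, j) plane with stream function [ramp j N]. It is built
    from backward differences, as [div] is, so its divergence vanishes because these commute. *)
Lemma div_swirl i j N n : i != j -> div (swirl i j N) n = 0.
Proof.
move=> ij; rewrite /div.
transitivity (\sum_l ((l == i)%:R * ((ramp j N n - ramp j N (n - basis_vec j)) -
     (ramp j N (n - basis_vec i) - ramp j N (n - basis_vec i - basis_vec j)))
   - (l == j)%:R * ((ramp j N n - ramp j N (n - basis_vec i)) -
     (ramp j N (n - basis_vec j) - ramp j N (n - basis_vec j - basis_vec i))))).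
  apply: eq_bigr => l _; rewrite !mxE.
  case: (l =P i) => [->|_]; case: (_ =P j) => [->|_] //=; ring.
have pick (k : 'I_d) (X : R) : \sum_(l < d) (l == k)%:R * X = X.
  rewrite (bigD1 k) //= eqxx mul1r big1 ?addr0 // => l /negPf ->; exact: mul0r.
by rewrite sumrB !pick (addrAC n (- basis_vec i)); ring.
Qed.

Definition flux_field i j N n : 'rV[R]_d := grad (ramp i N) n - swirl i j N n.

Lemma flux_field_inside i j N n : i != j -> (nsup n < N)%N -> flux_field i j N n = 0.
Proof.
move=> ij nN; apply/rowP => l; rewrite !mxE.
have [-> _] := ramp_inside i l nN; have [_ ->] := ramp_inside j j nN.
have [_ ->] := ramp_inside j i nN; rewrite eqxx [j == i]eq_sym (negPf ij) mulr1 mulr0 subr0.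
by rewrite eq_sym subrr.
Qed.

Lemma flux_field_outside i j N n : (0 < N)%N -> (2 * d * N + 1 <= nsup n)%N -> flux_field i j N n = 0.
Proof.
move=> N0 nN; apply/rowP => l; rewrite !mxE.
have [-> _] := ramp_outside i l N0 nN; have [_ ->] := ramp_outside j j N0 nN.
by have [_ ->] := ramp_outside j i N0 nN; rewrite !mulr0 !subr0.
Qed.

Lemma flux_field_bound i j N n l : (0 < N)%N -> i != j -> `|flux_field i j N n 0 l| <= 632 * d%:R.
Proof.
move=> N0 ij; rewrite !mxE.
have [h1 _] := ramp_diff i l n N0; have [_ h2] := ramp_diff j j n N0.
have [_ h3] := ramp_diff j i n N0.
have -> : 632 * d%:R = 316 * d%:R + 316 * d%:R :> R by ring.
apply: le_trans (ler_normB _ _) _; apply: lerD => //.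
case: (l =P i) => [->|_]; first by rewrite (negPf ij) mul1r mul0r subr0.
by case: (l == j); rewrite mul0r sub0r normrN ?mul1r ?mul0r ?normr0 ?(mulr_ge0 (ler0n R 316) (ler0n R d)).
Qed.

Lemma flux_identity i j N (h : 'rV[int]_d -> 'rV[R]_d) v : i != j -> (0 < N)%N ->
  (forall n, (N <= nsup n)%N -> h n = 0) -> (forall n, - laplacian v n = div h n) ->
  \sum_(n <- box d N) h n 0 i =
  - \sum_(n <- box d (2 * d * N)) \sum_l grad v n 0 l * flux_field i j N n 0 l.
Proof.
move=> ij N0 h0 hv.
pose M := (2 * d * N + 4)%N.
have M1 : ((2 * d * N).+1 <= M)%N by rewrite /M; lia.
have e1 := sum_div h (ramp_supported i N0) M1.
have e2 := sum_div (grad v) (ramp_supported i N0) M1.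
have W0 n : (2 * d * N + 1 < nsup n)%N -> swirl i j N n = 0.
  move=> nN; have [_ a] := ramp_outside j j N0 (ltnW nN); have [_ b] := ramp_outside j i N0 (ltnW nN).
  by apply/rowP => l; rewrite !mxE a b !mulr0 subr0.
have e3 := @sum_divfree (swirl i j N) v _ M W0 (fun n => div_swirl N n ij) (_ : _).
have {}e3 : \sum_(n <- box d M) \sum_l swirl i j N n 0 l * grad v n 0 l = 0.
  by apply: e3; rewrite /M; lia.
have NM : (N <= M)%N by move: d0; rewrite /M; clear; nia.
have hi : \sum_(n <- box d M) \sum_l h n 0 l * grad (ramp i N) n 0 l = \sum_(n <- box d N) h n 0 i.
  rewrite -(@box_widen d R (fun n => h n 0 i) N M) //; last first.
    by move=> n nN; rewrite h0 ?mxE // ltnW.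
  apply: eq_bigr => n _; have [nN|/h0 ->] := ltnP (nsup n) N; last first.
    by rewrite mxE big1 // => l _; rewrite mxE mul0r.
  rewrite (bigD1 i) //= big1 => [|l li]; rewrite !mxE.
    by have [-> _] := ramp_inside i i nN; rewrite eqxx mulr1 addr0.
  by have [-> _] := ramp_inside i l nN; rewrite eq_sym (negPf li) mulr0.
rewrite hi in e1.
have -> : \sum_(n <- box d N) h n 0 i = \sum_(n <- box d M) laplacian v n * ramp i N n.
  rewrite -[LHS]opprK -e1 -sumrN; apply: eq_bigr => n _; rewrite -hv; ring.
rewrite /laplacian e2; congr (- _).
transitivity (\sum_(n <- box d M) \sum_l grad v n 0 l * grad (ramp i N) n 0 l -
  \sum_(n <- box d M) \sum_l swirl i j N n 0 l * grad v n 0 l).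
  by rewrite e3 subr0.
rewrite -sumrB.
have -> : \sum_(n <- box d M) (\sum_l grad v n 0 l * grad (ramp i N) n 0 l -
   \sum_l swirl i j N n 0 l * grad v n 0 l) =
   \sum_(n <- box d M) \sum_l grad v n 0 l * flux_field i j N n 0 l.
  apply: eq_bigr => n _; rewrite -sumrB; apply: eq_bigr => l _.
  have -> : flux_field i j N n 0 l = grad (ramp i N) n 0 l - swirl i j N n 0 l.
    by rewrite /flux_field; move: (grad _ n) (swirl i j N n) => A B; rewrite !mxE.
  ring.
apply: box_widen; last by rewrite /M leq_addr.
move=> n nN; rewrite flux_field_outside ?addn1 // big1 // => l _.
by rewrite [X in _ * X]mxE mulr0.
Qed.

Lemma flux_lower_bound (h : 'rV[int]_d -> 'rV[R]_d) v N : (2 <= d)%N -> (0 < N)%N ->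
  (forall n, (N <= nsup n)%N -> h n = 0) -> (forall n, - laplacian v n = div h n) ->
  \sum_i (\sum_(n <- box d N) h n 0 i) ^+ 2 <=
  d%:R * (632 * d%:R) ^+ 2 * (d%:R * (7 * d * N)%:R ^+ d) *
  \sum_(n <- box d (2 * d * N) | (N <= nsup n)%N) \sum_l grad v n 0 l ^+ 2.
Proof.
move=> d2 N0 h0 hv; set S := \sum_(n <- _ | _) _.
have step i : (\sum_(n <- box d N) h n 0 i) ^+ 2 <= (632 * d%:R) ^+ 2 * (d%:R * (7 * d * N)%:R ^+ d) * S.
  (* The swirl needs a plane, hence a second direction; here d >= 2 enters. *)
  have [j ij] : exists j : 'I_d, i != j.
    pose j0 := Ordinal d0; pose j1 := Ordinal d2.
    have [ie|] := eqVneq i j0; last by exists j0.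
    by exists j1; rewrite ie.
  rewrite (flux_identity ij N0 h0 hv) sqrrN.
  rewrite (bigID (fun n => (N <= nsup n)%N)) /= [X in _ + X]big1 ?addr0; last first.
    move=> n; rewrite -ltnNge => nN; rewrite flux_field_inside // big1 // => l _.
    by rewrite [X in _ * X]mxE mulr0.
  pose s := [seq n : 'rV[int]_d <- box d (2 * d * N) | (N <= nsup n)%N].
  have fs (F : 'rV[int]_d -> R) : \sum_(n <- box d (2 * d * N) | (N <= nsup n)%N) F n = \sum_(n <- s) F n.
    by rewrite big_filter.
  rewrite /S !fs.
  rewrite (eq_bigr (fun n => 1 * (\sum_l grad v n 0 l * flux_field i j N n 0 l))); last by move=> n _; rewrite mul1r.
  apply: le_trans (cauchy_schwarz s (fun=> 1) _) _.
  have sz : \sum_(n <- s) (1 : R) ^+ 2 <= (7 * d * N)%:R ^+ d.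
    under eq_bigr do rewrite expr1n.
    rewrite big_const_seq iter_addr addr0 count_predT -natrX ler_nat.
    rewrite (@leq_trans (size (box d (2 * d * N)))) //; first by rewrite size_filter count_size.
    rewrite size_box leq_exp2r //; move: d0 N0; clear; nia.
  have sb : \sum_(n <- s) (\sum_l grad v n 0 l * flux_field i j N n 0 l) ^+ 2 <=
     d%:R * (632 * d%:R) ^+ 2 * \sum_(n <- s) \sum_l grad v n 0 l ^+ 2.
    rewrite mulr_sumr; apply: ler_sum => n _; apply: le_trans (cauchy_schwarz _ _ _) _.
    rewrite mulrC ler_wpM2r //; first by apply: sumr_ge0 => l _; exact: sqr_ge0.
    rewrite -[d in leRHS]card_ord mulr_natl -sumr_const card_ord; apply: ler_sum => l _.
    rewrite -real_normK ?num_real // lerXn2r ?nnegrE ?(mulr_ge0 (ler0n R 632) (ler0n R d)) //.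
    exact: flux_field_bound.
  apply: le_trans (ler_pM _ _ sz sb) _.
  - by apply: sumr_ge0 => n _; exact: sqr_ge0.
  - by apply: sumr_ge0 => n _; exact: sqr_ge0.
  by rewrite le_eqVlt; apply/orP; left; apply/eqP; ring.
apply: le_trans (ler_sum _ (fun i _ => step i)) _.
by rewrite sumr_const card_ord -[leLHS]mulr_natl !mulrA.
Qed.

End Flux.

(** On the annulus N <= |n| <= 2dN the squared dipole gradients contribute N^(-2d); the flux bound
    adds N^(-d), the inverse volume of the annulus. Together they give the exponent 3d. *)
Lemma coefficient_lower_bound (R : realType) (d : nat) (w : 'I_d -> 'rV[int]_d -> R) (C : R) :
  (2 <= d)%N -> (forall k, is_dipole k (w k) C) ->
  exists (c : R) (r0 : nat), 0 < c /\
  forall N (h : 'rV[int]_d -> 'rV[R]_d) (v : 'rV[int]_d -> R), (r0 <= N)%N -> (0 < N)%N ->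
  (forall n, (N <= nsup n)%N -> h n = 0) -> (forall n, - laplacian v n = div h n) ->
  c * (N%:R)^-1 ^+ (3 * d) * \sum_i (\sum_(n <- box d N) h n 0 i) ^+ 2 <=
  \sum_(n <- box d (2 * d * N) | (N <= nsup n)%N)
    \sum_k (\sum_i (w k (n + basis_vec i) - w k n) * grad v n 0 i) ^+ 2.
Proof.
move=> d2 wC; have d0 : (0 < d)%N by apply: leq_trans d2.
have [c1 [r0 [c10 nd]]] := dipole_nondegenerate d2 wC.
have dr : 0 < (d%:R : R) by rewrite ltr0n.
pose K := d%:R * (632 * d%:R) ^+ 2 * (d%:R * (7 * d%:R) ^+ d) : R.
have K0 : 0 < K.
  have p1 : 0 < 632 * d%:R :> R by exact: (mulr_gt0 (ltr0Sn R 631) dr).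
  have p2 : 0 < 7 * d%:R :> R by exact: (mulr_gt0 (ltr0Sn R 6) dr).
  by rewrite /K mulr_gt0 ?(mulr_gt0 dr) ?exprn_gt0.
pose D := (3 * d%:R)^-1 ^+ (2 * d) : R.
have D0 : 0 < D by rewrite exprn_gt0 // invr_gt0 mulr_gt0.
exists (c1 * D / K), r0; split; first by rewrite divr_gt0 // mulr_gt0.
move=> N h v rN N0 h0 hv; have Nr : 0 < (N%:R : R) by rewrite ltr0n.
have fl := flux_lower_bound d0 d2 N0 h0 hv.
set S := \sum_(n <- _ | _) _ in fl.
have NE : d%:R * (632 * d%:R) ^+ 2 * (d%:R * (7 * d * N)%:R ^+ d) = K * N%:R ^+ d :> R.
  by rewrite !natrM (exprMn d (7 * d%:R)) /K; move: ((7 * d%:R) ^+ d) (632 * d%:R) => a b; rewrite !mulrA.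
rewrite NE in fl.
apply: (@le_trans _ _ (c1 * D * N%:R^-1 ^+ (2 * d) * S)).
  have -> : c1 * D / K * N%:R^-1 ^+ (3 * d) * \sum_i (\sum_(n <- box d N) h n 0 i) ^+ 2
     = c1 * D * N%:R^-1 ^+ (2 * d) * ((K * N%:R ^+ d)^-1 * \sum_i (\sum_(n <- box d N) h n 0 i) ^+ 2).
    rewrite [(K * _)^-1]invfM -exprVn; have -> : (3 * d = 2 * d + d)%N by lia.
    by rewrite exprD; ring.
  apply: ler_wpM2l.
    by rewrite mulr_ge0 ?exprn_ge0 ?invr_ge0 // mulr_ge0 // ltW.
  by rewrite ler_pdivrMl // mulr_gt0 // exprn_gt0.
rewrite mulr_sumr [leLHS]big_seq_cond [leRHS]big_seq_cond; apply: ler_sum => n /andP[nb nN].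
rewrite mem_box in nb.
apply: le_trans (nd n (fun i => grad v n 0 i) (leq_trans rN nN)).
apply: ler_wpM2r; first by apply: sumr_ge0 => l _; exact: sqr_ge0.
rewrite -mulrA ler_wpM2l ?(ltW c10) // /D -exprMn -invfM.
have J0 := jap_gt0 R n.
have p3 : 0 < 3 * d%:R * N%:R :> R by rewrite mulr_gt0 // mulr_gt0.
rewrite lerXn2r ?nnegrE ?invr_ge0 ?(ltW p3) ?(ltW J0) // lef_pV2 ?posrE //.
by rewrite /jap -!natrM ler_nat; move: nb d0 N0; clear; nia.
Qed.

(** * Gaussian laws *)

Section NormalMoments.
Context {R : realType}.
Local Open Scope ereal_scope.
Notation mu := (@lebesgue_measure R).

(** Change of variables is available for the Radon-Nikodym derivative; it agrees almost everywhere
    with the explicit density since both have the same integral over every measurable set. *)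
Lemma ge0_integral_normal_prob (m s : R) (g : R -> \bar R) :
  measurable_fun setT g -> (forall x, 0 <= g x) ->
  \int[normal_prob m s]_x g x = \int[mu]_x (g x * (normal_pdf m s x)%:E).
Proof.
move=> mg g0.
have dom : normal_prob m s `<< mu := normal_prob_dominates m s.
rewrite -(Radon_Nikodym_SigmaFinite.change_of_variables dom g0 measurableT mg).
have mpdf : measurable_fun setT (fun x : measurableTypeR R => (normal_pdf m s x)%:E).
  by apply/measurable_EFinP; exact: measurable_normal_pdf.
apply: ae_eq_integral => //.
- apply: emeasurable_funM => //.
  exact: measurable_int (Radon_Nikodym_SigmaFinite.f_integrable dom).
- exact: emeasurable_funM.
apply: ae_eqe_mul2l; apply: integral_ae_eq => //.
  exact: Radon_Nikodym_SigmaFinite.f_integrable.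
by move=> E _ mE; rewrite -Radon_Nikodym_SigmaFinite.f_integral.
Qed.

Lemma normal_pdf_shift (m s x : R) : s != 0%R -> normal_pdf m s (x + m)%R = normal_pdf 0 s x.
Proof. by move=> s0; rewrite !normal_pdfE // /normal_fun subr0 addrK. Qed.

Lemma normal_pdf_even (s x : R) : s != 0%R -> normal_pdf 0 s (- x)%R = normal_pdf 0 s x.
Proof. by move=> s0; rewrite !normal_pdfE // /normal_fun !subr0 sqrrN. Qed.

Lemma normal_pdf_scale (s x : R) : (0 < s)%R -> (normal_pdf 0 s (s * x) * s)%R = normal_pdf 0 1 x.
Proof.
move=> s0; rewrite !normal_pdfE ?gt_eqF ?oner_neq0 // /normal_fun /normal_peak !subr0.
have -> : (- (s * x) ^+ 2 / (s ^+ 2 *+ 2) = - x ^+ 2 / (1 ^+ 2 *+ 2))%R.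
  rewrite exprMn expr1n -[(s ^+ 2 *+ 2)%R]mulr_natr -[(1 *+ 2)%R]mulr_natr mul1r -mulrN.
  by rewrite invfM mulrACA divff ?mul1r // expf_neq0 // gt_eqF.
rewrite mulrAC; congr (_ * _)%R.
rewrite expr1n mul1r -mulrnAr sqrtrM ?sqr_ge0 // sqrtr_sqr gtr0_norm // invfM mulrC mulrA.
by rewrite divff ?gt_eqF // mul1r.
Qed.

Lemma derive1_affine (a b : R) : (fun x : R => (a * x + b)%R)^`()%classic = cst a.
Proof.
apply/funext => x; rewrite derive1E deriveD //= derive_cst addr0.
by rewrite deriveZ //= derive_id scaler1.
Qed.

Lemma integral_affine (a b : R) (G : R -> R) : (0 < a)%R -> continuous G -> (forall x, (0 <= G x)%R) ->
  \int[mu]_x (G x)%:E = \int[mu]_x (G (a * x + b) * a)%:E.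
Proof.
move=> a0 cG G0.
rewrite (@increasing_ge0_integration_by_substitutionT _ (fun x => (a * x + b)%R) G) //.
- by apply: eq_integral => x _; rewrite derive1_affine /=.
- by move=> x y xy; rewrite ltrD2r ltr_pM2l.
- by rewrite derive1_affine => x; exact: cvg_cst.
- by rewrite derive1_affine; exact: is_cvg_cst.
- by rewrite derive1_affine; exact: is_cvg_cst.
- have -> : (fun x : R => (a * x + b)%R) = (fun x => (x + b)%R) \o (fun x => (x * a)%R).
    by apply/funext => x /=; rewrite mulrC.
  apply: cvg_comp; last exact: cvg_addrr_Ny.
  by apply/gt0_cvgMlNy => //; exact: cvg_id.
- have -> : (fun x : R => (a * x + b)%R) = (fun x => (x + b)%R) \o (fun x => (x * a)%R).
    by apply/funext => x /=; rewrite mulrC.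
  apply: cvg_comp; last exact: cvg_addrr.
  by apply/gt0_cvgMly => //; exact: cvg_id.
Qed.

Lemma integral_reflect (g : R -> \bar R) : measurable_fun setT g -> (forall x, 0 <= g x) ->
  \int[mu]_x g x = \int[mu]_x g (- x)%R.
Proof.
move=> mg g0.
transitivity (\int[pushforward mu (-%R : _ -> measurableTypeR R)]_x g x).
  by apply: eq_measure_integral => A mA _; exact/esym/lebesgue_measureN.
by rewrite ge0_integral_pushforward //= preimage_setT.
Qed.

(** Symmetry about [m] is stated for the two nonnegative parts of x - m, so that the substitutions
    for nonnegative integrands apply directly. *)
Lemma normal_prob_symmetric (m s : R) : s != 0%R ->
  \int[normal_prob m s]_x (Num.max (x - m) 0)%:E = \int[normal_prob m s]_x (Num.max (m - x) 0)%:E.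
Proof.
move=> s0.
have cmax (f : R -> R) : continuous f -> continuous (fun x => Num.max (f x) 0%R).
  by move=> cf x; apply: continuous_max; [exact: cf|exact: cvg_cst].
have c1 : continuous (fun x : R => (x - m)%R) by move=> x; apply: cvgB; [exact: cvg_id|exact: cvg_cst].
have c2 : continuous (fun x : R => (m - x)%R) by move=> x; apply: cvgB; [exact: cvg_cst|exact: cvg_id].
have pos (x : R) : (0 <= Num.max x 0)%R by rewrite le_max lexx orbT.
have mEF (f : R -> R) : continuous f -> measurable_fun setT (fun x => (f x)%:E).
  by move=> cf; apply/measurable_EFinP; exact: continuous_measurable_fun.
have shift (f : R -> R) : continuous f -> (forall x, 0 <= f x)%R ->
    \int[normal_prob m s]_x (f x)%:E = \int[mu]_x (f (x + m) * normal_pdf 0 s x)%:E.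
  move=> cf f0; rewrite ge0_integral_normal_prob; [|exact: mEF|by move=> x; rewrite lee_fin].
  rewrite (_ : \int[mu]_x _ = \int[mu]_x (f x * normal_pdf m s x)%:E); last first.
    by apply: eq_integral => x _; rewrite EFinM.
  rewrite (@integral_affine 1 m) //.
  - by apply: eq_integral => x _; rewrite mul1r mulr1 normal_pdf_shift.
  - by move=> x; apply: cvgM; [exact: cf|exact: continuous_normal_pdf].
  - by move=> x; rewrite mulr_ge0 // normal_pdf_ge0.
rewrite (shift _ (cmax _ c1) (fun x => pos _)) (shift _ (cmax _ c2) (fun x => pos _)).
rewrite integral_reflect.
- apply: eq_integral => x _; rewrite normal_pdf_even //; congr ((Num.max _ _ * _)%R%:E); ring.
- apply/measurable_EFinP; apply: measurable_funM; last exact: measurable_normal_pdf.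
  apply: continuous_measurable_fun; apply: (cmax (fun x => (x + m - m)%R)).
  by move=> x; apply: cvgB; [apply: cvgD; [exact: cvg_id|exact: cvg_cst]|exact: cvg_cst].
- by move=> x; rewrite lee_fin mulr_ge0 // normal_pdf_ge0.
Qed.

Definition normal_moment2 : \bar R := \int[mu]_x (x ^+ 2 * normal_pdf 0 1 x)%:E.

Lemma normal_moment2_gt0 : 0 < normal_moment2.
Proof.
have c0 : (0 < expR (-2) * normal_peak 1 :> R)%R by rewrite mulr_gt0 ?expR_gt0 ?normal_peak_gt0.
(* On [1, 2] the square is at least 1 and the Gaussian factor at least exp(-2). *)
apply: (@lt_le_trans _ _ (\int[mu]_(x in `[1%R, 2%R]) (expR (-2) * normal_peak 1)%:E)).
  rewrite integral_cst //= lebesgue_measure_itv /= lte_fin ltr1n -EFinD -EFinM lte_fin.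
  by rewrite mulr_gt0 //; lra.
apply: (@le_trans _ _ (\int[mu]_(x in `[1%R, 2%R]) (x ^+ 2 * normal_pdf 0 1 x)%:E)).
  apply: ge0_le_integral => //=.
  - by move=> x _; rewrite lee_fin ltW.
  - apply/measurable_EFinP; apply: measurable_funTS; apply: measurable_funM => //; last exact: measurable_normal_pdf.
  - move=> x; rewrite in_itv /= => /andP[x1 x2]; rewrite lee_fin normal_pdfE ?oner_neq0 //.
    rewrite mulrCA [leLHS]mulrC ler_pM2l ?normal_peak_gt0 ?oner_neq0 //.
    apply: (@le_trans _ _ (1 * normal_fun 0 1 x)%R).
      rewrite mul1r /normal_fun ler_expR subr0 expr1n mulNr lerN2 -mulr_natr mul1r ler_pdivrMr //.
      by rewrite expr2; apply: ler_pM => //; lra.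
    by rewrite ler_wpM2r ?normal_fun_ge0 // exprn_ege1.
apply: ge0_subset_integral => //=.
- by apply/measurable_EFinP; apply: measurable_funM => //; exact: measurable_normal_pdf.
- by move=> x _; rewrite lee_fin mulr_ge0 ?sqr_ge0 ?normal_pdf_ge0.
Qed.

Lemma normal_prob_moment2 (s : R) : s != 0%R ->
  \int[normal_prob 0 s]_x (x ^+ 2)%:E = (s ^+ 2)%:E * normal_moment2.
Proof.
move=> s0.
have abs_s : normal_prob 0 s = normal_prob 0 `|s|%R.
  apply/funext => A; apply: eq_integral => x _.
  by rewrite !normal_pdfE ?normr_eq0 // /normal_peak /normal_fun real_normK ?num_real.
have a0 : (0 < `|s|)%R by rewrite normr_gt0.
have mX : measurable_fun setT (fun x : R => (x ^+ 2)%:E).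
  by apply/measurable_EFinP; exact: measurable_funX.
rewrite (ge0_integral_normal_prob 0 s mX) => [|x]; last by rewrite lee_fin sqr_ge0.
transitivity (\int[mu]_x (x ^+ 2 * normal_pdf 0 `|s| x)%:E).
  apply: eq_integral => x _; rewrite !normal_pdfE ?normr_eq0 //.
  by rewrite /normal_peak /normal_fun real_normK ?num_real.
have cG : continuous (fun x : R => x ^+ 2 * normal_pdf 0 `|s| x)%R.
  move=> x; apply: cvgM; last by apply: continuous_normal_pdf; rewrite normr_eq0.
  exact: exprn_continuous.
have G0 t (x : R) : (0 <= x ^+ 2 * normal_pdf 0 t x)%R.
  by rewrite mulr_ge0 ?sqr_ge0 ?normal_pdf_ge0.
rewrite (integral_affine 0 a0 cG (G0 `|s|%R)).
have m1 : measurable_fun setT (fun x : R => (x ^+ 2 * normal_pdf 0 1 x)%:E).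
  by apply/measurable_EFinP; apply: measurable_funM => //; exact: measurable_normal_pdf.
have s2 : 0 <= (s ^+ 2)%:E by rewrite lee_fin sqr_ge0.
rewrite /normal_moment2 -(ge0_integralZl mu measurableT m1 _ s2) => [|x _]; last first.
  by rewrite lee_fin G0.
apply: eq_integral => x _.
by rewrite addr0 -mulrA (normal_pdf_scale _ a0) exprMn (real_normK (num_real s)) -EFinM -mulrA.
Qed.

End NormalMoments.

Section GaussianLaw.
Context d (T : measurableType d) (R : realType) (P : probability T R).
Local Open Scope ereal_scope.
Implicit Types X Y : T -> R.

(* The canonical measurable structure on R and measurableTypeR R differ by their display only. *)
Lemma measurable_funTR (f : T -> R) :
  measurable_fun setT f -> measurable_fun setT (f : T -> measurableTypeR R).
Proof. by move=> mf mT Y mY; exact: mf. Qed.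

Lemma gaussian_expectation X (nu : {measure set (measurableTypeR R) -> \bar R}) (g : R -> \bar R) :
  measurable_fun setT X ->
  (forall A : set R, measurable A -> P (X @^-1` A) = nu A) ->
  measurable_fun setT g -> (forall x, 0 <= g x) ->
  \int[P]_w g (X w) = \int[nu]_x g x.
Proof.
move=> /measurable_funTR mX law mg g0.
pose mixin := isMeasurableFun.Build _ _ _ _ _ mX.
pose X' : {mfun T >-> measurableTypeR R} := HB.pack (X : T -> measurableTypeR R) mixin.
have mg' : measurable_fun [set: measurableTypeR R] (g : measurableTypeR R -> \bar R).
  by move=> mT Y mY; exact: mg.
rewrite -[LHS](ge0_integral_distribution X' mg' g0).
by apply: eq_measure_integral => A mA _; rewrite -law.
Qed.

Lemma integral_dirac_setT (a : R) (g : R -> \bar R) : measurable_fun setT g ->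
  \int[@dirac _ (measurableTypeR R) a R]_x g x = g a.
Proof.
move=> mg.
have mg' : measurable_fun [set: measurableTypeR R] (g : measurableTypeR R -> \bar R).
  by move=> mT Y mY; exact: mg.
by rewrite (integral_dirac _ measurableT mg') diracE mem_set // mul1e.
Qed.

(* The value 1 of normal_moment2 is not needed: equal second moments give equal s^2. *)
Lemma centred_gaussian_law X : measurable_fun setT X -> is_gaussian P X ->
  P.-integrable setT (EFin \o X) -> \int[P]_w (X w)%:E = 0 -> exists s : R,
  (forall A : set R, measurable A ->
     P (X @^-1` A) = if s == 0%R then dirac (0%R : R) A else normal_prob 0 s A) /\
  \int[P]_w (X w ^+ 2)%:E = (s ^+ 2)%:E * normal_moment2.
Proof.
move=> mX [m [s law]] iX EX.
have EXm : \int[P]_w (X w - m)%:E = (- m)%:E.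
  under eq_integral do rewrite EFinB.
  rewrite integralB // ?EX; last exact: finite_measure_integrable_cst.
  have -> : \int[P]__ m%:E = m%:E by rewrite -[RHS](expectation_cst P m) unlock.
  by rewrite add0e.
have iXm : P.-integrable setT (fun w => (X w - m)%:E).
  rewrite (_ : (fun w => _) = (EFin \o X) \- (EFin \o cst m)) //.
  by apply: integrableB => //; exact: finite_measure_integrable_cst.
have pos (x : R) : (0 <= Num.max x 0)%R by rewrite le_max lexx orbT.
have posE (f : R -> R) x : 0 <= (Num.max (f x) 0)%:E by rewrite lee_fin.
have mmax (f : R -> R) : measurable_fun setT f -> measurable_fun setT (fun x => (Num.max (f x) 0)%:E).
  by move=> mf; apply/measurable_EFinP; apply: measurable_maxr.
have m1 : measurable_fun setT (fun x : R => (x - m)%R) by exact: measurable_funB.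
have m2 : measurable_fun setT (fun x : R => (m - x)%R) by exact: measurable_funB.
have sym : \int[P]_w (Num.max (X w - m) 0)%:E = \int[P]_w (Num.max (m - X w) 0)%:E.
  have [s0|s0] := eqVneq s 0%R.
    have lawd (A : set R) : measurable A -> P (X @^-1` A) = @dirac _ (measurableTypeR R) m R A.
      by move=> mA; rewrite law // s0 eqxx.
    rewrite (gaussian_expectation mX lawd (mmax _ m1) (posE _)).
    rewrite (gaussian_expectation mX lawd (mmax _ m2) (posE _)).
    by rewrite !integral_dirac_setT ?subrr //; exact: mmax.
  have lawn (A : set R) : measurable A -> P (X @^-1` A) = normal_prob m s A.
    by move=> mA; rewrite law // (negPf s0).
  rewrite (gaussian_expectation mX lawn (mmax _ m1) (posE _)).
  rewrite (gaussian_expectation mX lawn (mmax _ m2) (posE _)).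
  exact: normal_prob_symmetric.
(* By symmetry X - m has mean 0, whereas E X = 0 gives it mean -m. *)
have m0 : m = 0%R.
  have EXm0 : \int[P]_w (X w - m)%:E = 0.
    have e1 : \int[P]_w (fun w => (X w - m)%:E)^\+ w = \int[P]_w (Num.max (X w - m) 0)%:E.
      by apply: eq_integral => w _; rewrite funeposE EFin_max.
    have e2 : \int[P]_w (fun w => (X w - m)%:E)^\- w = \int[P]_w (Num.max (m - X w) 0)%:E.
      by apply: eq_integral => w _; rewrite funenegE -EFinN opprB EFin_max.
    rewrite integralE e1 e2 sym subee // -e2.
    exact: integrable_neg_fin_num.
  by have := EXm; rewrite EXm0 => -[] /esym/eqP; rewrite oppr_eq0 => /eqP.
rewrite m0 in law; exists s; split; first exact: law.
have mX2 : measurable_fun setT (fun x : R => (x ^+ 2)%:E).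
  by apply/measurable_EFinP; exact: measurable_funX.
have p2 (x : R) : 0 <= (x ^+ 2)%:E by rewrite lee_fin sqr_ge0.
have [s0|s0] := eqVneq s 0%R.
  have lawd (A : set R) : measurable A -> P (X @^-1` A) = @dirac _ (measurableTypeR R) 0%R R A.
    by move=> mA; rewrite law // s0 eqxx.
  rewrite (gaussian_expectation mX lawd mX2 p2) integral_dirac_setT // s0 expr0n /=.
  by rewrite mul0e.
have lawn (A : set R) : measurable A -> P (X @^-1` A) = normal_prob 0 s A.
  by move=> mA; rewrite law // (negPf s0).
by rewrite (gaussian_expectation mX lawn mX2 p2) normal_prob_moment2.
Qed.

Lemma gaussian_law_eq X Y : measurable_fun setT X -> measurable_fun setT Y ->
  is_gaussian P X -> is_gaussian P Y ->
  P.-integrable setT (EFin \o X) -> P.-integrable setT (EFin \o Y) ->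
  \int[P]_w (X w)%:E = 0 -> \int[P]_w (Y w)%:E = 0 ->
  \int[P]_w (X w ^+ 2)%:E < +oo ->
  \int[P]_w (X w ^+ 2)%:E = \int[P]_w (Y w ^+ 2)%:E ->
  forall A : set R, measurable A -> P (X @^-1` A) = P (Y @^-1` A).
Proof.
move=> mX mY gX gY iX iY EX EY fin e A mA.
have [s [lX vX]] := centred_gaussian_law mX gX iX EX.
have [t [lY vY]] := centred_gaussian_law mY gY iY EY.
rewrite (lX A mA) (lY A mA).
suff st : (s ^+ 2 = t ^+ 2)%R.
  have -> : (s == 0%R) = (t == 0%R) by rewrite -sqrf_eq0 st sqrf_eq0.
  have [//|t0] := eqVneq t 0%R; have s0 : s != 0%R by rewrite -sqrf_eq0 st sqrf_eq0.
  apply: eq_integral => x _.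
  by rewrite (normal_pdfE 0%R s0) (normal_pdfE 0%R t0) /normal_peak /normal_fun st.
have M0 := @normal_moment2_gt0 R.
rewrite vX vY in e; rewrite vX in fin.
case: (normal_moment2) M0 e fin => [M| |] //.
  by rewrite lte_fin => M0 [] /(mulIf (lt0r_neq0 M0)).
(* Infinite [normal_moment2]: the finite second moment of X forces s = 0, and equality of the
   moments forces t = 0. *)
move=> _.
have [->|s0] := eqVneq (s ^+ 2)%R 0%R; have [->|t0] := eqVneq (t ^+ 2)%R 0%R => //.
- by rewrite mul0e gt0_muley // lte_fin lt0r t0 sqr_ge0.
- by move=> _; rewrite gt0_muley ?ltxx // lte_fin lt0r s0 sqr_ge0.
- by move=> _; rewrite gt0_muley ?ltxx // lte_fin lt0r s0 sqr_ge0.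
Qed.

End GaussianLaw.

(** * Variables orthogonal to a generated sigma-algebra *)

Section StepLimit.
Variable R : realType.
Implicit Types y z r q : R.

Lemma bernoulli_le z k : 0 <= z <= 1 -> 1 - k%:R * z <= (1 - z) ^+ k.
Proof.
move=> /andP[z0 z1]; elim: k => [|k IH]; first by rewrite mul0r subr0.
rewrite exprS; apply: le_trans (ler_wpM2l _ IH); last by rewrite subr_ge0.
have := mulr_ge0 (mulr_ge0 z0 z0) (ler0n R k); rewrite -natr1; move: (k%:R : R) => x; lra.
Qed.

Lemma bernoulli_inv z k : 0 <= z <= 1 -> (1 - z) ^+ k * (1 + k%:R * z) <= 1.
Proof.
move=> /andP[z0 z1]; elim: k => [|k IH]; first by rewrite mul0r addr0 mulr1.
apply: le_trans IH; rewrite exprSr -mulrA ler_wpM2l ?exprn_ge0 ?subr_ge0 //.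
have := mulr_ge0 (mulr_ge0 z0 z0) (ler0n R k); have := mulr_ge0 z0 z0.
rewrite -natr1; move: (k%:R : R) => x; lra.
Qed.

Lemma natr_geometric r n : 0 <= r <= 1 -> (1 - r) * (n%:R * r ^+ n) <= 1.
Proof.
move=> /andP[r0 r1].
suff : (1 - r) * (n%:R * r ^+ n) + r ^+ n <= 1.
  by have := exprn_ge0 n r0; lra.
elim: n => [|n IH]; first by rewrite mul0r mulr0 add0r.
have h0 := exprn_ge0 n r0; have h1 : r ^+ n <= 1 by rewrite exprn_ile1.
rewrite exprS -natr1.
have := ler_wpM2l r0 IH; have : (1 - r) * (r * r ^+ n) <= (1 - r) * 1.
  by rewrite ler_wpM2l ?subr_ge0 // mulr_ile1.
move: (n%:R : R) (r ^+ n) => x y; lra.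
Qed.

Lemma natr_geometric_cvg q : 0 <= q < 1 -> (fun n : nat => n%:R * q ^+ n) @ \oo --> (0 : R).
Proof.
move=> /andP[q0 q1]; set r := Num.sqrt q.
have r0 : 0 <= r by exact: sqrtr_ge0.
have r1 : r < 1 by rewrite -sqrtr1 ltr_sqrt.
have rr : q = r * r by rewrite -expr2 sqr_sqrtr.
have br n : n%:R * q ^+ n <= (1 - r)^-1 * r ^+ n.
  rewrite rr exprMn mulrA ler_wpM2r ?exprn_ge0 // -[leRHS]mul1r ler_pdivlMr ?subr_gt0 // mulrC.
  by apply: natr_geometric; rewrite r0 ltW.
apply: (@squeeze_cvgr _ _ _ _ (fun=> 0) (fun n => (1 - r)^-1 * r ^+ n)).
- by apply: nearW => n; rewrite br andbT mulr_ge0 // exprn_ge0.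
- exact: cvg_cst.
- rewrite -(mulr0 (1 - r)^-1); apply: cvgM; first exact: cvg_cst.
  by apply: cvg_expr; rewrite ger0_norm.
Qed.

(** Polynomials approximating a step at 1/2. By Bernoulli's inequalities the expression is governed
    by n (2y)^n, which tends to 0 for y < 1/2 and is at least n otherwise; the extra factor [n] in
    the exponent settles y = 1/2. *)
Lemma step_limit y : 0 <= y <= 1 ->
  (fun n : nat => (1 - y ^+ n) ^+ (n * 2 ^ n)) @ \oo --> (if y < 1 / 2 then 1 else 0 : R).
Proof.
move=> /andP[y0 y1].
have zI n : 0 <= y ^+ n <= 1 by rewrite exprn_ge0 // exprn_ile1.
have kz n : (n * 2 ^ n)%:R * y ^+ n = n%:R * (2 * y) ^+ n :> R.
  by rewrite natrM natrX exprMn mulrA.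
have le1 n : (1 - y ^+ n) ^+ (n * 2 ^ n)%N <= 1.
  by have /andP[a b] := zI n; rewrite exprn_ile1 ?subr_ge0 // gerBl.
have ge0 n : 0 <= (1 - y ^+ n) ^+ (n * 2 ^ n)%N.
  by have /andP[a b] := zI n; rewrite exprn_ge0 // subr_ge0.
have [yh|yh] := ltP y (1 / 2).
  apply: (@squeeze_cvgr _ _ _ _ (fun n => 1 - n%:R * (2 * y) ^+ n) (fun=> 1)).
  - by apply: nearW => n; rewrite le1 andbT -kz; exact: bernoulli_le.
  - rewrite -[X in _ --> X]subr0; apply: cvgB; first exact: cvg_cst.
    by apply: natr_geometric_cvg; rewrite mulr_ge0 //=; lra.
  - exact: cvg_cst.
apply: (@squeeze_cvgr _ _ _ _ (fun=> 0) (fun n : nat => n.+1%:R^-1)).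
- apply: nearW => n; rewrite ge0 /= -[leRHS]mul1r ler_pdivlMr //.
  apply: le_trans (bernoulli_inv (n * 2 ^ n) (zI n)); rewrite ler_wpM2l //.
  rewrite kz -natr1 addrC lerD2l ler_peMr // exprn_ege1 //; lra.
- exact: cvg_cst.
- exact: cvg_harmonic.
Qed.

(* Halving theta until it enters [pi/2, pi] detects |theta| >= pi/2. *)
Lemma cos_halving (t : R) :
  (`|t| < pi / 2) <-> (forall j : nat, 0 < cos (t / 2 ^+ j)).
Proof.
have pi0 := pi_gt0 R.
split=> [th j|h].
  apply: cos_gt0_pihalf; rewrite -ltr_norml normrM [X in _ * X]ger0_norm ?invr_ge0 ?exprn_ge0 //.
  by apply: le_lt_trans th; rewrite ler_piMr // invf_le1 ?exprn_gt0 // exprn_ege1 // ler1n.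
rewrite ltNge; apply/negP => th.
have cosabs (x : R) : cos `|x| = cos x.
  by case: (ger0P x) => // _; rewrite cosN.
have ex : exists j : nat, `|t| / 2 ^+ j <= pi.
  have [n hn] : exists n : nat, `|t| / pi < n%:R.
    exists (Num.truncn (`|t| / pi)).+1; exact: truncnS_gt.
  exists n; rewrite ler_pdivrMr ?exprn_gt0 // mulrC -ler_pdivrMr //.
  apply: le_trans (ltW hn) _; rewrite -natrX ler_nat ltnW // ltn_expl //.
have [j hj jmin] := ex_minnP ex.
have hlow : pi / 2 <= `|t| / 2 ^+ j.
  case: j hj jmin => [|j] hj jmin; first by rewrite expr0 divr1.
  have : ~~ (`|t| / 2 ^+ j <= pi) by apply/negP => /jmin; rewrite ltnn.
  rewrite -ltNge => /ltW hp.
  by rewrite exprSr invfM mulrA ler_wpM2r.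
have := h j; rewrite -cosabs normrM [X in _ * X]ger0_norm ?invr_ge0 ?exprn_ge0 //.
have i1 : `|t| / 2 ^+ j \in `[0, pi] by rewrite in_itv /= hj (le_trans _ hlow) // divr_ge0 // ltW.
have i2 : pi / 2 \in `[(0 : R), pi] by rewrite in_itv /= divr_ge0 ?(ltW pi0) //=; lra.
by apply/negP; rewrite -leNgt -cos_pihalf leNgt ltr_cos // -leNgt.
Qed.

End StepLimit.

Section TrigOrthogonal.
Context d (T : measurableType d) (R : realType) (P : probability T R).
Variables (I : Type) (D : set I) (X : I -> T -> R) (A : set (T -> R)).
Hypothesis mX : forall i, measurable_fun setT (X i).
Hypothesis mA : forall S, A S -> measurable_fun setT S.
Hypothesis A0 : A (cst 0).
Hypothesis addA : forall S i (k c : R), A S -> D i -> A (fun w => S w + (k * X i w + c)).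
Implicit Types (V W : T -> R) (B : set T).

Lemma integrable_mul_bounded V (g : T -> R) : P.-integrable setT (EFin \o V) ->
  measurable_fun setT g -> (forall w, `|g w| <= 1) ->
  P.-integrable setT (fun w => (V w * g w)%:E).
Proof.
move=> iV mg g1; apply: (le_integrable measurableT _ _ iV).
  apply/measurable_EFinP; apply: measurable_funM => //.
  by apply/measurable_EFinP; exact: measurable_int iV.
by move=> w _ /=; rewrite lee_fin normrM ler_piMr.
Qed.

Lemma measurable_cos_fun (S : T -> R) : measurable_fun setT S ->
  measurable_fun setT (fun w => cos (S w)).
Proof.
move=> mS; apply: measurableT_comp => //.
exact: continuous_measurable_fun (@continuous_cos R).
Qed.

(** [A] is a class of phases, stable under adding affine functions of an observed variable; thus
    products with further cosines stay inside the family of test functions. *)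
Definition trig_orth V := P.-integrable setT (EFin \o V) /\
  forall S, A S -> (\int[P]_w (V w * cos (S w))%:E = 0)%E.

Lemma trig_orthB V W : trig_orth V -> trig_orth W -> trig_orth (fun w => V w - W w).
Proof.
move=> [iV oV] [iW oW]; split; first exact: (integrableB measurableT iV iW).
move=> S aS; have mc := measurable_cos_fun (mA aS).
under eq_integral do rewrite mulrBl EFinB.
rewrite integralB ?oV ?oW ?subee //; by apply: integrable_mul_bounded => // w; exact: cos_max.
Qed.

Lemma trig_orthZ (k : R) V : trig_orth V -> trig_orth (fun w => k * V w).
Proof.
move=> [iV oV]; split; first exact: (integrableZl measurableT k iV).
move=> S aS; have mc := measurable_cos_fun (mA aS).
under eq_integral do rewrite -mulrA EFinM.
rewrite integralZl ?oV ?mule0 //; apply: integrable_mul_bounded => // w; exact: cos_max.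
Qed.

Lemma trig_orth_ext V W : (forall w, V w = W w) -> trig_orth V -> trig_orth W.
Proof. by move=> /funext ->. Qed.

(** The product formula writes cos S times the new cosine as half the sum of two cosines, whose
    phases [S1] and [S2] again lie in [A]. *)
Lemma trig_orth_cos V i (k c : R) : D i -> trig_orth V ->
  trig_orth (fun w => V w * cos (k * X i w + c)).
Proof.
move=> Di [iV oV].
have mc : measurable_fun setT (fun w => cos (k * X i w + c)).
  by apply: measurable_cos_fun; apply: measurable_funD => //; exact: measurable_funM.
split; first by apply: integrable_mul_bounded => // w; exact: cos_max.
move=> S aS.
pose S1 w := S w + (k * X i w + c); pose S2 w := S w + (- k * X i w + - c).
have a1 : A S1 by exact: addA.
have a2 : A S2 by exact: addA.
have bnd S' : A S' -> P.-integrable setT (fun w => (2^-1 * (V w * cos (S' w)))%:E).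
  move=> aS'; apply: (integrableZl measurableT 2^-1 (integrable_mul_bounded iV (measurable_cos_fun (mA aS')) _)) => w.
  exact: cos_max.
have z S' : A S' -> (\int[P]_w (2^-1 * (V w * cos (S' w)))%:E = 0)%E.
  move=> aS'; under eq_integral do rewrite EFinM.
  rewrite integralZl ?oV ?mule0 //.
  by apply: integrable_mul_bounded => //; [exact: measurable_cos_fun (mA aS')|move=> w; exact: cos_max].
rewrite (_ : (\int[P]_w _)%E = (\int[P]_w ((2^-1 * (V w * cos (S1 w)))%:E + (2^-1 * (V w * cos (S2 w)))%:E))%E).
  by rewrite integralD ?z ?adde0 //; exact: bnd.
apply: eq_integral => w _; rewrite -EFinD /S1 /S2 mulNr -opprD cosB cosD; congr (_%:E).
by field.
Qed.

(** The cosine rescaled to [0, 1] and reversed: it is below 1/2 exactly where the cosine is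
    positive, as [step_limit] requires. *)
Definition half_cos i (k c : R) w : R := (1 - cos (k * X i w + c)) / 2.

Lemma half_cosI i k c w : 0 <= half_cos i k c w <= 1.
Proof.
have := cos_max (k * X i w + c); rewrite ler_norml /half_cos => /andP[a b].
by apply/andP; split; lra.
Qed.

Lemma measurable_half_cos i k c : measurable_fun setT (half_cos i k c).
Proof.
apply: measurable_funM => //; apply: measurable_funB => //.
by apply: measurable_cos_fun; apply: measurable_funD => //; exact: measurable_funM.
Qed.

Lemma trig_orth_pow V i k c n : D i -> trig_orth V -> trig_orth (fun w => V w * half_cos i k c w ^+ n).
Proof.
move=> Di oV; elim: n => [|n IH]; first by apply: trig_orth_ext oV => w; rewrite mulr1.
apply: trig_orth_ext (trig_orthZ 2^-1 (trig_orthB IH (trig_orth_cos k c Di IH))) => w.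
by rewrite exprS /half_cos; field.
Qed.

Lemma trig_orth_poly V i k c n m : D i -> trig_orth V ->
  trig_orth (fun w => V w * (1 - half_cos i k c w ^+ n) ^+ m).
Proof.
move=> Di oV; elim: m => [|m IH]; first by apply: trig_orth_ext oV => w; rewrite mulr1.
apply: trig_orth_ext (trig_orthB IH (trig_orth_pow k c n Di IH)) => w.
by rewrite exprS; ring.
Qed.

Lemma trig_orth_lim V (g : nat -> T -> R) (h : T -> R) : P.-integrable setT (EFin \o V) ->
  (forall n, measurable_fun setT (g n)) -> measurable_fun setT h ->
  (forall n w, `|g n w| <= 1) -> (forall w, g ^~ w @ \oo --> h w) ->
  (forall n, trig_orth (fun w => V w * g n w)) -> trig_orth (fun w => V w * h w).
Proof.
move=> iV mg mh g1 gh og.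
have mV : measurable_fun setT V by apply/measurable_EFinP; exact: measurable_int iV.
have iVn : P.-integrable setT (EFin \o (fun w => `|V w|)) by exact: (integrable_abse iV).
have lim (c : T -> R) : measurable_fun setT c -> (forall w, `|c w| <= 1) ->
    P.-integrable setT (fun w => (V w * h w * c w)%:E) /\
    ((\int[P]_w (V w * g n w * c w)%:E)%E @[n --> \oo] --> (\int[P]_w (V w * h w * c w)%:E)%E).
  move=> mc c1.
  have [||||//| a _ b] := @dominated_convergence _ T R P setT measurableT
    (fun n w => (V w * g n w * c w)%:E) (fun w => (V w * h w * c w)%:E) (EFin \o (fun w => `|V w|)).
  - by move=> n; apply/measurable_EFinP; do 2 apply: measurable_funM => //.
  - by apply/measurable_EFinP; do 2 apply: measurable_funM => //.
  - apply: aeW => w _; apply: cvg_EFin; first by apply: nearW.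
    by apply: cvgM; [apply: cvgM; [exact: cvg_cst|exact: gh]|exact: cvg_cst].
  - exact: iVn.
  - apply: aeW => w n _ /=; rewrite lee_fin !normrM -mulrA ler_piMr // mulr_ile1 //.
  by split.
split.
  have [||i1 _] := lim (cst 1); [exact: measurable_cst|by move=> w; rewrite normr1|].
  by apply: eq_integrable i1 => // w _ /=; rewrite mulr1.
move=> S aS.
have [||_ l] := lim (fun w => cos (S w)); [exact: measurable_cos_fun (mA aS)|by move=> w; exact: cos_max|].
apply: (cvg_unique _ l) => //; rewrite (_ : (fun n => _) = (fun=> 0%E)); first exact: cvg_cst.
by apply/funext => n; have [_ ->] := og n.
Qed.

(* Indicators of such events are bounded limits of trigonometric polynomials; for balls this is
   step_limit combined with cos_halving. *)
Definition stable_event B := measurable B /\ forall V, trig_orth V -> trig_orth (fun w => V w * \1_B w).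

Lemma stable_eventT : stable_event setT.
Proof. by split => // V; apply: trig_orth_ext => w; rewrite indicT mulr1. Qed.

Lemma stable_eventI B C : stable_event B -> stable_event C -> stable_event (B `&` C).
Proof.
move=> [mB gB] [mC gC]; split; first exact: measurableI.
by move=> V /gB /gC; apply: trig_orth_ext => w; rewrite indicI /= mulrA.
Qed.

Lemma stable_eventC B : stable_event B -> stable_event (~` B).
Proof.
move=> [mB gB]; split; first exact: measurableC.
move=> V oV; apply: trig_orth_ext (trig_orthB oV (gB V oV)) => w.
by rewrite !indicE in_setC; case: (w \in B); rewrite /= ?mulr1 ?mulr0 ?subrr ?subr0.
Qed.

Lemma stable_event_bigcap (F : nat -> set T) : (forall n, stable_event (F n)) -> stable_event (\bigcap_n F n).
Proof.
move=> gF.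
have gfin n : stable_event (\big[setI/setT]_(j < n) F j).
  elim: n => [|n IH]; first by rewrite big_ord0; exact: stable_eventT.
  by rewrite big_ord_recr /=; exact: stable_eventI.
split; first by apply: bigcap_measurableType => n _; have [] := gF n.
move=> V oV; have [iV _] := oV.
apply: (@trig_orth_lim V (fun n => \1_(\big[setI/setT]_(j < n) F j)) (\1_(\bigcap_n F n))) => //.
- by move=> n; apply: measurable_indic; have [] := gfin n.
- by apply: measurable_indic; apply: bigcap_measurableType => n _; have [] := gF n.
- by move=> n w; rewrite indicE; case: (_ \in _); rewrite ?normr1 ?normr0.
- move=> w; have [Fw|nFw] := pselect ((\bigcap_n F n) w).
    rewrite indicE mem_set //; apply: cvg_near_cst; apply: nearW => n.
    by rewrite indicE mem_set // -bigcap_mkord => j _; exact: Fw.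
  have [j nFj] : exists j, ~ F j w.
    by apply: contrapT => h; apply: nFw => j _; apply: contrapT => h2; apply: h; exists j.
  rewrite [X in _ --> X]indicE memNset //; apply: cvg_near_cst.
  exists j.+1 => // n /= jn; rewrite indicE memNset // -bigcap_mkord => h; exact: nFj (h j jn).
- by move=> n; have [_] := gfin n; exact.
Qed.

Lemma stable_event_sigma_algebra : sigma_algebra setT stable_event.
Proof.
split.
- by rewrite -setCT; apply: stable_eventC; exact: stable_eventT.
- by move=> B gB; rewrite setTD; exact: stable_eventC.
- move=> F gF; rewrite -(setCK (\bigcup_k F k)) setC_bigcup; apply: stable_eventC.
  by apply: stable_event_bigcap => n; exact: stable_eventC.
Qed.

Lemma stable_event_cos_gt0 i (k c : R) : D i -> stable_event [set w | 0 < cos (k * X i w + c)].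
Proof.
move=> Di.
have mB : measurable [set w | 0 < cos (k * X i w + c)].
  rewrite -[X in measurable X]setTI.
  have mc : measurable_fun setT (fun w => cos (k * X i w + c)).
    by apply: measurable_cos_fun; apply: measurable_funD => //; exact: measurable_funM.
  have := mc measurableT `]0, +oo[%classic (measurable_itv _).
  by rewrite (_ : _ @^-1` _ = [set w | 0 < cos (k * X i w + c)]) //; apply/seteqP; split => w /=; rewrite in_itv /= andbT.
split=> // V oV; have [iV _] := oV.
apply: (@trig_orth_lim V (fun n w => (1 - half_cos i k c w ^+ n) ^+ (n * 2 ^ n)%N)) => //.
- move=> n; apply: measurable_funX; apply: measurable_funB => //; apply: measurable_funX.
  exact: measurable_half_cos.
- move=> n w; have /andP[a b] := half_cosI i k c w.
  have h1 : 0 <= half_cos i k c w ^+ n <= 1 by rewrite exprn_ge0 // exprn_ile1.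
  case/andP: h1 => h0 h1; rewrite ger0_norm ?exprn_ge0 ?subr_ge0 // exprn_ile1 ?subr_ge0 //.
  by rewrite gerBl.
- move=> w; have := step_limit (half_cosI i k c w).
  rewrite indicE; set b := (_ < _); have -> : (w \in [set w | 0 < cos (k * X i w + c)]) = b.
    apply/idP/idP; rewrite inE /= /b /half_cos; lra.
  by case: b.
- by move=> n; exact: trig_orth_poly.
Qed.

Lemma stable_event_ball i (x r : R) : D i -> 0 < r -> stable_event [set w | `|X i w - x| < r].
Proof.
move=> Di r0; have pi0 := pi_gt0 R.
(* This scale maps the ball of radius [r] onto |t| < pi/2, the set that [cos_halving] describes. *)
pose a := pi / (2 * r); have a0 : 0 < a by rewrite divr_gt0 // mulr_gt0.
rewrite (_ : [set w | _] = \bigcap_j [set w | 0 < cos (a / 2 ^+ j * X i w + - (a * x / 2 ^+ j))]).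
  by apply: stable_event_bigcap => j; exact: stable_event_cos_gt0.
have key w : `|X i w - x| < r <-> `|a * (X i w - x)| < pi / 2.
  rewrite normrM (gtr0_norm a0) -ltr_pdivlMl //.
  have -> : a^-1 * (pi / 2) = r by rewrite /a invf_div mulrA divfK ?lt0r_neq0 // mulrAC divff ?mul1r.
  exact: iff_refl.
have e j w : a / 2 ^+ j * X i w + - (a * x / 2 ^+ j) = a * (X i w - x) / 2 ^+ j by ring.
apply/seteqP; split => w /=.
  by move=> /key /cos_halving h j _ /=; rewrite e.
by move=> h; apply/key/cos_halving => j; rewrite -e; exact: h.
Qed.

Lemma stable_event_preimage i (B : set R) : D i -> measurable B -> stable_event (X i @^-1` B).
Proof.
move=> Di mB.
have sG : sigma_algebra setT [set B : set R | stable_event (X i @^-1` B)].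
  have [g0 gC gU] := stable_event_sigma_algebra; split => /=.
  - by rewrite preimage_set0.
  - by move=> C /gC; rewrite !setTD.
  - by move=> F /gU; rewrite preimage_bigcup.
have : (@ocitv R).-sigma.-measurable B by exact: mB.
rewrite RGenOInfty.measurableE; apply: (smallest_sub sG).
move=> _ [x ->] /=.
(* A ray is the countable union of the balls of radius n + 1 centred at x + n + 1; rays generate the
   Borel sets. *)
rewrite (_ : X i @^-1` _ = ~` \bigcap_n (~` [set w | `|X i w - (x + n.+1%:R)| < n.+1%:R])).
  by apply: stable_eventC; apply: stable_event_bigcap => n; apply: stable_eventC; exact: stable_event_ball.
rewrite setC_bigcap; under eq_bigcupr do rewrite setCK.
apply/seteqP; split => w /=; rewrite in_itv /= andbT.
  move=> xw; exists (Num.truncn (X i w - x)) => //=.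
  have := truncnS_gt (X i w - x); set n := (_.+1)%:R => h.
  by rewrite ltr_norml; apply/andP; split; lra.
by move=> [n _] /=; rewrite ltr_norml => /andP[h _]; lra.
Qed.

(** The stable events form a sigma-algebra containing the generators. For such a [B], testing V
    restricted to [B] against the zero phase, whose cosine is 1, gives the integral over [B]. *)
Theorem trig_orth_sigma_family V B : trig_orth V -> sigma_family D X B ->
  measurable B /\ (\int[P]_(w in B) (V w)%:E = 0)%E.
Proof.
move=> oV FB.
have [mB gB] : stable_event B.
  apply: (smallest_sub stable_event_sigma_algebra _ FB).
  by move=> _ [i Di [C mC <-]]; rewrite setTI; exact: stable_event_preimage.
split=> //.
have [_ o] := gB V oV.
rewrite integral_mkcond -(o _ A0); apply: eq_integral => w _.
by rewrite /= cos0 mulr1 patchE indicE; case: ifP => _; rewrite ?mulr1 ?mulr0.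
Qed.

End TrigOrthogonal.

Lemma normM_le_sqr (R : realType) (x y : R) : `|x * y| <= x ^+ 2 / 2 + y ^+ 2 / 2.
Proof.
by have := sqr_ge0 (x - y); have := sqr_ge0 (x + y); rewrite ler_norml sqrrB sqrrD; lra.
Qed.

Lemma half_window (R : realType) (x y : R) : `|y - x| <= x / 2 -> x / 2 <= y <= 3 / 2 * x.
Proof. by rewrite ler_norml => /andP[h1 h2]; apply/andP; split; lra. Qed.

(** * Linear combinations of the Gaussian family *)

Section QuadraticForm.
Variables (R : realType) (I : eqType) (c : I -> I -> R) (K : seq I).
Hypothesis uK : uniq K.
Hypothesis csym : forall n m, c n m = c m n.
Implicit Types a b : I -> R.

Definition qform a b := \sum_(n <- K) \sum_(m <- K) a n * b m * c n m.

Lemma qformC a b : qform a b = qform b a.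
Proof.
rewrite /qform exchange_big; apply: eq_bigr => m _; apply: eq_bigr => n _.
by rewrite csym; ring.
Qed.

Lemma qform_linear a b e t : qform (fun n => a n - t * b n) e = qform a e - t * qform b e.
Proof.
rewrite /qform mulr_sumr -sumrB; apply: eq_bigr => n _.
rewrite mulr_sumr -sumrB; apply: eq_bigr => m _; ring.
Qed.

Definition unit_mass (i : I) (n : I) : R := (n == i)%:R.

Lemma sum_unit_mass i (f : I -> R) : i \in K -> \sum_(n <- K) unit_mass i n * f n = f i.
Proof.
move=> iK; rewrite (bigD1_seq i) //= big1 ?addr0; last by move=> n /negPf ni; rewrite /unit_mass ni mul0r.
by rewrite /unit_mass eqxx mul1r.
Qed.

(** Schur test: bounding a_n a_m by the mean of the squares, row sums at most 1/2 make the
    off-diagonal part at most half of the squared l^2 norm. *)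
Lemma qform_diagonally_dominant (a : I -> R) : (forall n, c n n = 1) ->
  (forall n, \sum_(m <- K | m != n) `|c n m| <= 1 / 2) ->
  \sum_(n <- K) a n ^+ 2 / 2 <= qform a a <= 3 / 2 * \sum_(n <- K) a n ^+ 2.
Proof.
move=> c1 row.
pose off n m : R := if m != n then `|c n m| else 0.
have offC n m : off n m = off m n by rewrite /off eq_sym csym.
have rowo n : \sum_(m <- K) off n m <= 1 / 2 by rewrite -big_mkcond.
have s2 n : 0 <= a n ^+ 2 / 2 by rewrite divr_ge0 // sqr_ge0.
have sumE : \sum_(n <- K) a n ^+ 2 / 2 = (\sum_(n <- K) a n ^+ 2) / 2 by rewrite mulr_suml.
have offb : \sum_(n <- K) \sum_(m <- K) (a n ^+ 2 / 2 + a m ^+ 2 / 2) * off n m <= \sum_(n <- K) a n ^+ 2 / 2.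
  have -> : \sum_(n <- K) \sum_(m <- K) (a n ^+ 2 / 2 + a m ^+ 2 / 2) * off n m =
     2 * \sum_(n <- K) \sum_(m <- K) a n ^+ 2 / 2 * off n m.
    under eq_bigr do (under eq_bigr do rewrite mulrDl; rewrite big_split /=).
    rewrite big_split /= [X in _ + X]exchange_big /= mulr_natl mulr2n; congr (_ + _).
    by apply: eq_bigr => n _; apply: eq_bigr => m _; rewrite offC.
  rewrite mulr_sumr; apply: ler_sum => n _; rewrite -mulr_sumr.
  by rewrite mulrCA ler_piMr // -ler_pdivlMl // mulr1 -div1r.
have offa : `|qform a a - \sum_(n <- K) a n ^+ 2| <= \sum_(n <- K) a n ^+ 2 / 2.
  apply: le_trans offb; rewrite /qform -sumrB; apply: le_trans (ler_norm_sum _ _ _) _.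
  rewrite [leLHS]big_seq [leRHS]big_seq; apply: ler_sum => n nK.
  rewrite (bigD1_seq n) //= c1 mulr1 -expr2 addrAC subrr add0r [leRHS](bigD1_seq n) //=.
  rewrite {1}/off eqxx mulr0 add0r; apply: le_trans (ler_norm_sum _ _ _) _; apply: ler_sum => m mn.
  by rewrite /off mn normrM ler_wpM2r // normM_le_sqr.
by move: offa; rewrite sumE; exact: half_window.
Qed.

Hypothesis lower : forall a, \sum_(n <- K) a n ^+ 2 / 2 <= qform a a.

Lemma qform_unit_mass_sum (s : seq I) a b : {subset s <= K} -> uniq s -> (forall n, n \notin s -> b n = 0) ->
  (forall i, i \in s -> qform a (unit_mass i) = 0) -> qform a b = 0.
Proof.
move=> sK us b0 orth.
have -> : qform a b = \sum_(i <- s) b i * qform a (unit_mass i).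
  transitivity (\sum_(i <- K) b i * qform a (unit_mass i)).
    rewrite /qform; under [RHS]eq_bigr do rewrite mulr_sumr.
    rewrite [RHS]exchange_big /=; apply: eq_bigr => n _.
    under [RHS]eq_bigr do rewrite mulr_sumr.
    rewrite [RHS]exchange_big /=; apply: eq_big_seq => m mK.
    rewrite (_ : \sum_(i <- K) _ = \sum_(i <- K) unit_mass m i * (b i * a n * c n m)).
      by rewrite sum_unit_mass //; ring.
    by apply: eq_bigr => i _; rewrite /unit_mass eq_sym; ring.
  apply: big_uniq_eq => // i; apply: contraNeq => h.
  rewrite b0 ?mul0r //; by apply: contraNN h => is_; rewrite is_ (sK _ is_).
by rewrite big_seq big1 // => i is_; rewrite orth // mulr0.
Qed.

(** Gram-Schmidt, one index at a time: [e] is the unit mass at [m] made orthogonal to the other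
    indices, and subtracting a multiple of it corrects [b]. *)
Lemma orthogonal_projection (s : seq I) a : {subset s <= K} -> uniq s ->
  exists b, (forall n, n \notin s -> b n = a n) /\ forall i, i \in s -> qform b (unit_mass i) = 0.
Proof.
elim: s a => [|m s IH] a sK /=; first by exists a.
move=> /andP[ms us].
have mK : m \in K by apply: sK; rewrite mem_head.
have sK' : {subset s <= K} by move=> n ns; apply: sK; rewrite inE ns orbT.
have [b [ba orthb]] := IH a sK' us.
have [e [em orthe]] := IH (unit_mass m) sK' us.
have Qe : qform e e = qform e (unit_mass m).
  have := @qform_unit_mass_sum s e (fun n => e n - 1 * unit_mass m n) sK' us.
  rewrite qformC qform_linear mul1r [qform (unit_mass m) e]qformC => h.
  by apply/eqP; rewrite -subr_eq0 h // => n ns; rewrite em // mul1r subrr.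
(* The coefficient of [e] at [m] is still 1, so the lower bound on the form makes the divisor
   positive. *)
have Qe0 : qform e e != 0.
  apply: lt0r_neq0; apply: lt_le_trans (lower e).
  rewrite (bigD1_seq m) //= em // /unit_mass eqxx expr1n ltr_wpDr ?divr_gt0 //.
  by apply: sumr_ge0 => n _; rewrite divr_ge0 // sqr_ge0.
exists (fun n => b n - qform b (unit_mass m) / qform e e * e n); split.
  move=> n; rewrite inE negb_or => /andP[nm ns].
  by rewrite ba // em // /unit_mass (negPf nm) mulr0 subr0.
move=> i; rewrite inE qform_linear => /orP[/eqP ->|is_]; last by rewrite orthb // orthe // mulr0 subr0.
by rewrite -Qe divfK // subrr.
Qed.

End QuadraticForm.

(** * The lattice covariance as a perturbation of the identity *)

Section LatticeCovariance.
Variables (R : realType) (d : nat).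

Lemma enormE (n : 'rV[int]_d) : enorm (toR R n) = Num.sqrt (sq R n).
Proof. by congr Num.sqrt; apply: eq_bigr => i _; rewrite mxE. Qed.

Lemma nsup_le_enorm (n : 'rV[int]_d) : (nsup n)%:R <= enorm (toR R n).
Proof.
rewrite enormE -(@ler_pXn2r _ 2) ?nnegrE ?sqrtr_ge0 ?ler0n // sqr_sqrtr ?sq_ge0 //.
exact: sq_ge.
Qed.

Definition lattice_cov (beta : R) (n m : 'rV[int]_d) : R := (1 + enorm (toR R (n - m)%R)) `^ (- beta).

Lemma lattice_covC beta n m : lattice_cov beta n m = lattice_cov beta m n.
Proof. by rewrite /lattice_cov !enormE -sqN opprB. Qed.

Lemma lattice_cov_diag beta n : lattice_cov beta n n = 1.
Proof.
rewrite /lattice_cov /enorm subrr big1; first by rewrite sqrtr0 addr0 powR1.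
by move=> i _; rewrite !mxE expr0n.
Qed.

(** Of the exponent [beta], d + 1 powers ensure summability; the remaining [b] give the factor
    2^(-b), since [jap] is at least 2 off the diagonal. *)
Lemma lattice_cov_le (b : nat) beta n m : m != n -> d.+1%:R + b%:R <= beta ->
  lattice_cov beta n m <= (2 ^+ b)^-1 * (jap R (m - n))^-1 ^+ d.+1.
Proof.
move=> mn hb; rewrite lattice_covC /lattice_cov; set z := (m - n)%R.
have z1 : (0 < nsup z)%N by rewrite lt0n; apply: contraNneq mn => /nsup_eq0 /eqP; rewrite subr_eq0.
have j2 : 2 <= jap R z by rewrite ler_nat.
have j0 : 0 < jap R z by exact: jap_gt0.
have le1 : jap R z <= 1 + enorm (toR R z).
  by rewrite /jap -natr1 addrC lerD2l nsup_le_enorm.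
have x0 : 0 < 1 + enorm (toR R z) by apply: lt_le_trans le1.
have p1 : 2 ^+ b * jap R z ^+ d.+1 <= (1 + enorm (toR R z)) `^ beta.
  apply: (@le_trans _ _ (jap R z `^ beta)); last first.
    apply: ge0_ler_powR => //; rewrite ?nnegrE ?(ltW j0) ?(ltW x0) //.
    by apply: le_trans hb; rewrite -natrD.
  apply: (@le_trans _ _ (jap R z `^ (d.+1%:R + b%:R))); last by rewrite ler_powR // jap_ge1.
  rewrite -natrD powR_mulrn ?(ltW j0) // exprD mulrC ler_wpM2l ?exprn_ge0 ?(ltW j0) //.
  by rewrite lerXn2r ?nnegrE // ltW.
rewrite powRN exprVn -invfM lef_pV2 ?posrE ?mulr_gt0 ?exprn_gt0 //.
exact: powR_gt0.
Qed.

Lemma sum_subset_le (K L : seq 'rV[int]_d) (g : 'rV[int]_d -> R) : uniq K -> uniq L ->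
  {subset K <= L} -> (forall n, 0 <= g n) -> \sum_(n <- K) g n <= \sum_(n <- L) g n.
Proof.
move=> uK uL sKL g0; rewrite [leRHS](bigID (fun n => n \in K)) /=.
rewrite -[leLHS]addr0 lerD //; last exact: sumr_ge0.
have -> // : \sum_(n <- L | n \in K) g n = \sum_(n <- K) g n.
rewrite -big_filter; apply: perm_big.
apply: uniq_perm => //; first exact: filter_uniq.
move=> n; rewrite mem_filter; by case nK: (n \in K) => //=; rewrite (sKL _ nK).
Qed.

Lemma lattice_cov_qform_bounds : exists2 beta_d : R, d%:R < beta_d & forall beta, beta_d <= beta ->
  forall (K : seq 'rV[int]_d) (a : 'rV[int]_d -> R), uniq K ->
  \sum_(n <- K) a n ^+ 2 / 2 <= qform (lattice_cov beta) K a a <= 3 / 2 * \sum_(n <- K) a n ^+ 2.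
Proof.
have [Cs Cs0 sCs] := sum_jap R d.
(* Row sums are at most Cs / 2^b, and 2 Cs < b <= 2^b makes them at most 1/2. This fixes
   [beta_d]. *)
have [b hb] : exists b : nat, 2 * Cs < b%:R.
  exists (Num.truncn (2 * Cs)).+1; exact: truncnS_gt.
exists (d.+1%:R + b%:R); first by rewrite -natrD ltr_nat ltnS leq_addr.
move=> beta hbeta K a uK; apply: (qform_diagonally_dominant uK) => [n m|n|n].
- exact: lattice_covC.
- exact: lattice_cov_diag.
pose g (z : 'rV[int]_d) : R := (2 ^+ b)^-1 * (jap R z)^-1 ^+ d.+1.
have g0 z : 0 <= g z.
  by rewrite mulr_ge0 ?invr_ge0 ?exprn_ge0 ?invr_ge0 // ltW // jap_gt0.
have [N KN] : exists N, {subset K <= box d N}.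
  exists (\max_(m <- K) nsup m)%N => m mK; rewrite mem_box; exact: leq_bigmax_seq.
have b0 : 0 < (b%:R : R) by apply: le_lt_trans hb; rewrite mulr_ge0 // ltW.
apply: (@le_trans _ _ (\sum_(m <- K) g (m - n))).
  rewrite big_mkcond /=; apply: ler_sum => m _; case: ifP => // mn.
  by rewrite ger0_norm ?powR_ge0 // lattice_cov_le.
apply: le_trans (sum_subset_le uK (box_uniq d N) KN _) _; first by move=> m; exact: g0.
apply: le_trans (@box_shift_le R d g (- n) N (N + nsup n) g0 _) _; first by rewrite nsupN.
rewrite -mulr_sumr.
have h := sCs 0%N (N + nsup n)%N; rewrite divr1 in h.
apply: (@le_trans _ _ ((2 ^+ b)^-1 * Cs)).
  by rewrite ler_wpM2l ?invr_ge0 ?exprn_ge0.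
have b2 : b%:R <= 2 ^+ b :> R by rewrite -natrX ler_nat ltnW // ltn_expl.
rewrite ler_pdivrMl ?exprn_gt0 //; lra.
Qed.

End LatticeCovariance.

Section SquareIntegrable.
Context d (T : measurableType d) (R : realType) (P : probability T R).
Implicit Types f g h : T -> R.

Definition sqint f := measurable_fun setT f /\ (\int[P]_w (f w ^+ 2)%:E < +oo)%E.

Lemma sqint_sqr f : sqint f -> P.-integrable setT (fun w => (f w ^+ 2)%:E).
Proof.
move=> [mf fin]; apply/integrableP; split.
  by apply/measurable_EFinP; exact: measurable_funX.
by under eq_integral do rewrite gee0_abs ?lee_fin ?sqr_ge0 //.
Qed.

Lemma sqint_mul f g : sqint f -> sqint g -> P.-integrable setT (fun w => (f w * g w)%:E).
Proof.
move=> sf sg; have [mf _] := sf; have [mg _] := sg.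
apply: (le_integrable measurableT _ _ (integrableD measurableT (sqint_sqr sf) (sqint_sqr sg))).
  by apply/measurable_EFinP; exact: measurable_funM.
move=> w _ /=; rewrite lee_fin (ger0_norm (addr_ge0 (sqr_ge0 _) (sqr_ge0 _))).
apply: le_trans (normM_le_sqr _ _) _.
by have := sqr_ge0 (f w); have := sqr_ge0 (g w); lra.
Qed.

Lemma sqint_le f h : measurable_fun setT f -> P.-integrable setT (EFin \o h) ->
  (forall w, f w ^+ 2 <= h w) -> sqint f.
Proof.
move=> mf ih fh; split=> //.
have : P.-integrable setT (fun w => (f w ^+ 2)%:E).
  apply: (le_integrable measurableT _ _ ih); first by apply/measurable_EFinP; exact: measurable_funX.
  move=> w _ /=; rewrite lee_fin ger0_norm ?sqr_ge0 //.
  by apply: le_trans (fh w) _; exact: ler_norm.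
move=> /integrableP[_]; under eq_integral do rewrite gee0_abs ?lee_fin ?sqr_ge0 //.
by [].
Qed.

Lemma sqint_cst k : sqint (cst k).
Proof.
by apply: (@sqint_le _ (cst (k ^+ 2))) => //; exact: finite_measure_integrable_cst.
Qed.

Lemma sqint_integrable f : sqint f -> P.-integrable setT (EFin \o f).
Proof.
move=> sf; have := sqint_mul sf (sqint_cst 1).
by apply: eq_integrable => // w _ /=; rewrite mulr1.
Qed.

Lemma sqintZ k f : sqint f -> sqint (fun w => k * f w).
Proof.
move=> sf; have [mf _] := sf.
apply: (@sqint_le _ (fun w => k ^+ 2 * f w ^+ 2)); first exact: measurable_funM.
  exact: (integrableZl measurableT (k ^+ 2) (sqint_sqr sf)).
by move=> w; rewrite exprMn.
Qed.

Lemma sqintD f g : sqint f -> sqint g -> sqint (fun w => f w + g w).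
Proof.
move=> sf sg; have [mf _] := sf; have [mg _] := sg.
apply: (@sqint_le _ (fun w => 2 * f w ^+ 2 + 2 * g w ^+ 2)); first exact: measurable_funD.
  exact: (integrableD measurableT (integrableZl measurableT 2 (sqint_sqr sf)) (integrableZl measurableT 2 (sqint_sqr sg))).
by move=> w; exact: sqrD_le.
Qed.

Lemma sqintB f g : sqint f -> sqint g -> sqint (fun w => f w - g w).
Proof.
move=> sf sg; have := sqintD sf (sqintZ (-1) sg).
by congr sqint; apply/funext => w; rewrite mulN1r.
Qed.

Lemma sqint_sum (I : Type) (s : seq I) (F : I -> T -> R) : (forall i, sqint (F i)) ->
  sqint (fun w => \sum_(i <- s) F i w).
Proof.
move=> sF; elim: s => [|i s IH].
  by under eq_fun do rewrite big_nil; exact: (sqint_cst 0).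
by under eq_fun do rewrite big_cons; exact: sqintD.
Qed.

Definition ip f g : R := fine (\int[P]_w (f w * g w)%:E).

Lemma ipE f g : sqint f -> sqint g -> (\int[P]_w (f w * g w)%:E)%E = (ip f g)%:E.
Proof. by move=> sf sg; rewrite fineK //; apply: integrable_fin_num => //; exact: sqint_mul. Qed.

Lemma ipC f g : ip f g = ip g f.
Proof. by congr fine; apply: eq_integral => w _; rewrite mulrC. Qed.

Lemma ipDl f g h : sqint f -> sqint g -> sqint h -> ip (fun w => f w + g w) h = ip f h + ip g h.
Proof.
move=> sf sg sh; rewrite /ip; under eq_integral do rewrite mulrDl EFinD.
have i1 := sqint_mul sf sh; have i2 := sqint_mul sg sh.
by rewrite integralD // fineD //; exact: integrable_fin_num.
Qed.

Lemma ipZl k f h : sqint f -> sqint h -> ip (fun w => k * f w) h = k * ip f h.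
Proof.
move=> sf sh; rewrite /ip; under eq_integral do rewrite -mulrA EFinM.
rewrite integralZl ?fineM //; try apply: integrable_fin_num => //; exact: sqint_mul.
Qed.

Lemma ip_suml (I : Type) (s : seq I) (a : I -> R) (F : I -> T -> R) h : (forall i, sqint (F i)) -> sqint h ->
  ip (fun w => \sum_(i <- s) a i * F i w) h = \sum_(i <- s) a i * ip (F i) h.
Proof.
move=> sF sh; elim: s => [|i s IH].
  rewrite big_nil /ip; under eq_integral do rewrite big_nil mul0r.
  by rewrite integral0.
rewrite big_cons -IH -ipZl // -ipDl //; first by congr ip; apply/funext => w; rewrite big_cons.
  exact: sqintZ.
by apply: sqint_sum => j; exact: sqintZ.
Qed.

End SquareIntegrable.

Section SinLimit.
Variable R : realType.

Lemma sin_mean_value (y : R) : exists c, `|c| <= `|y| /\ sin y = cos c * y.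
Proof.
wlog y0 : y / 0 <= y.
  move=> h; have [/h //|/ltW y0] := leP 0 y.
  have ny : 0 <= - y by rewrite oppr_ge0.
  have [c [cy e]] := h (- y) ny.
  by exists c; split; [by rewrite -[`|y|]normrN|move: e; rewrite sinN mulrN => /oppr_inj].
have [c cI e] := @MVT_segment R sin cos 0 y y0 (fun x _ => is_derive_sin x)
  (continuous_subspaceT (@continuous_sin R)).
exists c; split; last by move: e; rewrite sin0 !subr0.
by move: cI; rewrite in_itv /= => /andP[c0 cy]; rewrite !ger0_norm.
Qed.

Lemma sin_norm_le (y : R) : `|sin y| <= `|y|.
Proof.
by have [c [_ ->]] := sin_mean_value y; rewrite normrM ler_piMl // cos_max.
Qed.

Lemma sin_quotient_cvg (y : R) : (fun n : nat => n.+1%:R * sin (n.+1%:R^-1 * y)) @ \oo --> y.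
Proof.
have [c hc] := choice (fun n : nat => sin_mean_value (n.+1%:R^-1 * y)).
have c0 : c @ \oo --> (0 : R).
  apply: norm_cvg0; apply: (@squeeze_cvgr _ _ _ _ (fun=> 0) (fun n => n.+1%:R^-1 * `|y|)).
  - apply: nearW => n; rewrite normr_ge0 /=; have [+ _] := hc n.
    by rewrite normrM ger0_norm ?invr_ge0.
  - exact: cvg_cst.
  - by rewrite -(mul0r `|y|); apply: cvgM; [exact: cvg_harmonic|exact: cvg_cst].
rewrite (_ : (fun n => _) = (fun n => cos (c n) * y)); last first.
  by apply/funext => n; have [_ ->] := hc n; rewrite mulrCA mulVKf.
rewrite -[X in _ --> X]mul1r; apply: cvgM; last exact: cvg_cst.
by rewrite -(@cos0 R); apply: (cvg_comp _ _ c0); exact: continuous_cos.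
Qed.

End SinLimit.

Section SameLaw.
Context d (T : measurableType d) (R : realType) (P : probability T R).
Implicit Types X Y : T -> R.

Lemma same_law_expectation X Y (g : R -> R) : measurable_fun setT X -> measurable_fun setT Y ->
  (forall A : set R, measurable A -> P (X @^-1` A) = P (Y @^-1` A)) ->
  measurable_fun setT g -> (forall x, 0 <= g x) ->
  (\int[P]_w (g (X w))%:E = \int[P]_w (g (Y w))%:E)%E.
Proof.
move=> mX mY law mg g0.
have mY' := measurable_funTR mY.
pose mixin := isMeasurableFun.Build _ _ _ _ _ mY'.
pose Y' : {mfun T >-> measurableTypeR R} := HB.pack (Y : T -> measurableTypeR R) mixin.
have mEg : measurable_fun setT (EFin \o g) by apply/measurable_EFinP.
have pg x : (0 <= (EFin \o g) x)%E by rewrite lee_fin.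
rewrite (@gaussian_expectation _ _ _ P X (distribution P Y') (EFin \o g) mX law mEg pg).
by rewrite (@gaussian_expectation _ _ _ P Y (distribution P Y') (EFin \o g) mY _ mEg pg).
Qed.

Lemma integrable_bounded (f : T -> R) : measurable_fun setT f -> (forall w, `|f w| <= 1) ->
  P.-integrable setT (EFin \o f).
Proof.
move=> mf f1; apply: (le_integrable measurableT _ _ (finite_measure_integrable_cst P 1 measurableT)).
  exact/measurable_EFinP.
by move=> w _ /=; rewrite lee_fin normr1.
Qed.

Lemma same_law_cos X Y (c0 : R) : measurable_fun setT X -> measurable_fun setT Y ->
  (forall A : set R, measurable A -> P (X @^-1` A) = P (Y @^-1` A)) ->
  (\int[P]_w (cos (X w + c0))%:E = \int[P]_w (cos (Y w + c0))%:E)%E.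
Proof.
move=> mX mY law.
have mc (Z : T -> R) : measurable_fun setT Z -> P.-integrable setT (EFin \o (fun w => cos (Z w + c0))).
  move=> mZ; apply: integrable_bounded; last by move=> w; exact: cos_max.
  by apply: (@measurable_cos_fun _ _ _ (fun w => Z w + c0)); exact: measurable_funD.
(* Adding 1 makes the cosine nonnegative, so that [same_law_expectation] applies. *)
have split_int (Z : T -> R) : measurable_fun setT Z ->
    (\int[P]_w (cos (Z w + c0) + 1)%:E = \int[P]_w (cos (Z w + c0))%:E + 1)%E.
  move=> mZ; under eq_integral do rewrite EFinD.
  rewrite integralD //; [|exact: mc|exact: finite_measure_integrable_cst].
  by congr (_ + _)%E; have := expectation_cst P 1; rewrite unlock.
have := @same_law_expectation X Y (fun x => cos (x + c0) + 1) mX mY law.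
rewrite !split_int // => h.
suff : (\int[P]_w (cos (X w + c0))%:E + 1 = \int[P]_w (cos (Y w + c0))%:E + 1)%E.
  move/(congr1 (fun x => x - 1)%E); rewrite !addeK //.
apply: h.
  apply: measurable_funD => //; apply: measurableT_comp; last exact: measurable_funD.
  exact: continuous_measurable_fun (@continuous_cos R).
by move=> x; have := cos_max (x + c0); rewrite ler_norml => /andP[? _]; lra.
Qed.

End SameLaw.

Lemma max_sqr_le (R : realType) (x : R) : Num.max x 0 ^+ 2 <= x ^+ 2.
Proof. by rewrite maxEle; case: ifP => // _; rewrite expr0n sqr_ge0. Qed.

(** * From indicators to square integrable variables *)

Section Stairs.
Context d (T : measurableType d) (R : realType) (P : probability T R).
Variables (F : set (set T)) (V : T -> R).
Hypothesis sV : sqint P V.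
Hypothesis F0 : forall A, F A -> measurable A /\ (\int[P]_(w in A) (V w)%:E = 0)%E.

(** For f >= 0, [f] rounded down to a multiple of 1/(n + 1) and capped at n + 1. Written with
    indicators of the positive level sets, which lie in the sigma-algebra. *)
Definition stairs (f : T -> R) (n : nat) (w : T) : R :=
  \sum_(j < n.+1 ^ 2) n.+1%:R^-1 * \1_[set w | j.+1%:R <= n.+1%:R * f w] w.

Lemma stairsE f n w : 0 <= f w ->
  stairs f n w = (minn (n.+1 ^ 2) (Num.truncn (n.+1%:R * f w)))%:R / n.+1%:R.
Proof.
move=> f0; have nf : 0 <= n.+1%:R * f w by rewrite mulr_ge0.
rewrite /stairs -mulr_sumr mulrC; congr (_ / _).
under eq_bigr => j _.
  rewrite indicE (_ : (w \in _) = (j < Num.truncn (n.+1%:R * f w))%N); last first.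
    apply/idP/idP; rewrite inE /= => h; first by rewrite truncn_ge_nat.
    by rewrite -truncn_ge_nat.
  over.
rewrite -natr_sum; congr (_%:R); move: (Num.truncn _) => m.
elim: (n.+1 ^ 2)%N => [|k IH]; first by rewrite big_ord0 min0n.
by rewrite big_ord_recr /= IH; case: ltnP; lia.
Qed.

Lemma stairs_bounds f n w : 0 <= f w -> 0 <= stairs f n w <= f w.
Proof.
move=> f0; rewrite stairsE // divr_ge0 //= ler_pdivrMr // [leRHS]mulrC.
have nf : 0 <= n.+1%:R * f w by rewrite mulr_ge0.
have := truncn_le (n.+1%:R * f w); rewrite nf => h; apply: le_trans h.
by rewrite ler_nat geq_minr.
Qed.

Lemma stairs_cvg f w : 0 <= f w -> stairs f ^~ w @ \oo --> f w.
Proof.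
move=> f0.
have lo (n : nat) : f w <= n.+1%:R -> f w - n.+1%:R^-1 <= stairs f n w.
  move=> fn; rewrite stairsE //.
  have nf : 0 <= n.+1%:R * f w by rewrite mulr_ge0.
  have -> : minn (n.+1 ^ 2) (Num.truncn (n.+1%:R * f w)) = Num.truncn (n.+1%:R * f w).
    apply/minn_idPr; rewrite -(ler_nat R).
    have := truncn_le (n.+1%:R * f w); rewrite nf => h; apply: le_trans h _.
    by rewrite natrX expr2 ler_wpM2l.
  rewrite ler_pdivlMr // mulrBl mulVf // mulrC lerBlDr natr1.
  exact: ltW (truncnS_gt _).
apply: (@squeeze_cvgr _ _ _ _ (fun n : nat => f w - n.+1%:R^-1) (fun=> f w)).
- exists (Num.truncn (f w)) => // n /= hn.
  have /andP[_ ->] := stairs_bounds n f0; rewrite andbT; apply: lo.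
  by apply: ltW; apply: lt_le_trans (truncnS_gt _) _; rewrite ler_nat ltnS.
- rewrite -[X in _ --> X]subr0; apply: cvgB; [exact: cvg_cst|exact: cvg_harmonic].
- exact: cvg_cst.
Qed.

Lemma integral_stairs_limit f : sqint P f -> (forall w, 0 <= f w) ->
  (forall r, 0 < r -> F [set w | r <= f w]) -> (\int[P]_w (V w * f w)%:E = 0)%E.
Proof.
move=> sf f0 Ff; have [mV _] := sV; have [mf _] := sf.
have FA n (j : nat) : F [set w | j.+1%:R <= n.+1%:R * f w].
  rewrite (_ : [set w | _] = [set w | j.+1%:R / n.+1%:R <= f w]).
    by apply: Ff; rewrite divr_gt0.
  by apply/seteqP; split => w /=; rewrite ler_pdivrMr // mulrC.
have iV := sqint_integrable sV.
have zero n : (\int[P]_w (V w * stairs f n w)%:E = 0)%E.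
  under eq_integral do rewrite /stairs mulr_sumr -sumEFin.
  rewrite integral_sum //.
    rewrite big1 // => j _; have [mA vA] := F0 (FA n j).
    under eq_integral do rewrite mulrCA EFinM.
    rewrite integralZl //; last first.
      by apply: integrable_mul_bounded => // w; rewrite indicE; case: (_ \in _); rewrite ?normr1 ?normr0.
    rewrite (_ : (\int[P]_w _)%E = 0%E) ?mule0 // -vA [RHS]integral_mkcond.
    by apply: eq_integral => w _; rewrite patchE indicE; case: ifP => _; rewrite ?mulr1 ?mulr0.
  move=> j; have [mA _] := F0 (FA n j).
  apply: (eq_integrable measurableT (fun w => (n.+1%:R^-1)%:E * (V w * \1_[set w | j.+1%:R <= n.+1%:R * f w] w)%:E)%E).
    by move=> w _; rewrite -EFinM mulrCA.
  apply: integrableZl => //.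
  by apply: integrable_mul_bounded => // w; rewrite indicE; case: (_ \in _); rewrite ?normr1 ?normr0.
have ms n : measurable_fun setT (stairs f n).
  rewrite /stairs; apply: measurable_sum => j; apply: measurable_funM => //.
  by apply: measurable_indic; have [] := F0 (FA n j).
have [||||//| _ _ lim] := @dominated_convergence _ T R P setT measurableT
    (fun n w => (V w * stairs f n w)%:E) (fun w => (V w * f w)%:E) (fun w => `|(V w * f w)%:E|%E).
- by move=> n; apply/measurable_EFinP; exact: measurable_funM.
- by apply/measurable_EFinP; exact: measurable_funM.
- apply: aeW => w _; apply: cvg_EFin; first by apply: nearW.
  by apply: cvgM; [exact: cvg_cst|exact: stairs_cvg].
- exact: integrable_abse (sqint_mul sV sf).
- apply: aeW => w n _ /=; rewrite lee_fin !normrM ler_wpM2l //.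
  by have /andP[a b] := stairs_bounds n (f0 w); rewrite !ger0_norm.
apply: esym; apply: (cvg_unique _ _ lim) => //.
by rewrite (_ : (fun n => _) = (fun=> 0%E)); [exact: cvg_cst|apply/funext => n; rewrite /= zero].
Qed.

(** The positive and negative parts of [Y] have all positive level sets in [F]; their staircases are
    orthogonal to [V] term by term, and dominated convergence with majorant |V f|, for [f] either
    part, concludes. *)
Lemma integral_mul_eq0 Y : sqint P Y -> preimage_set_system setT Y measurable `<=` F ->
  (\int[P]_w (V w * Y w)%:E = 0)%E.
Proof.
move=> sY YF; have [mY _] := sY.
have FY (B : set R) : measurable B -> F (Y @^-1` B).
  by move=> mB; apply: YF; exists B => //; rewrite setTI.
pose Yp w := Num.max (Y w) 0; pose Yn w := Num.max (- Y w) 0.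
have sp : sqint P Yp.
  apply: (@sqint_le _ _ _ _ _ (fun w => Y w ^+ 2)); [exact: measurable_maxr|exact: sqint_sqr|].
  by move=> w; exact: max_sqr_le.
have sn : sqint P Yn.
  apply: (@sqint_le _ _ _ _ _ (fun w => Y w ^+ 2)); [|exact: sqint_sqr|].
    by apply: measurable_maxr => //; exact: measurable_funN.
  by move=> w; rewrite -[Y w ^+ 2]sqrrN; exact: max_sqr_le.
have e w : (V w * Y w)%:E = ((V w * Yp w)%:E - (V w * Yn w)%:E)%E.
  rewrite -EFinB -mulrBr; congr ((_ * _)%:E); rewrite /Yp /Yn.
  by case: (leP (Y w) 0); case: (leP (- Y w) 0) => a b; lra.
under eq_integral do rewrite e.
rewrite integralB //; [|exact: sqint_mul|exact: sqint_mul].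
rewrite !integral_stairs_limit ?subee // => [w|r r0|w|r r0].
- by rewrite /Yn le_max lexx orbT.
- rewrite (_ : [set w | _] = Y @^-1` `]-oo, - r]%classic); first exact: FY.
  apply/seteqP; split => w /=; rewrite /Yn in_itv /=; case: (leP (- Y w) 0); lra.
- by rewrite /Yp le_max lexx orbT.
- rewrite (_ : [set w | _] = Y @^-1` `[r, +oo[%classic); first exact: FY.
  apply/seteqP; split => w /=; rewrite /Yp in_itv /= andbT; case: (leP (Y w) 0); lra.
Qed.

End Stairs.

(** * Orthogonal Gaussian components and the residual *)

Section GaussianSpace.
Context disp (T : measurableType disp) (R : realType) (P : probability T R).
Variables (I : eqType) (X : I -> T -> R) (c : I -> I -> R) (K : seq I).
Hypothesis jg : jointly_gaussian P X.
Hypothesis sX : forall n, sqint P (X n).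
Hypothesis EX : forall n, (\int[P]_w (X n w)%:E = 0)%E.
Hypothesis covX : forall n m, ip P (X n) (X m) = c n m.
Hypothesis uK : uniq K.
Hypothesis lower : forall a : I -> R, \sum_(n <- K) a n ^+ 2 / 2 <= qform c K a a.
Implicit Types (a b e : I -> R) (Y : T -> R).

Definition lin a (w : T) : R := \sum_(n <- K) a n * X n w.

Lemma cov_sym n m : c n m = c m n. Proof. by rewrite -!covX ipC. Qed.

Lemma lin_sqint a : sqint P (lin a).
Proof. by apply: sqint_sum => n; exact: sqintZ. Qed.

Lemma lin_mean0 a : (\int[P]_w (lin a w)%:E = 0)%E.
Proof.
under eq_integral do rewrite /lin -sumEFin.
rewrite integral_sum // => [|n]; last exact: sqint_integrable (sqintZ _ (sX n)).
rewrite big1 // => n _; under eq_integral do rewrite EFinM.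
by rewrite integralZl ?EX ?mule0 //; exact: sqint_integrable.
Qed.

Lemma ip_lin a b : ip P (lin a) (lin b) = qform c K a b.
Proof.
rewrite (ip_suml K a sX (lin_sqint b)) /qform; apply: eq_bigr => n _.
rewrite ipC (ip_suml K b sX (sX n)) mulr_sumr; apply: eq_bigr => m _.
by rewrite covX cov_sym; ring.
Qed.

Lemma linD a b t w : lin a w + t * lin b w = lin (fun n => a n + t * b n) w.
Proof. by rewrite /lin mulr_sumr -big_split; apply: eq_bigr => n _ /=; ring. Qed.

(** Both are centred Gaussian, and orthogonality gives them the same variance, the sum of the two
    quadratic forms; a centred Gaussian law is determined by its variance. *)
Lemma lin_same_law a b : qform c K a b = 0 -> forall A : set R, measurable A ->
  P ((fun w => lin a w + lin b w) @^-1` A) = P ((fun w => lin a w - lin b w) @^-1` A).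
Proof.
move=> ab0.
have eD : (fun w => lin a w + lin b w) = lin (fun n => a n + 1 * b n).
  by apply/funext => w; rewrite -linD mul1r.
have eB : (fun w => lin a w - lin b w) = lin (fun n => a n + -1 * b n).
  by apply/funext => w; rewrite -linD mulN1r.
have g e : is_gaussian P (lin e) by exact: jg.
have m e : measurable_fun setT (lin e) by have [] := lin_sqint e.
rewrite eD eB; apply: gaussian_law_eq => //; try exact: sqint_integrable (lin_sqint _).
- exact: lin_mean0.
- exact: lin_mean0.
- by have [] := lin_sqint (fun n => a n + 1 * b n).
under eq_integral do rewrite expr2; under [RHS]eq_integral do rewrite expr2.
rewrite !(ipE (lin_sqint _) (lin_sqint _)) !ip_lin; congr (_%:E).
have fl e1 e2 t e3 : qform c K (fun n => e1 n + t * e2 n) e3 = qform c K e1 e3 + t * qform c K e2 e3.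
  have := qform_linear c K e1 e2 e3 (- t); rewrite mulNr opprK => <-.
  by congr qform; apply/funext => n; ring.
have fr e1 e2 t e3 : qform c K e3 (fun n => e1 n + t * e2 n) = qform c K e3 e1 + t * qform c K e3 e2.
  by rewrite (qformC K cov_sym) fl !(qformC K cov_sym e3).
rewrite !fl !fr ab0 (qformC K cov_sym b a) ab0; ring.
Qed.

(* The integral of sin (t * lin b) * cos (lin a + c0) is half the difference of two cosine
   expectations, equal by lin_same_law; divide by t and let t go to 0. *)
Lemma lin_cos_orthogonal a b (c0 : R) : qform c K a b = 0 ->
  (\int[P]_w (lin b w * cos (lin a w + c0))%:E = 0)%E.
Proof.
move=> ab0.
have ma := (lin_sqint a).1; have mb := (lin_sqint b).1.
have mcosL : measurable_fun setT (fun w => cos (lin a w + c0)).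
  by apply: (@measurable_cos_fun _ _ _ (fun w => lin a w + c0)); exact: measurable_funD.
have msin t : measurable_fun setT (fun w => sin (t * lin b w)).
  apply: measurableT_comp; first exact: continuous_measurable_fun (@continuous_sin R).
  exact: measurable_funM.
have small t : (\int[P]_w (sin (t * lin b w) * cos (lin a w + c0))%:E = 0)%E.
  have tb w : t * lin b w = lin (fun n => t * b n) w.
    by rewrite /lin mulr_sumr; apply: eq_bigr => n _; rewrite mulrA.
  have ab1 : qform c K a (fun n => t * b n) = 0.
    transitivity (t * qform c K a b); last by rewrite ab0 mulr0.
    rewrite /qform mulr_sumr; apply: eq_bigr => n _; rewrite mulr_sumr; apply: eq_bigr => m _; ring.
  have mS (s : R) : measurable_fun setT (fun w => lin a w + s * lin (fun n => t * b n) w).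
    by apply: measurable_funD => //; apply: measurable_funM => //; exact: (lin_sqint _).1.
  have mD : measurable_fun setT (fun w => lin a w + lin (fun n => t * b n) w).
    by apply: measurable_funD => //; exact: (lin_sqint _).1.
  have mB : measurable_fun setT (fun w => lin a w - lin (fun n => t * b n) w).
    by apply: measurable_funB => //; exact: (lin_sqint _).1.
  have := same_law_cos (c0 - pi / 2) mD mB (lin_same_law ab1).
  have icos (S : T -> R) : measurable_fun setT S -> P.-integrable setT (EFin \o (fun w => cos (S w + (c0 - pi / 2)))).
    move=> m; apply: integrable_bounded => [|w]; last exact: cos_max.
    by apply: (@measurable_cos_fun _ _ _ (fun w => S w + (c0 - pi / 2))); exact: measurable_funD.
  move=> e.
  rewrite (_ : (\int[P]_w _)%E = (\int[P]_w (2^-1%:E * ((cos (lin a w + lin (fun n => (t * b n)%R) w + (c0 - pi / 2)))%:E -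
     (cos (lin a w - lin (fun n => (t * b n)%R) w + (c0 - pi / 2)))%:E)))%E); last first.
    apply: eq_integral => w _; rewrite -EFinB -EFinM tb; congr (_%:E).
    move: (lin a w) (lin _ w) => x y.
    have -> : x + y + (c0 - pi / 2) = (x + c0 - pi / 2) + y by ring.
    have -> : x - y + (c0 - pi / 2) = (x + c0 - pi / 2) - y by ring.
    rewrite (cosD (x + c0 - pi / 2) y) (cosB (x + c0 - pi / 2) y).
    have -> : sin (x + c0 - pi / 2) = - cos (x + c0) by rewrite sinB cos_pihalf sin_pihalf; ring.
    by move: (cos (x + c0)) (cos (x + c0 - pi / 2)) => u v; field.
  rewrite integralZl //; last exact: integrableB (icos _ mD) (icos _ mB).
  by rewrite integralB ?e ?subee ?mule0 //; [exact: integrable_fin_num (icos _ mB)|exact: icos|exact: icos].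
pose f (n : nat) w := n.+1%:R * sin (n.+1%:R^-1 * lin b w).
have zero n : (\int[P]_w (f n w * cos (lin a w + c0))%:E = 0)%E.
  under eq_integral do rewrite /f -mulrA EFinM.
  rewrite integralZl ?small ?mule0 //.
  apply: (integrable_mul_bounded (V := fun w => sin (n.+1%:R^-1 * lin b w))) => // [|w]; last exact: cos_max.
  by apply: integrable_bounded => // w; exact: sin_max.
have ib := sqint_integrable (lin_sqint b).
have [||||//| _ _ lim] := @dominated_convergence _ T R P setT measurableT
    (fun n w => (f n w * cos (lin a w + c0))%:E) (fun w => (lin b w * cos (lin a w + c0))%:E)
    (fun w => `|(lin b w)%:E|%E).
- by move=> n; apply/measurable_EFinP; apply: measurable_funM => //; exact: measurable_funM.
- by apply/measurable_EFinP; exact: measurable_funM.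
- apply: aeW => w _; apply: cvg_EFin; first by apply: nearW.
  by apply: cvgM; [exact: sin_quotient_cvg|exact: cvg_cst].
- exact: integrable_abse ib.
- apply: aeW => w n _ /=; rewrite lee_fin normrM -[leRHS]mulr1; apply: ler_pM => //; last exact: cos_max.
  rewrite /f normrM ger0_norm // -ler_pdivlMl //; apply: le_trans (sin_norm_le _) _.
  by rewrite normrM ger0_norm // invr_ge0.
apply: esym; apply: (cvg_unique _ _ lim) => //.
by rewrite (_ : (fun n => _) = (fun=> 0%E)); [exact: cvg_cst|apply/funext => n; rewrite /= zero].
Qed.

Variable B : pred I.
Let s := [seq n <- K | B n].
Let A : set (T -> R) := [set S | exists a (c0 : R),
  (forall n, n \notin s -> a n = 0) /\ S = (fun w => lin a w + c0)].
Hypothesis BK : forall n, B n -> n \in K.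

Lemma lin_trig_orth b : (forall n, n \in s -> qform c K b (unit_mass R n) = 0) -> trig_orth P A (lin b).
Proof.
move=> orth; split; first exact: sqint_integrable (lin_sqint b).
move=> S [a [c0 [a0 ->]]]; apply: lin_cos_orthogonal.
rewrite (qformC K cov_sym); apply: (qform_unit_mass_sum uK _ _ a0 orth) => //.
- by move=> n; rewrite mem_filter => /andP[].
- exact: filter_uniq.
Qed.

Lemma lin_orthogonal b Y : (forall n, n \in s -> qform c K b (unit_mass R n) = 0) ->
  sqint P Y -> preimage_set_system setT Y measurable `<=` sigma_family [set n | B n] X ->
  (\int[P]_w (lin b w * Y w)%:E = 0)%E.
Proof.
move=> orth sY YF.
apply: (@integral_mul_eq0 _ _ _ _ (sigma_family [set n | B n] X)) => //; first exact: lin_sqint.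
move=> E FE; apply: (@trig_orth_sigma_family _ _ _ _ _ [set n | B n] X A) => //.
- by move=> n; have [] := sX n.
- move=> S [a [c0 [_ ->]]]; apply: measurable_funD => //; exact: (lin_sqint a).1.
- exists (fun=> 0), 0; split=> //; apply/funext => w.
  by rewrite /lin big1 ?addr0 // => n _; rewrite mul0r.
- move=> S i k c1 [a [c0 [a0 ->]]] /= Bi.
  have iK := BK Bi.
  exists (fun n => a n + k * unit_mass R i n), (c0 + c1); split.
    move=> n ns; rewrite a0 // add0r /unit_mass; case: eqP => [ni|_]; last by rewrite mulr0.
    by move: ns; rewrite ni mem_filter Bi iK.
  apply/funext => w; rewrite -linD.
  have -> : lin (unit_mass R i) w = X i w by exact: sum_unit_mass.
  ring.
- exact: lin_trig_orth.
Qed.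

(* Writing a = b + e with b orthogonal to the coordinates in B, the variable lin b is orthogonal
   both to lin e and to Y. *)
Lemma residual_lower_bound a Y : measurable_fun setT Y ->
  preimage_set_system setT Y measurable `<=` sigma_family [set n | B n] X ->
  ((\sum_(n <- K | ~~ B n) a n ^+ 2 / 2)%:E <= \int[P]_w ((lin a w - Y w) ^+ 2)%:E)%E.
Proof.
move=> mY YF.
(* [Y] is only measurable here. An infinite distance satisfies the bound trivially, and a finite one
   makes [Y] square integrable. *)
have [->|fin] := eqVneq (\int[P]_w ((lin a w - Y w) ^+ 2)%:E)%E +oo%E; first exact: leey.
have sD : sqint P (fun w => lin a w - Y w).
  split; first by apply: measurable_funB => //; exact: (lin_sqint a).1.
  by rewrite ltey.
have sY : sqint P Y.
  have := sqintB (lin_sqint a) sD; congr sqint; apply/funext => w; ring.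
have ss : {subset s <= K} by move=> n; rewrite mem_filter => /andP[].
have us : uniq s by exact: filter_uniq.
have [b [ba orth]] := orthogonal_projection uK cov_sym lower a ss us.
pose e n := a n - b n.
have e0 n : n \notin s -> e n = 0 by move=> ns; rewrite /e ba // subrr.
have be : qform c K b e = 0 by exact: (qform_unit_mass_sum uK ss us e0 orth).
pose Z w := lin e w - Y w.
have sZ : sqint P Z by apply: sqintB => //; exact: lin_sqint.
have aE w : lin a w - Y w = lin b w + Z w.
  rewrite /Z addrA; congr (_ - _); rewrite -[lin e w]mul1r linD; apply: eq_bigr => n _.
  by congr (_ * _); rewrite /e; ring.
have DZ : (\int[P]_w (lin b w * Z w)%:E = 0)%E.
  under eq_integral do rewrite /Z mulrBr EFinB.
  rewrite integralB //; [|exact: sqint_mul (lin_sqint _) (lin_sqint _)|exact: sqint_mul (lin_sqint _) sY].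
  by rewrite (lin_orthogonal orth sY YF) (ipE (lin_sqint _) (lin_sqint _)) ip_lin be subee.
have iDD := sqint_sqr (lin_sqint b).
have iDZ := integrableZl measurableT 2 (sqint_mul (lin_sqint b) sZ).
apply: (@le_trans _ _ (\int[P]_w ((lin b w ^+ 2)%:E + 2%:E * (lin b w * Z w)%:E))%E).
  rewrite integralD // integralZl ?DZ ?mule0 ?adde0; [|by []|exact: sqint_mul (lin_sqint b) sZ].
  under eq_integral do rewrite expr2.
  (* Discarding the indices in [B] from the l^2 norm of [b] leaves those where [b] agrees with
     [a]. *)
  rewrite (ipE (lin_sqint _) (lin_sqint _)) ip_lin lee_fin; apply: le_trans (lower b).
  rewrite big_mkcond /=; rewrite [leLHS]big_seq [leRHS]big_seq; apply: ler_sum => n nK.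
  case: ifPn => Bn; last by rewrite divr_ge0 // sqr_ge0.
  by rewrite ba // mem_filter (negPf Bn).
have sq2 : sqint P (fun w => lin b w + Z w) by apply: sqintD => //; exact: lin_sqint.
rewrite (_ : (\int[P]_w ((lin a w - Y w) ^+ 2)%:E)%E = (\int[P]_w ((lin b w + Z w) ^+ 2)%:E)%E); last first.
  by apply: eq_integral => w _; rewrite aE.
apply: le_integral => //; first exact: integrableD.
  exact: sqint_sqr.
move=> w _; rewrite -EFinM -EFinD lee_fin -subr_ge0.
have -> : (lin b w + Z w) ^+ 2 - (lin b w ^+ 2 + 2 * (lin b w * Z w)) = Z w ^+ 2 by ring.
exact: sqr_ge0.
Qed.

End GaussianSpace.

(** * The solution as a Gaussian series *)

Section LatticeDecay.
Variables (R : realType) (d : nat).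
Implicit Types (u v : 'rV[int]_d -> R) (n : 'rV[int]_d).

Lemma decays_bounded u : decays u -> exists2 A : R, 0 <= A & forall n, `|u n| <= A.
Proof.
move=> /(_ 1 ltr01)[r ur]; pose N := (Num.truncn `|r|).+1.
exists (1 + \sum_(n <- box d N) `|u n|) => [|n].
  by rewrite addr_ge0 // sumr_ge0.
have [nN|nN] := leqP (nsup n) N.
  rewrite (big_rem n) /= ?mem_box // addrCA lerDl addr_ge0 // sumr_ge0 //.
apply: le_trans (ur n _) _; last by rewrite lerDl sumr_ge0.
apply: le_trans (nsup_le_enorm R n); apply: le_trans (ler_norm r) _.
apply: ltW; apply: lt_trans (truncnS_gt _) _.
by rewrite ltr_nat.
Qed.

Lemma grad_bounded v : decays v -> exists2 A : R, 0 <= A & forall n i, `|grad v n 0 i| <= A.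
Proof.
move=> /decays_bounded[A A0 vA]; exists (A + A) => [|n i]; first exact: addr_ge0.
by rewrite mxE; apply: le_trans (ler_normB _ _) _; apply: lerD.
Qed.

End LatticeDecay.

Section Coefficients.
Variables (R : realType) (d : nat).
Hypothesis d2 : (2 <= d)%N.
Variables (k : 'I_d) (w : 'rV[int]_d -> R) (C : R).
Hypothesis wC : is_dipole k w C.
Variable v : 'rV[int]_d -> R.
Hypothesis dv : decays v.

Let d0 : (0 < d)%N. Proof. exact: ltn_trans d2. Qed.

(** The coefficient of the Gaussian at [n] once the divergence in the equation has been moved onto
    the truncated dipole. *)
Definition coef N n : R := \sum_i grad v n 0 i * grad (fun m => w m * cutoff R N m) n 0 i.

Lemma coef_outside N n : (0 < N)%N -> (2 * d * N + 1 <= nsup n)%N -> coef N n = 0.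
Proof.
move=> N0 nN; apply: big1 => i _.
by have [e1 e2 _] := @cutoff_out R d d0 N n i N0 nN; rewrite [X in _ * X]mxE e1 e2 !mulr0 subrr mulr0.
Qed.

Lemma coef_inside N n : (nsup n < N)%N ->
  coef N n = \sum_i (w (n + basis_vec i) - w n) * grad v n 0 i.
Proof.
move=> nN; have N0 : (0 < N)%N by exact: leq_ltn_trans nN.
apply: eq_bigr => i _; rewrite mulrC [X in X * _]mxE.
rewrite !(@cutoff_eq1 R d d0 N _ N0) ?mulr1 //; first exact: ltnW.
exact: leq_trans (nsup_addb _ _) nN.
Qed.

Definition step_cst : R := C * (1 + 105 * (3 * d%:R)).

Lemma step_cst_ge0 : 0 <= step_cst.
Proof.
exact: mulr_ge0 (dipole_cst_ge0 wC)
  (addr_ge0 ler01 (mulr_ge0 (ler0n R 105) (mulr_ge0 (ler0n R 3) (ler0n R d)))).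
Qed.

(** Differencing the cutoff costs 1/N, and on its support 1/N is at most 3d / jap n; so the
    truncated dipole keeps the gradient decay of [w], uniformly in [N]. *)
Lemma dipole_cutoff_step N n i : (0 < N)%N ->
  `|grad (fun m => w m * cutoff R N m) n 0 i| <= step_cst * (jap R n)^-1 ^+ d.
Proof.
move=> N0; have C0 : 0 <= C := dipole_cst_ge0 wC.
have j0 : 0 <= (jap R n)^-1 by rewrite invr_ge0 ltW // jap_gt0.
have rhs0 : 0 <= step_cst * (jap R n)^-1 ^+ d.
  by rewrite mulr_ge0 ?exprn_ge0 // mulr_ge0 // addr_ge0.
rewrite mxE; have [nN|nN] := leqP (2 * d * N + 1) (nsup n).
  by have [-> -> _] := @cutoff_out R d d0 N n i N0 nN; rewrite !mulr0 subrr normr0.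
have [_ wb wd] := wC; have [cd _] := @cutoff_diff R d d0 N n i N0.
set a := w (n + _); set b := w n; set e := cutoff R N (n + _); set f := cutoff R N n.
have -> : a * e - b * f = (a - b) * e + b * (e - f) by ring.
apply: le_trans (ler_normD _ _) _; rewrite !normrM /step_cst mulrDr mulr1 mulrDl; apply: lerD.
  by rewrite -[leRHS]mulr1; apply: ler_pM => //; [exact: wd|exact: cutoff_norm].
have Nj : N%:R^-1 <= 3 * d%:R * (jap R n)^-1 :> R.
  rewrite ler_pdivlMr ?jap_gt0 // mulrC ler_pdivrMr ?ltr0n // /jap -!natrM ler_nat.
  by move: nN N0 d0; clear; nia.
apply: le_trans (_ : C * (jap R n)^-1 ^+ d.-1 * (105 * (3 * d%:R * (jap R n)^-1)) <= _).
  apply: ler_pM => //; first exact: wb.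
  by apply: le_trans cd _; apply: ler_wpM2l => //; exact: ler0n.
have -> : (jap R n)^-1 ^+ d = (jap R n)^-1 ^+ d.-1 * (jap R n)^-1 by rewrite -exprSr prednK.
by rewrite le_eqVlt; apply/orP; left; apply/eqP; ring.
Qed.

(** The gradient of [v] is merely bounded here, and the dipole gradient gives jap^(-2d). As 2d >= d
    + 1, the squares are summable with the tail of [sum_jap]. *)
Lemma coef_bound : exists2 A : R, 0 <= A &
  forall N n, (0 < N)%N -> coef N n ^+ 2 <= A * (jap R n)^-1 ^+ d.+1.
Proof.
have [A A0 vA] := grad_bounded dv.
have C0 : 0 <= C := dipole_cst_ge0 wC.
pose D := step_cst; have D0 : 0 <= D := step_cst_ge0.
exists ((d%:R * (A * D)) ^+ 2) => [|N n N0]; first exact: sqr_ge0.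
have j0 : 0 <= (jap R n)^-1 by rewrite invr_ge0 ltW // jap_gt0.
have j1 : (jap R n)^-1 <= 1 by rewrite invf_le1 ?jap_gt0 // jap_ge1.
apply: le_trans (_ : (d%:R * (A * D)) ^+ 2 * ((jap R n)^-1 ^+ d) ^+ 2 <= _); last first.
  apply: ler_wpM2l; first exact: sqr_ge0.
  rewrite -exprM; apply: ler_wiXn2l => //.
  by move: d2; clear; lia.
rewrite -exprMn -[leLHS]real_normK ?num_real // lerXn2r ?nnegrE //.
  by rewrite mulr_ge0 ?exprn_ge0 // mulr_ge0 ?ler0n // mulr_ge0.
apply: le_trans (ler_norm_sum _ _ _) _; rewrite -mulrA.
apply: sum_ord_le => i; rewrite normrM -mulrA; apply: ler_pM => //.
exact: dipole_cutoff_step.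
Qed.

Lemma coef_tail : exists2 A : R, 0 <= A & forall N M B, (0 < N)%N -> (N <= M)%N ->
  \sum_(n <- box d B) (coef M n - coef N n) ^+ 2 <= A / N.+1%:R.
Proof.
have [A A0 cA] := coef_bound; have [C' C'0 tail] := sum_jap R d.
exists (4 * A * C') => [|N M B N0 NM]; first by rewrite mulr_ge0 ?mulr_ge0 ?ler0n // ltW.
have M0 : (0 < M)%N by exact: leq_trans NM.
have j0 n : 0 <= (jap R n)^-1 by rewrite invr_ge0 ltW // jap_gt0.
rewrite -mulrA; apply: le_trans (_ : 4 * A * \sum_(n <- box d B | (N <= nsup n)%N) (jap R n)^-1 ^+ d.+1 <= _); last first.
  by apply: ler_wpM2l; [rewrite mulr_ge0 ?ler0n|exact: tail].
rewrite mulr_sumr [leRHS]big_mkcond; apply: ler_sum => n _; case: leqP => nN; last first.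
  by rewrite !coef_inside ?subrr ?expr0n // (leq_trans nN).
apply: le_trans (sqrD_le _ _) _; rewrite sqrrN.
have := cA _ n M0; have := cA _ n N0.
set x := coef N n ^+ 2; set y := coef M n ^+ 2; set z := _ ^+ d.+1.
by rewrite -(mulrA 4) => xz yz; lra.
Qed.

(** Deterministic, to be applied to each realisation of the field: decay of [u] enters through its
    boundedness, which makes the error of [dipole_representation] O(1/N). *)
Lemma increment_representation (g u : 'rV[int]_d -> R) :
  decaying_solution (fun n => g n *: grad v n) u ->
  (fun N => \sum_(n <- box d (2 * d * N.+1 + 1)) coef N.+1 n * g n) @ \oo --> grad u 0 0 k.
Proof.
move=> [eqn /decays_bounded[A A0 uA]].
pose B := cutoff_cst R d * C * (7 * d%:R) ^+ d * A.
have B0 : 0 <= B.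
  have h7 : 0 <= 7 * d%:R :> R := mulr_ge0 (ler0n R 7) (ler0n R d).
  exact: mulr_ge0 (mulr_ge0 (mulr_ge0 (cutoff_cst_ge0 R d) (dipole_cst_ge0 wC)) (exprn_ge0 d h7)) A0.
have err N : `|\sum_(n <- box d (2 * d * N.+1 + 1)) coef N.+1 n * g n - grad u 0 0 k| <= B * N.+1%:R^-1.
  have := dipole_representation d0 wC (ltn0Sn N) (fun n _ => uA n).
  rewrite distrC mxE add0r; congr (`|_ - _| <= _).
  have -> : \sum_(n <- box d (2 * d * N.+1 + 1)) laplacian u n * (w n * cutoff R N.+1 n) =
      - \sum_(n <- box d (2 * d * N.+1 + 1)) div (fun n => g n *: grad v n) n * (w n * cutoff R N.+1 n).
    by rewrite -sumrN; apply: eq_bigr => n _; rewrite -eqn mulNr opprK.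
  rewrite (@sum_div _ _ _ (fun n => w n * cutoff R N.+1 n) (2 * d * N.+1)); last by rewrite addn1.
    rewrite opprK; apply: eq_bigr => n _; rewrite /coef mulr_suml; apply: eq_bigr => i _.
    rewrite [X in X * _]mxE; set a := grad v n 0 i; set b := grad _ n 0 i.
    by rewrite -mulrA mulrC.
  by move=> n nN; rewrite (@cutoff_eq0 R d d0 N.+1 n) ?mulr0 // ltnW.
apply/cvgrPdist_le => e e0.
have Bcvg : (fun N : nat => B * N.+1%:R^-1) @ \oo --> (0 : R).
  by rewrite -[0](mulr0 B); apply: cvgMr; exact: cvg_harmonic.
move/cvgrPdist_le: Bcvg => /(_ e e0); apply: filterS => N.
rewrite sub0r normrN ger0_norm; last by apply: mulr_ge0 B0 _; rewrite invr_ge0.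
move=> Be.
by rewrite distrC; apply: le_trans (err N) Be.
Qed.

End Coefficients.

Section MeanSquareLimit.
Context disp (T : measurableType disp) (R : realType) (P : probability T R).

Lemma measurable_fun_limn_einf (f : nat -> T -> \bar R) :
  (forall n, measurable_fun setT (f n)) -> measurable_fun setT (fun w => limn_einf (f ^~ w)).
Proof.
move=> mf; apply: measurableT_comp => //.
by apply: measurable_fun_limn_esup => n; exact: measurableT_comp.
Qed.

(** The Gaussian sums are known to converge only almost surely to the increment; Fatou's lemma
    transfers their mean square bounds to the limit. *)
Lemma fatou_upper_bound (f : nat -> T -> R) (g : T -> R) (c : R) :
  (forall n, measurable_fun setT (f n)) -> measurable_fun setT g ->
  (forall n w, 0 <= f n w) -> (forall w, 0 <= g w) ->
  {ae P, forall w, f ^~ w @ \oo --> g w} ->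
  (forall n, \int[P]_w (f n w)%:E <= c%:E)%E -> (\int[P]_w (g w)%:E <= c%:E)%E.
Proof.
move=> mf mg f0 g0 fg fc.
have mEf n : measurable_fun setT (fun w => (f n w)%:E) by exact/measurable_EFinP.
apply: (@le_trans _ _ (\int[P]_w limn_einf (fun n => (f n w)%:E))%E).
  apply: ae_ge0_le_integral => //.
  - by move=> w _; rewrite lee_fin.
  - exact/measurable_EFinP.
  - move=> w _; rewrite limn_einf_lim; apply: lime_ge; first exact: is_cvg_einfs.
    by apply: nearW => n; apply: le_ereal_inf_tmp => _ [m _ <-]; rewrite lee_fin.
  - exact: measurable_fun_limn_einf.
  - case: fg => N [mN N0 sN]; exists N; split=> // w /= nw; apply: sN => /= cvw; apply: nw => _.
    have /cvg_limn_einf_sup[-> _] : (fun n => (f n w)%:E) @ \oo --> (g w)%:E by apply: cvg_EFin; [exact: nearW|exact: cvw].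
    by [].
apply: le_trans (@fatou _ _ _ P setT measurableT (fun n w => (f n w)%:E) mEf _) _.
  by move=> n w _; rewrite lee_fin.
rewrite limn_einf_lim; apply: lime_le; first exact: is_cvg_einfs.
apply: nearW => n; apply: le_trans (fc n); apply: ereal_inf_lbound.
by exists n => /=.
Qed.

Lemma integral_sqrD_le (f g : T -> R) : measurable_fun setT f -> measurable_fun setT g ->
  (\int[P]_w ((f w + g w) ^+ 2)%:E <=
   2%:E * \int[P]_w (f w ^+ 2)%:E + 2%:E * \int[P]_w (g w ^+ 2)%:E)%E.
Proof.
move=> mf mg.
have m2 (h : T -> R) : measurable_fun setT h -> measurable_fun setT (fun w => (h w ^+ 2)%:E).
  by move=> mh; apply/measurable_EFinP; exact: measurable_funX.
have p2 (h : T -> R) w : (0 <= (h w ^+ 2)%:E)%E by rewrite lee_fin sqr_ge0.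
have m22 (h : T -> R) : measurable_fun setT h -> measurable_fun setT (fun w => (2%:E * (h w ^+ 2)%:E)%E).
  by move=> mh; apply: emeasurable_funM => //; exact: m2.
have p22 (h : T -> R) w : (0 <= 2%:E * (h w ^+ 2)%:E)%E by rewrite mule_ge0.
rewrite -(ge0_integralZl_EFin P measurableT _ (m2 f mf)) // -(ge0_integralZl_EFin P measurableT _ (m2 g mg)) //.
rewrite -(ge0_integralD P measurableT (fun w _ => p22 f w) (m22 f mf) (fun w _ => p22 g w) (m22 g mg)).
apply: ge0_le_integral => //.
- by move=> w _; exact: (p2 (fun w => f w + g w)).
- by apply: (m2 (fun w => f w + g w)); exact: measurable_funD.
- by apply: emeasurable_funD; exact: m22.
- by move=> w _; rewrite -!EFinM -EFinD lee_fin sqrD_le.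
Qed.

End MeanSquareLimit.

Section GaussianSeries.
Context disp (T : measurableType disp) (R : realType) (P : probability T R) (d : nat).
Variables (G : 'rV[int]_d -> T -> R) (c : 'rV[int]_d -> 'rV[int]_d -> R).
Hypothesis jg : jointly_gaussian P G.
Hypothesis sG : forall n, sqint P (G n).
Hypothesis EG : forall n, (\int[P]_w (G n w)%:E = 0)%E.
Hypothesis covG : forall n m, ip P (G n) (G m) = c n m.
Hypothesis bounds : forall K a, uniq K ->
  \sum_(n <- K) a n ^+ 2 / 2 <= qform c K a a <= 3 / 2 * \sum_(n <- K) a n ^+ 2.

Variables (a : nat -> 'rV[int]_d -> R) (b : nat -> nat) (A : R) (X : T -> R).
Hypothesis b_homo : forall N M, (N <= M)%N -> (b N <= b M)%N.
Hypothesis a_supp : forall N n, (b N < nsup n)%N -> a N n = 0.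
Hypothesis a_tail : forall N M B, (N <= M)%N ->
  \sum_(n <- box d B) (a M n - a N n) ^+ 2 <= A / N.+1%:R.
Hypothesis mX : measurable_fun setT X.
Hypothesis aX : {ae P, forall w, (fun N => lin G (box d (b N)) (a N) w) @ \oo --> X w}.

Let S N := lin G (box d (b N)) (a N).

Let mS N : measurable_fun setT (S N). Proof. by have [] := lin_sqint (box d (b N)) sG (a N). Qed.

Lemma partial_sum_distance N M : (N <= M)%N ->
  (\int[P]_w ((S M w - S N w) ^+ 2)%:E <= (3 / 2 * (A / N.+1%:R))%:E)%E.
Proof.
move=> NM; pose K := box d (b M); pose e n := a M n + -1 * a N n.
have SE w : S M w - S N w = lin G K e w.
  rewrite -linD mulN1r; congr (_ - _); apply: esym; apply: box_widen (b_homo NM) => n nN.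
  by rewrite a_supp ?mul0r.
under eq_integral do rewrite SE expr2.
rewrite (ipE (lin_sqint _ sG _) (lin_sqint _ sG _)) (ip_lin _ sG covG) lee_fin.
have /andP[_ le] := @bounds (box d (b M)) e (box_uniq d (b M)).
apply: le_trans le _; apply: ler_wpM2l; first by rewrite divr_ge0.
apply: le_trans (a_tail (b M) NM).
by apply: ler_sum => n _; rewrite /e mulN1r.
Qed.

Lemma limit_distance N : (\int[P]_w ((X w - S N w) ^+ 2)%:E <= (3 / 2 * (A / N.+1%:R))%:E)%E.
Proof.
apply: (@fatou_upper_bound _ _ _ P (fun M w => (S (M + N)%N w - S N w) ^+ 2)).
- by move=> M; apply: measurable_funX; exact: measurable_funB.
- by apply: measurable_funX; exact: measurable_funB.
- by move=> M w; exact: sqr_ge0.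
- by move=> w; exact: sqr_ge0.
- case: aX => Z [mZ Z0 sZ]; exists Z; split=> // w /= nw; apply: sZ => /= cvw; apply: nw.
  rewrite expr2; under eq_fun do rewrite expr2.
  have cv : (fun M => S (M + N)%N w - S N w) @ \oo --> X w - S N w.
    by apply: cvgB; [rewrite (cvg_shiftn N (fun M => S M w))|exact: cvg_cst].
  exact: cvgM.
- by move=> M; apply: partial_sum_distance; exact: leq_addl.
Qed.

(** The finite sums satisfy Q/2 <= E (S_M - Y)^2 <= 2 E (X - Y)^2 + 2 E (X - S_M)^2, and the last
    term tends to 0; hence the factor 1/4. *)
Lemma conditional_variance_bound (B : pred 'rV[int]_d) (Q : R) (M0 : nat) (Y : T -> R) :
  measurable_fun setT Y ->
  preimage_set_system setT Y measurable `<=` sigma_family [set n | B n] G ->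
  (forall n, B n -> (nsup n <= b M0)%N) ->
  (forall M, (M0 <= M)%N -> Q <= \sum_(n <- box d (b M) | ~~ B n) a M n ^+ 2) ->
  ((Q / 4)%:E <= \int[P]_w ((X w - Y w) ^+ 2)%:E)%E.
Proof.
move=> mY YF BM QM; set J := (\int[P]_w _)%E.
have J0 : (0 <= J)%E by apply: integral_ge0 => w _; rewrite lee_fin sqr_ge0.
have key M : (M0 <= M)%N -> ((Q / 2)%:E <= 2%:E * J + (3 * (A / M.+1%:R))%:E)%E.
  move=> M0M.
  apply: (@le_trans _ _ (\int[P]_w ((S M w - Y w) ^+ 2)%:E)%E).
    have low e : \sum_(n <- box d (b M)) e n ^+ 2 / 2 <= qform c (box d (b M)) e e.
      by have /andP[] := @bounds (box d (b M)) e (box_uniq d (b M)).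
    have BK n : B n -> n \in box d (b M).
      by move=> /BM; rewrite mem_box => /leq_trans; apply; exact: b_homo.
    apply: le_trans (residual_lower_bound jg sG EG covG (box_uniq d (b M)) low BK (a M) mY YF).
    by rewrite lee_fin -mulr_suml ler_wpM2r ?invr_ge0 // QM.
  rewrite (_ : (\int[P]_w ((S M w - Y w) ^+ 2)%:E)%E = (\int[P]_w (((X w - Y w) + - (X w - S M w)) ^+ 2)%:E)%E); last first.
    by apply: eq_integral => w _; congr ((_ ^+ 2)%:E); ring.
  have mXY : measurable_fun setT (fun w => X w - Y w) by exact: measurable_funB.
  have mXS : measurable_fun setT (fun w => - (X w - S M w)).
    by apply: measurableT_comp => //; exact: measurable_funB.
  apply: le_trans (integral_sqrD_le P mXY mXS) _.
  rewrite leeD2l //; under eq_integral do rewrite sqrrN.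
  apply: (@le_trans _ _ (2%:E * (3 / 2 * (A / M.+1%:R))%:E)%E).
    by rewrite lee_pmul2l // limit_distance.
  by rewrite -EFinM lee_fin le_eqVlt; apply/orP; left; apply/eqP; field.
case: (ltP J +oo%E) => [Joo|]; last by rewrite leye_eq => /eqP ->; rewrite leey.
have Jf : J \is a fin_num by rewrite ge0_fin_numE.
move: key; rewrite -(fineK Jf) lee_fin; set j := fine J => key.
apply/ler_addgt0Pr => e e0.
have [M M0M Me] : exists2 M, (M0 <= M)%N & A / M.+1%:R <= e / 2.
  have /cvgrPdist_le : (fun M : nat => A * M.+1%:R^-1) @ \oo --> (0 : R).
    by rewrite -[0](mulr0 A); apply: cvgMr; exact: cvg_harmonic.
  move=> /(_ (e / 2)) []; first by rewrite divr_gt0.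
  move=> M1 _ hM; exists (maxn M0 M1); first exact: leq_maxl.
  have /= := hM (maxn M0 M1) (leq_maxr _ _); rewrite sub0r normrN; apply: le_trans; exact: ler_norm.
have := key M M0M; rewrite -EFinM -EFinD lee_fin; move: Me; set z := A / _; lra.
Qed.

End GaussianSeries.

Section Norms.
Variables (R : realType) (d : nat).

Lemma nsup_le_norm (n : 'rV[int]_d) : (nsup n)%:R <= `|toR R n|.
Proof.
have [d0|d0] := posnP d.
  suff -> : nsup n = 0%N by exact: normr_ge0.
  by apply/eqP; rewrite -leqn0; apply/nsup_leP => i; move: (ltn_ord i); rewrite [X in (_ < X)%N]d0.
have [i ->] : exists i, nsup n = absz (n 0 i).
  have hd : (0 < #|'I_d|)%N by rewrite card_ord.
  by have [i ni] := bigop.eq_bigmax (fun i : 'I_d => absz (n 0 i)) hd; exists i.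
rewrite -abs_coord [leRHS]/Num.Def.normr /= mx_normrE; apply/bigmax_geP; right.
by exists (0, i) => //=; rewrite mxE.
Qed.

Lemma enormZ (a : R) (x : 'rV[R]_d) : 0 <= a -> enorm (a *: x) = a * enorm x.
Proof.
move=> a0; rewrite /enorm; under eq_bigr do rewrite mxE exprMn.
by rewrite -mulr_sumr sqrtrM ?sqr_ge0 // sqrtr_sqr ger0_norm.
Qed.

Lemma enorm_ge0 (x : 'rV[R]_d) : 0 <= enorm x. Proof. exact: sqrtr_ge0. Qed.

Lemma enorm_sqr (x : 'rV[R]_d) : enorm x ^+ 2 = \sum_i x 0 i ^+ 2.
Proof. by rewrite sqr_sqrtr // sumr_ge0 // => i _; exact: sqr_ge0. Qed.

Lemma rescaled_supported (hhat : 'rV[R]_d -> 'rV[R]_d) (ell : R) n : 0 < ell ->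
  supp hhat `<=` [set x | enorm x <= 1] -> ell < (nsup n)%:R -> hhat (ell^-1 *: toR R n) = 0.
Proof.
move=> ell0 hsub nell; apply: contraTeq nell => hn; rewrite -leNgt.
have /hsub /= : supp hhat (ell^-1 *: toR R n) by exact: subset_closure.
rewrite enormZ ?invr_ge0 ?(ltW ell0) // mulrC ler_pdivrMr // mul1r.
by apply: le_trans; exact: nsup_le_enorm.
Qed.

(** The lattice sum is a finitely supported big operator; bounded support of [h] identifies it with
    a sum over a box. *)
Lemma lattice_sum_box (h : 'rV[int]_d -> 'rV[R]_d) N :
  (forall n, (N < nsup n)%N -> h n = 0) ->
  \sum_(n \in [set: 'rV[int]_d]) h n = \sum_(n <- box d N) h n.
Proof.
move=> h0; rewrite [RHS]fsbig_seq ?box_uniq //; apply: esym; apply: fsbig_widen => // n [_ /= nN].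
by apply: h0; rewrite ltnNge -mem_box; apply/negP.
Qed.

End Norms.

Section SquareRoots.
Variable R : realType.

Lemma le_poweR_half (x : R) (y : \bar R) : 0 <= x ->
  ((x ^+ 2)%:E <= y)%E -> (x%:E <= y `^ 2^-1)%E.
Proof.
move=> x0 xy; have -> : x%:E = ((x ^+ 2)%:E `^ 2^-1)%E.
  by rewrite poweR_EFin powR12_sqrt ?sqr_ge0 // sqrtr_sqr ger0_norm.
apply: gt0_ler_poweR => //.
  by rewrite in_itv /= lee_fin sqr_ge0 leey.
by rewrite in_itv /= leey andbT; apply: le_trans xy; rewrite lee_fin sqr_ge0.
Qed.

Lemma powR_half_sqr (L : R) (d : nat) : 0 <= L -> (L `^ (- (d%:R / 2))) ^+ 2 = L^-1 ^+ d.
Proof.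
move=> L0; rewrite -powR_mulrn ?powR_ge0 // -powRrM mulNr divfK ?pnatr_eq0 //.
by rewrite powRN powR_mulrn // exprVn.
Qed.

End SquareRoots.

(** * Conditional variance of one increment *)

Section ConditionalVariance.
Context disp (T : measurableType disp) (R : realType) (P : probability T R) (d : nat).
Variables (G : 'rV[int]_d -> T -> R) (c : 'rV[int]_d -> 'rV[int]_d -> R).
Hypothesis d2 : (2 <= d)%N.
Hypothesis jg : jointly_gaussian P G.
Hypothesis sG : forall n, sqint P (G n).
Hypothesis EG : forall n, (\int[P]_w (G n w)%:E = 0)%E.
Hypothesis covG : forall n m, ip P (G n) (G m) = c n m.
Hypothesis bounds : forall (K : seq 'rV[int]_d) (a : 'rV[int]_d -> R), uniq K ->
  \sum_(n <- K) a n ^+ 2 / 2 <= qform c K a a <= 3 / 2 * \sum_(n <- K) a n ^+ 2.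

Lemma increment_conditional_variance (k : 'I_d) (w : 'rV[int]_d -> R) (C : R)
    (v : 'rV[int]_d -> R) (u : 'rV[int]_d -> T -> R) (L : R) (N : nat) (Y : T -> R) :
  is_dipole k w C -> decays v -> (forall n, measurable_fun setT (u n)) ->
  {ae P, forall w, decaying_solution (fun n => G n w *: grad v n) (u ^~ w)} ->
  L < N%:R -> measurable_fun setT Y ->
  preimage_set_system setT Y measurable `<=` sigma_family [set n | `|toR R n| <= L] G ->
  (((\sum_(n <- box d (2 * d * N) | (N <= nsup n)%N)
     (\sum_i (w (n + basis_vec i) - w n) * grad v n 0 i) ^+ 2) / 4)%:E
   <= \int[P]_x ((grad (u ^~ x) 0 0 k - Y x) ^+ 2)%:E)%E.
Proof.
move=> wC dv mu sol LN mY YF.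
have d0 : (0 < d)%N by exact: ltn_trans d2.
have [A A0 tail] := coef_tail d2 wC dv.
have small (n : 'rV[int]_d) : `|toR R n| <= L -> (nsup n < N)%N.
  by move=> nL; rewrite -(ltr_nat R); apply: le_lt_trans LN; apply: le_trans nL; exact: nsup_le_norm.
(* Since L < N, every observed index has nsup n < N and the annulus N <= |n| <= 2dN is unobserved.
   From M = 2dN + 1 on, the cutoff equals 1 on the annulus and next to it, so the coefficients there
   no longer depend on M. *)
apply: (@conditional_variance_bound _ _ _ P d G c jg sG EG covG bounds
  (fun M => coef w v M.+1) (fun M => (2 * d * M.+1 + 1)%N) A _ _ _ _ _ _
  (fun n => `|toR R n| <= L) _ (2 * d * N + 1)%N Y mY YF).
- by move=> M M' MM; rewrite leq_add2r leq_mul2l ltnS MM orbT.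
- by move=> M n nM; apply: (coef_outside d2) => //; exact: ltnW.
- move=> M M' B MM; apply: le_trans (tail M.+1 M'.+1 B _ _) _ => //.
  by apply: ler_wpM2l => //; rewrite lef_pV2 ?posrE ?ltr0n // ler_nat.
- have -> : (fun x => grad (u ^~ x) 0 0 k) = (fun x => u (basis_vec k) x - u 0 x).
    by apply/funext => x; rewrite mxE add0r.
  exact: measurable_funB.
- case: sol => Z [mZ Z0 sZ]; exists Z; split=> // x /= nx; apply: sZ => /= solx; apply: nx.
  exact: (increment_representation d2 wC solx).
- move=> n /small /ltnW nN; apply: leq_trans nN _.
  have dd : (0 < 2 * d)%N by rewrite muln_gt0.
  apply: leq_trans (leq_pmull N dd) _; apply: leq_trans (leq_addr 1 _).
  by apply: leq_trans (leq_pmull _ dd); rewrite leqW // leq_addr.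
- move=> M NM; rewrite [leRHS]big_mkcond /=.
  apply: le_trans (_ : \sum_(n <- box d (2 * d * N)) (if ~~ (`|toR R n| <= L) then coef w v M.+1 n ^+ 2 else 0) <= _).
    rewrite big_mkcond /= [leLHS]big_seq [leRHS]big_seq; apply: ler_sum => n; rewrite mem_box => nN.
    case: leqP => Nn; last by case: ifP => // _; exact: sqr_ge0.
    case: ifPn => [_|/negPn/small]; last by rewrite ltnNge Nn.
    by rewrite (coef_inside d2) //; move: nN NM; clear; lia.
  apply: sum_subset_le => [||n|n]; rewrite ?box_uniq ?mem_box //.
    by move/leq_trans; apply; move: NM d0; clear; nia.
  by case: ifP => // _; exact: sqr_ge0.
Qed.

End ConditionalVariance.

Theorem proposition1 (R : realType) (d : nat) (d_ge2 : (2 <= d)%N) :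
  exists2 beta_d : R, d%:R < beta_d &
  forall beta : R, beta_d <= beta ->
  exists c K : R, 0 < c /\ 0 < K /\
  forall (disp : measure_display) (T : measurableType disp)
    (P : probability T R) (G : 'rV[int]_d -> {RV P >-> R}),
  jointly_gaussian P (fun n => G n : T -> R) ->
  identically_distributed P (fun n => G n : T -> R) ->
  (forall n, 'E_P[G n] = 0)%E ->
  (forall n n', 'E_P[fun w => (G n w * G n' w)%R]
     = ((1 + enorm (toR R (n - n')%R)) `^ (- beta))%:E)%E ->
  forall (ell : R) (hhat : 'rV[R]_d -> 'rV[R]_d) (nu : 'rV[R]_d),
  1 <= ell ->
  compact (supp hhat) ->
  supp hhat `<=` [set x | enorm x <= 1] ->
  let h := fun n : 'rV[int]_d => hhat (ell^-1 *: toR R n) in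
  \sum_(n \in [set: 'rV[int]_d]) h n = ell ^+ d *: nu ->
  forall (v : 'rV[int]_d -> R) (ubar : 'rV[int]_d -> {RV P >-> R}),
  decaying_solution h v ->
  {ae P, forall w, decaying_solution (fun n => G n w *: grad v n)
                                     (fun n => ubar n w)} ->
  forall L : R, K * ell <= L ->
  let grad_ubar0 := fun w => grad (fun n => ubar n w) 0 in
  let F_L := sigma_family [set n | `|toR R n| <= L]
               (fun n => G n : T -> R) in
  forall Y : T -> 'rV[R]_d,
  (forall i : 'I_d, is_cond_expectation P F_L
     (fun w => grad_ubar0 w 0 i) (fun w => Y w 0 i)) ->
  ((c * enorm nu * ((ell / L) ^+ d * L `^ (- (d%:R / 2))))%:E
     <= 'E_P[fun w => (enorm (grad_ubar0 w - Y w) ^+ 2)%R] `^ 2^-1)%E.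
Proof.
have [w [C [C0 wC]]] := dipoles_exist R d_ge2.
have [c0 [r0 [c00 lower]]] := coefficient_lower_bound d_ge2 wC.
have [beta_d d_beta bounds] := lattice_cov_qform_bounds R d.
exists beta_d => // beta /bounds {}bounds.
(* The 1/4 is the loss in [conditional_variance_bound]; 2^(-3d) pays for replacing the integer
   radius N by 2L. *)
pose c := Num.sqrt (c0 / 4 * 2^-1 ^+ (3 * d)).
have c2 : c ^+ 2 = c0 / 4 * 2^-1 ^+ (3 * d).
  by rewrite sqr_sqrtr // mulr_ge0 ?exprn_ge0 ?divr_ge0 ?invr_ge0 // ltW.
(* As ell >= 1, this choice of K gives both ell <= L, so that [h] vanishes on the annulus, and r0 <=
   L, the range of the nondegeneracy estimate. *)
exists c, (1 + r0%:R); split.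
  by rewrite sqrtr_gt0 mulr_gt0 ?exprn_gt0 ?divr_gt0 ?invr_gt0.
split; first by rewrite ltr_pwDl.
move=> disp T P G jg _ EG covG ell hhat nu ell1 _ hsub h sum_h v ubar [eqv dv] sol L KL g F_L Y condY.
have ell0 : 0 < ell := lt_le_trans ltr01 ell1.
have KL' : ell + r0%:R * ell <= L by move: KL; rewrite mulrDl mul1r.
have ellL : ell <= L.
  by apply: le_trans KL'; rewrite lerDl mulr_ge0 // ltW.
have L1 : 1 <= L := le_trans ell1 ellL.
have L0 : 0 < L := lt_le_trans ltr01 L1.
(* The least integer above L: the annulus |n| >= N contains no observed index, and N <= 2L because L
   >= 1. *)
pose N := (Num.truncn L).+1.
have LN : L < N%:R := truncnS_gt L.
have NL : N%:R <= 2 * L.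
  rewrite mulr_natl mulr2n -natr1; apply: lerD => //.
  by rewrite truncn_le ltW.
have r0N : (r0 <= N)%N.
  rewrite -(ler_nat R) ltW //; apply: le_lt_trans LN; apply: le_trans KL'.
  rewrite -[leLHS]add0r; apply: lerD; first exact: ltW.
  by rewrite ler_peMr.
have h0 n : (N <= nsup n)%N -> h n = 0.
  move=> Nn; apply: (@rescaled_supported R d hhat ell n ell0 hsub); apply: le_lt_trans ellL _.
  by apply: lt_le_trans LN _; rewrite ler_nat.
have sG n : sqint P (G n : T -> R).
  split => //; have := covG n n; rewrite unlock.
  under eq_integral do rewrite -expr2.
  by move=> ->; exact: ltry.
have EG0 n : (\int[P]_x (G n x)%:E = 0)%E by have := EG n; rewrite unlock.
have ipG n m : ip P (G n : T -> R) (G m : T -> R) = lattice_cov beta n m.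
  by rewrite /ip; have := covG n m; rewrite unlock => ->.
have mY k : measurable_fun setT (fun x => Y x 0 k).
  by have [_ /measurable_int iY _] := condY k; exact/measurable_EFinP.
have mu n : measurable_fun setT (ubar n : T -> R) by [].
have mg k : measurable_fun setT (fun x => g x 0 k).
  have -> : (fun x => g x 0 k) = (fun x => ubar (basis_vec k) x - ubar 0 x).
    by apply/funext => x; rewrite mxE add0r.
  exact: measurable_funB.
pose D k x := (g x 0 k - Y x 0 k) ^+ 2.
have mD k : measurable_fun setT (fun x => (D k x)%:E).
  by apply/measurable_EFinP; apply: measurable_funX; exact: measurable_funB.
(* Conditional expectations are taken coordinatewise, so the squared error splits into one residual
   per direction [k]. *)
have -> : ('E_P[fun x => (enorm (g x - Y x) ^+ 2)%R] = \sum_k \int[P]_x (D k x)%:E)%E.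
  rewrite unlock -(ge0_integral_sum P measurableT mD) => [|k x _]; last by rewrite lee_fin sqr_ge0.
  apply: eq_integral => x _; rewrite sumEFin enorm_sqr; congr (_%:E).
  by apply: eq_bigr => k _; rewrite /D !mxE.
apply: le_poweR_half.
  rewrite !mulr_ge0 ?enorm_ge0 ?exprn_ge0 ?sqrtr_ge0 ?powR_ge0 //.
  by rewrite divr_ge0 // ltW.
pose Q k := \sum_(n <- box d (2 * d * N) | (N <= nsup n)%N)
     (\sum_i (w k (n + basis_vec i) - w k n) * grad v n 0 i) ^+ 2.
apply: (@le_trans _ _ (\sum_k (Q k / 4)%:E)%E); last first.
  apply: lee_sum => k _; have [YF _ _] := condY k.
  exact: (increment_conditional_variance d_ge2 jg sG EG0 ipG bounds (wC k) dv mu sol LN (mY k) YF).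
rewrite sumEFin lee_fin -mulr_suml ler_pdivlMr //.
have := lower N h v r0N (ltn0Sn _) h0 eqv.
rewrite (exchange_big _ _ _ _ _ _) /= => low; apply: le_trans low.
have -> : \sum_i (\sum_(n <- box d N) h n 0 i) ^+ 2 = (ell ^+ d) ^+ 2 * enorm nu ^+ 2.
  rewrite enorm_sqr mulr_sumr; apply: eq_bigr => i _.
  rewrite -summxE -(lattice_sum_box (h := h)) => [|n nN]; last by apply: h0; exact: ltnW.
  by rewrite sum_h mxE exprMn.
(* The square of (ell/L)^d L^(-d/2) is ell^(2d) L^(-3d), and the 2^(-3d) inside [c] turns L into
   2L. *)
have -> : (c * enorm nu * ((ell / L) ^+ d * L `^ (- (d%:R / 2)))) ^+ 2 * 4 =
    c0 * (2 * L)^-1 ^+ (3 * d) * ((ell ^+ d) ^+ 2 * enorm nu ^+ 2).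
  rewrite !exprMn powR_half_sqr ?(ltW L0) // c2 invfM exprMn (mulnC 3) 2!(exprM _ d 3).
  by set a := 2^-1 ^+ d; set b := L^-1 ^+ d; set e := ell ^+ d; field.
apply: ler_wpM2r; first by rewrite mulr_ge0 ?sqr_ge0.
apply: ler_wpM2l; first exact: ltW.
apply: lerXn2r; rewrite ?nnegrE ?invr_ge0 ?mulr_ge0 ?(ltW L0) //.
by rewrite lef_pV2 ?posrE ?mulr_gt0 // (lt_trans L0 LN).
Qed.
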